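(* Let $\theta>0$ and let $\tilde W_n'=\frac{W_n'-\mathbb E W_n'}{n^2}$, $\tilde T_n'=\frac{T_n'-\mathbb E T_n'}{n}$ for the Hoppe tree with parameter $\theta$. Then $(\tilde W_n',\tilde T_n')^t$ converges in distribution and with second moments to a random vector $(\tilde W',\tilde T')^t$ whose law satisfies $$\begin{pmatrix}\tilde W'\\ \tilde T'\end{pmatrix}\overset{d}{=}\begin{pmatrix}(1-V)^2 & V(1-V)\\ 0 & 1-V\end{pmatrix}\begin{pmatrix}\tilde W'\\ \tilde T'\end{pmatrix}+\begin{pmatrix}V^2 & V(1-V)\\ 0 & V\end{pmatrix}\begin{pmatrix}\tilde W\\ \tilde T\end{pmatrix}+b^\ast,$$ $$b^\ast=\begin{pmatrix}\Big(\frac{\theta+5}{\theta+1}-\frac{2\theta+4}{\theta+1}V\Big)V+\mathcal E(V)+\big(\Psi(\theta+1)-\Psi(2)\big)V\\[2pt] V+\mathcal E(V)+\big(\Psi(\theta+1)-\Psi(2)\big)V\end{pmatrix},$$ where $V\sim\beta(1,\theta)$, and $(\tilde W',\tilde T')$, $(\tilde W,\tilde T)$, $V$ are independent, with $(\tilde W,\tilde T)$ having the limit law for the random recursive tree described in the context. This law of $(\tilde W',\tilde T')$ is the unique solution of this equation among centered probability distributions on $\mathbb R^2$ with finite second moments.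
   Context: Let $(J_k)_{k\ge1}$ be independent with $\Pr(J_k=0)=\frac{\theta}{\theta+k-1}$ and $\Pr(J_k=i)=\frac{1}{\theta+k-1}$ for $i\in\{1,\dots,k-1\}$. The Hoppe tree with $n$ vertices has vertex set $\{0,\dots,n-1\}$, root $0$, parent of $k\ge1$ equal to $J_k$; for $\theta=1$ it is the random recursive tree. $T_n=\sum_{k=0}^{n-1}D_k$ ($D_k$ the depth of $k$) is the total length and $W_n=\sum_{0\le i<j\le n-1}\operatorname{dist}(i,j)$ the Wiener index; primes denote quantities for the Hoppe tree with parameter $\theta$, unprimed ones for the random recursive tree. $\mathcal E(v)=v\log v+(1-v)\log(1-v)$, $\Psi$ is the digamma function, $\beta(1,\theta)$ has density $\theta(1-v)^{\theta-1}$ on $(0,1)$. Known input (Neininger 2002): for the random recursive tree, $\big(\frac{W_n-\mathbb EW_n}{n^2},\frac{T_n-\mathbb ET_n}{n}\big)$ converges in distribution and with second moments to $(\tilde W,\tilde T)$, whose law is the unique centered finite-second-moment solution of $\begin{pmatrix}\tilde W\\ \tilde T\end{pmatrix}\overset d=\begin{pmatrix}(1-U)^2&U(1-U)\\0&1-U\end{pmatrix}\begin{pmatrix}\tilde W^\ast\\ \tilde T^\ast\end{pmatrix}+\begin{pmatrix}U^2&U(1-U)\\0&U\end{pmatrix}\begin{pmatrix}\tilde W\\ \tilde T\end{pmatrix}+\begin{pmatrix}3U(1-U)+\mathcal E(U)\\ U+\mathcal E(U)\end{pmatrix}$, with $(\tilde W,\tilde T),(\tilde W^\ast,\tilde T^\ast),U$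 independent, $(\tilde W^\ast,\tilde T^\ast)\overset d=(\tilde W,\tilde T)$, $U\sim\mathcal U[0,1]$. Convergence ''with second moments'' means convergence in distribution together with convergence of all second moments. *)

(* Defs.v *)
From HB Require Import structures.
From mathcomp Require Import all_boot all_order all_algebra.
From mathcomp Require Import all_classical all_reals all_analysis.
Set Implicit Arguments. Unset Strict Implicit. Unset Printing Implicit Defensive.
Import Order.TTheory GRing.Theory Num.Theory.
Import numFieldNormedType.Exports.
Local Open Scope classical_set_scope.
(* Combinatorics of recursive trees on vertex set {0,...,n-1}.               *)
(* A tree is encoded by its parent function J : nat -> nat with J k < k for *)
(* 1 <= k <= n-1 (J k is the parent of k; vertex 0 is the root).            *)

Fixpoint depth_fuel (J : nat -> nat) (fuel k : nat) : nat :=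
  match fuel with
  | 0 => 0
  | f.+1 => if k == 0 then 0 else (depth_fuel J f (J k)).+1
  end.
(* fuel k suffices since J k < k *)
Definition depth (J : nat -> nat) (k : nat) : nat := depth_fuel J k k.

(* graph distance in the tree: since labels increase along root-to-leaf
   paths, the larger of two distinct vertices is not an ancestor of the
   smaller one, so the path goes through its parent. *)
Fixpoint dist_fuel (J : nat -> nat) (fuel i j : nat) : nat :=
  match fuel with
  | 0 => 0
  | f.+1 => if i == j then 0
            else if j < i then (dist_fuel J f (J i) j).+1
            else (dist_fuel J f i (J j)).+1
  end.
Definition tdist (J : nat -> nat) (i j : nat) : nat := dist_fuel J (i + j) i j.

Definition total_length (n : nat) (J : nat -> nat) : nat :=
  \sum_(k < n) depth J k.
Definition wiener (n : nat) (J : nat -> nat) : nat :=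
  \sum_(i < n) \sum_(j < n | i < j) tdist J i j.

Definition valid_parents (n : nat) (p : {ffun 'I_n -> 'I_n}) : bool :=
  [forall k : 'I_n, if k == 0 :> nat then p k == 0 :> nat else p k < k].

Definition parent_fun (n : nat) (p : {ffun 'I_n -> 'I_n}) (k : nat) : nat :=
  odflt 0%N (omap (fun i : 'I_n => nat_of_ord (p i)) (insub k)).

Local Open Scope ring_scope.

Section Hoppe.
Variable R : realType.

(* Probability that the Hoppe tree with parameter theta and n vertices has
   parent vector p: product over k = 1..n-1 of P(J_k = p k), where
   P(J_k = 0) = theta/(theta+k-1), P(J_k = i) = 1/(theta+k-1), 1<=i<=k-1. *)
Definition hoppe_prob (theta : R) (n : nat) (p : {ffun 'I_n -> 'I_n}) : R :=
  if valid_parents p then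
    \prod_(k < n | (0 < k)%N)
       ((if p k == 0 :> nat then theta else 1) / (theta + k%:R - 1))
  else 0.

Definition hoppeE (theta : R) (n : nat) (g : (nat -> nat) -> R) : R :=
  \sum_(p : {ffun 'I_n -> 'I_n}) hoppe_prob theta p * g (parent_fun p).

Definition hoppe_normalized (theta : R) (n : nat) (J : nat -> nat) : R * R :=
  (((wiener n J)%:R - hoppeE theta n (fun J' => (wiener n J')%:R)) / (n%:R ^+ 2),
   ((total_length n J)%:R - hoppeE theta n (fun J' => (total_length n J')%:R))
      / n%:R).

Definition hoppe_normE (theta : R) (n : nat) (f : R * R -> R) : R :=
  hoppeE theta n (fun J => f (hoppe_normalized theta n J)).

Local Open Scope ereal_scope.

Definition bounded_continuous (f : R * R -> R) : Prop :=
  continuous f /\ exists M : R, forall x, (`|f x| <= M)%R.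

Definition finite_second_moments (mu : probability (R * R)%type R) : Prop :=
  mu.-integrable setT (fun x => ((x.1) ^+ 2)%:E) /\
  mu.-integrable setT (fun x => ((x.2) ^+ 2)%:E).

Definition centered_L2 (mu : probability (R * R)%type R) : Prop :=
  finite_second_moments mu /\
  \int[mu]_x (x.1)%:E = 0 /\ \int[mu]_x (x.2)%:E = 0.

(* The laws E n (finitely supported, given as expectation functionals)
   converge in distribution and with second moments to mu. *)
Definition cvg_dist_L2 (E : nat -> (R * R -> R) -> R)
  (mu : probability (R * R)%type R) : Prop :=
  (forall f, bounded_continuous f ->
     (fun n => (E n f)%:E) @ \oo --> \int[mu]_x (f x)%:E) /\
  finite_second_moments mu /\
  (fun n => (E n (fun x => x.1 ^+ 2))%:E) @ \oo --> \int[mu]_x (x.1 ^+ 2)%:E /\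
  (fun n => (E n (fun x => x.2 ^+ 2))%:E) @ \oo --> \int[mu]_x (x.2 ^+ 2)%:E /\
  (fun n => (E n (fun x => x.1 * x.2))%:E) @ \oo --> \int[mu]_x (x.1 * x.2)%:E.

Definition Mleft (v : R) (x : R * R) : R * R :=
  ((1 - v) ^+ 2 * x.1 + v * (1 - v) * x.2, (1 - v) * x.2)%R.
Definition Mright (v : R) (x : R * R) : R * R :=
  (v ^+ 2 * x.1 + v * (1 - v) * x.2, v * x.2)%R.

(* mu is the law of  Mleft(V) X + Mright(V) Y + b(V), where X ~ mu1,
   Y ~ mu2, and V has density dens on (0,1), all independent.
   Equality in law is tested on bounded continuous functions. *)
Definition fixed_point_eq (dens : R -> R) (b : R -> R * R)
  (mu mu1 mu2 : probability (R * R)%type R) : Prop :=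
  forall f, bounded_continuous f ->
    \int[mu]_z (f z)%:E =
    \int[lebesgue_measure]_(v in `]0%R, 1%R[)
       ((dens v)%:E *
        \int[mu1]_x \int[mu2]_y
           (f (Mleft v x + Mright v y + b v)%R)%:E).

Definition entropyE (v : R) : R := (v * ln v + (1 - v) * ln (1 - v))%R.

Definition digamma (x : R) : R :=
  limn (fun n : nat => ln n%:R - \sum_(k < n.+1) (x + k%:R)^-1)%R.

Definition unif_dens (v : R) : R := 1%R.
Definition beta1_dens (theta : R) (v : R) : R := (theta * (1 - v) `^ (theta - 1))%R.

Definition b_rrt (u : R) : R * R :=
  (3 * u * (1 - u) + entropyE u, u + entropyE u)%R.
Definition b_hoppe (theta : R) (v : R) : R * R :=
  (((theta + 5) / (theta + 1) - (2 * theta + 4) / (theta + 1) * v) * v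
     + entropyE v + (digamma (theta + 1) - digamma 2) * v,
   v + entropyE v + (digamma (theta + 1) - digamma 2) * v)%R.

End Hoppe.

(* Main.v *)
Require Import Defs.
From HB Require Import structures.
From mathcomp Require Import all_boot all_order all_algebra.
From mathcomp Require Import all_classical all_reals all_analysis.
From mathcomp Require Import measurable_realfun.
From mathcomp Require Import ring lra zify.
Set Implicit Arguments. Unset Strict Implicit. Unset Printing Implicit Defensive.
Import Order.TTheory GRing.Theory Num.Theory.
Import numFieldNormedType.Exports.
Local Open Scope classical_set_scope.
Local Open Scope ring_scope.

(* Hanging the subtree of vertex 1 below the rest of the tree encodes a
   recursive tree as a binary tree, on which a growth step replaces a leaf by a
   pair of leaves.  With [s = theta + n - 1], the pair
   [(w + (theta - 1) t) / (s (s + 1)), t / s], where [w] and [t] are the centered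
   Wiener index and total length, is a martingale whose increments have
   variances of order [(log n / n)^2]; realising all tree sizes on the unit
   interval, it converges in mean square, which gives the limit law [mu], the
   second moments, and a rate uniform over Lipschitz test functions.  The same
   argument for [theta = 1] identifies [nu].  Given the proportion [v] of the
   subtree of vertex 1, which is a beta mixture of binomials, the two parts of
   the tree are independent Hoppe and random recursive trees, so the fixed-point
   equation follows from Bernstein's law of large numbers.  It is affine, and
   [Mleft v] contracts the l1 norm by [1 - v^2], whence uniqueness. *)

(** * Recursive trees as binary trees *)

(** The root carries weight [theta], so the conditional mean of the Wiener index after a growth step
    contains [(theta - 1) t]; the mean of [w + (theta - 1) t] is a multiple of itself plus a
    deterministic term, which is why this combination replaces [w]. The obstacle in the fixed-point
    equation is that both subtree sizes are random and that, once one subtree is fixed, the other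
    one meets a test function depending on that subtree and on the size. Convergence in law at each
    fixed test function does not cover this. All these functions share one Lipschitz constant, so a
    rate uniform over Lipschitz functions does, and mean-square convergence on one probability space
    provides it. The law [nu] is known through bounded continuous functions; it obtains its rate by
    agreeing on bounded Lipschitz ones with the limit constructed for [theta = 1]. Equations are
    proved for bounded Lipschitz functions and carried to bounded continuous ones by Lipschitz
    envelopes. Uniqueness compares two solutions on Lipschitz functions, where averaging over [v]
    gives the factor [E (1 - V^2) < 1]. *)

(* [Leaf l] is the one-vertex tree; [Join r s] is the tree [r] with the tree
   [s] hung below its root as the oldest child.  A new child of the vertex
   [j] then always replaces the leaf [j] by a [Join] of two leaves. *)
Inductive btree := Leaf of nat | Join of btree & btree.

Fixpoint leaves (b : btree) : seq nat :=
  match b with Leaf l => [:: l] | Join r s => leaves r ++ leaves s end.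

Fixpoint lroot (b : btree) : nat :=
  match b with Leaf l => l | Join r _ => lroot r end.

Fixpoint bsize (b : btree) : nat :=
  match b with Leaf _ => 1 | Join r s => (bsize r + bsize s)%N end.

Fixpoint bT (b : btree) : nat :=
  match b with Leaf _ => 0 | Join r s => (bT r + bT s + bsize s)%N end.

(** A path between [r] and [s] runs through both roots and the edge joining them; summing the two
    depths and this edge over all pairs gives the last three terms. *)
Fixpoint bW (b : btree) : nat :=
  match b with
  | Leaf _ => 0
  | Join r s => (bW r + bW s + bsize r * bT s + bsize s * bT r
                 + bsize r * bsize s)%N
  end.

Fixpoint bdepth (b : btree) (l : nat) : nat :=
  match b with
  | Leaf _ => 0
  | Join r s => if l \in leaves r then bdepth r l else (bdepth s l).+1
  end.

Fixpoint bdist (b : btree) (i j : nat) : nat :=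
  match b with
  | Leaf _ => 0
  | Join r s =>
    if i \in leaves r then
      if j \in leaves r then bdist r i j else (bdepth r i + bdepth s j).+1
    else
      if j \in leaves r then (bdepth r j + bdepth s i).+1 else bdist s i j
  end.

Fixpoint ins (b : btree) (j n : nat) : btree :=
  match b with
  | Leaf l => if l == j then Join (Leaf l) (Leaf n) else Leaf l
  | Join r s => Join (ins r j n) (ins s j n)
  end.

(** The growth kernel acts on shapes; giving every leaf the label 0 makes trees with different
    labellings equal. *)
Fixpoint erase (b : btree) : btree :=
  match b with Leaf _ => Leaf 0 | Join r s => Join (erase r) (erase s) end.

Fixpoint btree_of (J : nat -> nat) (n : nat) : btree :=
  match n with
  | 0 => Leaf 0
  | m.+1 => ins (btree_of J m) (J m.+1) m.+1
  end.

Lemma bsize_leaves b : bsize b = size (leaves b).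
Proof. by elim: b => //= r -> s ->; rewrite size_cat. Qed.

Lemma bsize_gt0 b : (0 < bsize b)%N.
Proof. by elim: b => //= r Hr s Hs; rewrite addn_gt0 Hr. Qed.

Lemma bsize_erase b : bsize (erase b) = bsize b.
Proof. by elim: b => //= r -> s ->. Qed.

Lemma bT_erase b : bT (erase b) = bT b.
Proof. by elim: b => //= r -> s ->; rewrite bsize_erase. Qed.

Lemma bW_erase b : bW (erase b) = bW b.
Proof. by elim: b => //= r -> s ->; rewrite !bsize_erase !bT_erase. Qed.

Lemma lroot_leaves b : lroot b \in leaves b.
Proof. by elim: b => [l|r Hr s _] /=; rewrite ?mem_seq1 // mem_cat Hr. Qed.

Lemma ins_notin b j n : j \notin leaves b -> ins b j n = b.
Proof.
elim: b => [l|r Hr s Hs] /=; first by rewrite mem_seq1 eq_sym => /negbTE ->.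
by rewrite mem_cat negb_or => /andP[/Hr -> /Hs ->].
Qed.

Lemma mem_leaves_ins b j n x :
  j \in leaves b -> (x \in leaves (ins b j n)) = (x == n) || (x \in leaves b).
Proof.
elim: b => [l|r Hr s Hs] /=.
  by rewrite mem_seq1 eq_sym => /eqP ->; rewrite eqxx /= !inE orbC.
rewrite mem_cat => jb; rewrite !mem_cat.
have [jr|jr] := boolP (j \in leaves r); have [js|js] := boolP (j \in leaves s).
- by rewrite Hr // Hs //; case: (x == n).
- by rewrite Hr // (ins_notin n js) orbA.
- by rewrite Hs // (ins_notin n jr) orbCA.
- by move: jb; rewrite (negbTE jr) (negbTE js).
Qed.

Lemma perm_leaves_ins b j n : uniq (leaves b) -> j \in leaves b ->
  perm_eq (leaves (ins b j n)) (n :: leaves b).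
Proof.
elim: b => [l|r Hr s Hs] /=.
  by rewrite mem_seq1 eq_sym => _ /eqP ->; rewrite eqxx /= (perm_catC [:: j] [:: n]).
rewrite cat_uniq mem_cat => /and3P[ur /hasPn rs us] /orP[jr|js].
  have js : j \notin leaves s by apply/negP => /rs; rewrite jr.
  by rewrite (ins_notin n js) -cat_cons perm_cat2r Hr.
have jr : j \notin leaves r by exact: rs.
rewrite (ins_notin n jr) -cat1s perm_sym.
rewrite (perm_catCA [:: n] (leaves r) (leaves s)) perm_cat2l perm_sym.
exact: Hs.
Qed.

Lemma bsize_ins b j n : uniq (leaves b) -> j \in leaves b ->
  bsize (ins b j n) = (bsize b).+1.
Proof.
by move=> ub jb; rewrite !bsize_leaves (perm_size (perm_leaves_ins n ub jb)).
Qed.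

Lemma lroot_ins b j n : lroot (ins b j n) = lroot b.
Proof. by elim: b => [l|r Hr s _] //=; case: (l == j). Qed.

Lemma bdepth_ins b j n i : uniq (leaves b) -> j \in leaves b ->
  n \notin leaves b -> i \in leaves b -> bdepth (ins b j n) i = bdepth b i.
Proof.
elim: b => [l|r Hr s Hs] /=.
  by rewrite !mem_seq1 => _ /eqP -> _ /eqP ->; rewrite eqxx /= mem_seq1 eqxx.
rewrite cat_uniq !mem_cat negb_or => /and3P[ur /hasPn rs us] /orP[jr|js]
  /andP[nr ns] ib.
  have js : j \notin leaves s by apply/negP => /rs; rewrite jr.
  rewrite (ins_notin n js) mem_leaves_ins //.
  have -> : (i == n) = false.
    by apply/eqP => e; move: ib; rewrite e (negbTE nr) (negbTE ns).
  by rewrite /=; case: ifP => // ir; rewrite Hr.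
have jr : j \notin leaves r by exact: rs.
rewrite (ins_notin n jr); case: ifP => // ir; rewrite Hs //.
by move: ib; rewrite ir.
Qed.

Lemma bdepth_ins_new b j n : uniq (leaves b) -> j \in leaves b ->
  n \notin leaves b -> bdepth (ins b j n) n = (bdepth b j).+1.
Proof.
elim: b => [l|r Hr s Hs] /=.
  rewrite !mem_seq1 => _ /eqP ->; rewrite eqxx /= mem_seq1.
  by move=> /negbTE ->.
rewrite cat_uniq !mem_cat negb_or => /and3P[ur /hasPn rs us] /orP[jr|js]
  /andP[nr ns].
  by rewrite jr mem_leaves_ins // eqxx /= Hr.
have jr : j \notin leaves r by exact: rs.
by rewrite (ins_notin n jr) (negbTE nr) (negbTE jr) Hs.
Qed.

Lemma bdist_ins b j n i k : uniq (leaves b) -> j \in leaves b ->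
  n \notin leaves b -> i \in leaves b -> k \in leaves b ->
  bdist (ins b j n) i k = bdist b i k.
Proof.
elim: b => [l|r Hr s Hs] /=.
  rewrite !mem_seq1 => _ /eqP -> _ /eqP -> /eqP ->.
  by rewrite eqxx /= mem_seq1 eqxx.
rewrite cat_uniq !mem_cat negb_or => /and3P[ur /hasPn rs us] /orP[jr|js]
  /andP[nr ns] ib kb.
  have js : j \notin leaves s by apply/negP => /rs; rewrite jr.
  rewrite (ins_notin n js) !mem_leaves_ins //.
  have -> : (i == n) = false.
    by apply/eqP => e; move: ib; rewrite e (negbTE nr) (negbTE ns).
  have -> : (k == n) = false.
    by apply/eqP => e; move: kb; rewrite e (negbTE nr) (negbTE ns).
  rewrite /=; case: ifP => ir; case: ifP => kr //.
  - by rewrite Hr.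
  - by rewrite bdepth_ins.
  - by rewrite bdepth_ins.
have jr : j \notin leaves r by exact: rs.
rewrite (ins_notin n jr); case: ifP => ir; case: ifP => kr //.
- by rewrite bdepth_ins //; move: kb; rewrite kr.
- by rewrite bdepth_ins //; move: ib; rewrite ir.
- by rewrite Hs //; [move: ib; rewrite ir | move: kb; rewrite kr].
Qed.

Lemma bdist_ins_new b j n i : uniq (leaves b) -> j \in leaves b ->
  n \notin leaves b -> i \in leaves b ->
  bdist (ins b j n) i n = (bdist b i j).+1.
Proof.
elim: b => [l|r Hr s Hs] /=.
  rewrite !mem_seq1 => _ /eqP -> nl /eqP ->.
  by rewrite eqxx /= !mem_seq1 eqxx (negbTE nl).
rewrite cat_uniq !mem_cat negb_or => /and3P[ur /hasPn rs us] /orP[jr|js]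
  /andP[nr ns] ib.
  have js : j \notin leaves s by apply/negP => /rs; rewrite jr.
  rewrite (ins_notin n js) !mem_leaves_ins // eqxx /= jr.
  have -> : (i == n) = false.
    by apply/eqP => e; move: ib; rewrite e (negbTE nr) (negbTE ns).
  rewrite /=; case: ifP => ir; first by rewrite Hr.
  by rewrite bdepth_ins_new.
have jr : j \notin leaves r by exact: rs.
rewrite (ins_notin n jr) (negbTE nr) (negbTE jr); case: ifP => ir.
  by rewrite bdepth_ins_new // addnS.
by rewrite Hs //; move: ib; rewrite ir.
Qed.

Lemma bdist_sym b i j : bdist b i j = bdist b j i.
Proof. by elim: b => //= r -> s ->; do 2 case: (_ \in _). Qed.

Lemma bdist_refl b i : bdist b i i = 0%N.
Proof. by elim: b => //= r -> s ->; case: (_ \in _). Qed.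

Lemma bT_sum b : uniq (leaves b) -> bT b = (\sum_(i <- leaves b) bdepth b i)%N.
Proof.
elim: b => [l|r Hr s Hs] /=; first by rewrite big_seq1.
rewrite cat_uniq => /and3P[ur /hasPn rs us].
rewrite big_cat /= -addnA; congr (_ + _)%N.
  by rewrite Hr // big_seq_cond [in RHS]big_seq_cond; apply: eq_bigr => i /andP[-> _].
rewrite Hs // bsize_leaves -sum1_size -big_split /=.
rewrite big_seq_cond [in RHS]big_seq_cond.
by apply: eq_bigr => i /andP[/rs /negbTE -> _]; rewrite addn1.
Qed.

Lemma bT_ins b j n : uniq (leaves b) -> j \in leaves b ->
  bT (ins b j n) = (bT b + (bdepth b j).+1)%N.
Proof.
elim: b => [l|r Hr s Hs] /=.
  by rewrite mem_seq1 => _ /eqP ->; rewrite eqxx.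
rewrite cat_uniq mem_cat => /and3P[ur /hasPn rs us] /orP[jr|js].
  have js : j \notin leaves s by apply/negP => /rs; rewrite jr.
  by rewrite (ins_notin n js) jr Hr //; lia.
have jr : j \notin leaves r by exact: rs.
by rewrite (ins_notin n jr) (negbTE jr) Hs // bsize_ins //; lia.
Qed.

(** The new leaf adds its distances to all old vertices, each one more than the distance to [j]. For
    vertices on the other side of a [Join] this distance splits at the joining edge, so that their
    sum involves only the size and [bT] of that side. *)
Lemma bW_ins b j n : uniq (leaves b) -> j \in leaves b ->
  bW (ins b j n) = (bW b + \sum_(i <- leaves b) (bdist b i j).+1)%N.
Proof.
elim: b => [l|r Hr s Hs] /=.
  by rewrite mem_seq1 => _ /eqP ->; rewrite eqxx big_seq1.
rewrite cat_uniq mem_cat => /and3P[ur /hasPn rs us] /orP[jr|js].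
  have js : j \notin leaves s by apply/negP => /rs; rewrite jr.
  rewrite (ins_notin n js) jr Hr // bT_ins // bsize_ins // big_cat /=.
  have -> : (\sum_(i <- leaves r) (if i \in leaves r then bdist r i j
      else (bdepth r j + bdepth s i).+1).+1 =
      \sum_(i <- leaves r) (bdist r i j).+1)%N.
    by rewrite big_seq_cond [in RHS]big_seq_cond; apply: eq_bigr => i /andP[-> _].
  have -> : (\sum_(i <- leaves s) (if i \in leaves r then bdist r i j
      else (bdepth r j + bdepth s i).+1).+1 =
      bsize s * (bdepth r j).+2 + bT s)%N.
    rewrite (bT_sum us) bsize_leaves -sum1_size big_distrl -big_split /=.
    rewrite big_seq_cond [in RHS]big_seq_cond.
    by apply: eq_bigr => i /andP[/rs /negbTE -> _]; lia.
  by lia.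
have jr : j \notin leaves r by exact: rs.
rewrite (ins_notin n jr) (negbTE jr) Hs // bT_ins // bsize_ins // big_cat /=.
have -> : (\sum_(i <- leaves r) (if i \in leaves r then (bdepth r i + bdepth s j).+1
      else bdist s i j).+1 = bsize r * (bdepth s j).+2 + bT r)%N.
  rewrite (bT_sum ur) bsize_leaves -sum1_size big_distrl -big_split /=.
  rewrite big_seq_cond [in RHS]big_seq_cond.
  by apply: eq_bigr => i /andP[-> _]; lia.
have -> : (\sum_(i <- leaves s) (if i \in leaves r then (bdepth r i + bdepth s j).+1
      else bdist s i j).+1 = \sum_(i <- leaves s) (bdist s i j).+1)%N.
  rewrite big_seq_cond [in RHS]big_seq_cond.
  by apply: eq_bigr => i /andP[/rs /negbTE -> _].
by lia.
Qed.

(** * Depths and distances of a parent function, read in its binary tree *)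

Section tree_of_parents.
Variables (J : nat -> nat) (n : nat).
Hypothesis J_lt : forall k, (0 < k <= n)%N -> (J k < k)%N.

Lemma leaves_btree_of m : (m <= n)%N ->
  perm_eq (leaves (btree_of J m)) (iota 0 m.+1).
Proof.
elim: m => // m IH mn.
have IHm := IH (ltnW mn).
have um : uniq (leaves (btree_of J m)) by rewrite (perm_uniq IHm) iota_uniq.
have Jm : J m.+1 \in leaves (btree_of J m).
  by rewrite (perm_mem IHm) mem_iota /= J_lt.
rewrite -[m.+2]addn1 iotaD -cat_rcons cats0 ?cats1.
rewrite perm_sym perm_rcons perm_sym.
rewrite (permPl (perm_leaves_ins _ um Jm)).
by rewrite perm_cons.
Qed.

Lemma uniq_btree_of m : (m <= n)%N -> uniq (leaves (btree_of J m)).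
Proof. by move=> mn; rewrite (perm_uniq (leaves_btree_of mn)) iota_uniq. Qed.

Lemma mem_btree_of m i : (m <= n)%N ->
  (i \in leaves (btree_of J m)) = (i <= m)%N.
Proof. by move=> mn; rewrite (perm_mem (leaves_btree_of mn)) mem_iota. Qed.

Lemma lroot_btree_of m : lroot (btree_of J m) = 0%N.
Proof. by elim: m => //= m <-; rewrite lroot_ins. Qed.

Lemma depth_fuelE f k : (k <= f)%N -> (k <= n)%N ->
  depth_fuel J f k = depth_fuel J k k.
Proof.
elim/ltn_ind: k f => k IH [|f]; first by case: k {IH}.
case: k IH => // k IH kf kn /=.
have Jk : (J k.+1 < k.+1)%N by rewrite J_lt.
by rewrite (IH _ Jk f) ?(IH _ Jk k) //; lia.
Qed.

Lemma depthS k : (k < n)%N -> depth J k.+1 = (depth J (J k.+1)).+1.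
Proof.
move=> kn; rewrite /depth /= depth_fuelE //.
- by have := @J_lt k.+1; lia.
- by have := @J_lt k.+1; lia.
Qed.

(** The sum of the two labels drops at every step, so all fuels from [i + j] on agree. A recursive
    call made with leftover fuel is thereby again a [tdist]. *)
Lemma dist_fuelE f i j : (i + j <= f)%N -> (i <= n)%N -> (j <= n)%N ->
  dist_fuel J f i j = tdist J i j.
Proof.
rewrite /tdist; move Es : (i + j)%N => s.
elim/ltn_ind: s f i j Es => s IH [|f] i j Es; first by case: s {IH} Es.
move=> sf i_n j_n; case: s IH Es sf => [|s] IH Es sf.
  have [-> ->] : i = 0%N /\ j = 0%N by lia.
  by [].
rewrite /=; case: eqP => // /eqP ij; case: ltnP => ji.
  have Ji : (J i < i)%N by apply: J_lt; lia.
  by rewrite (IH (J i + j)%N _ f) ?(IH (J i + j)%N _ s) //; lia.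
have Jj : (J j < j)%N by apply: J_lt; lia.
by rewrite (IH (i + J j)%N _ f) ?(IH (i + J j)%N _ s) //; lia.
Qed.

Lemma tdistS i k : (i <= k)%N -> (k < n)%N ->
  tdist J i k.+1 = (tdist J i (J k.+1)).+1.
Proof.
move=> ik kn; rewrite {1}/tdist addnS /=.
have Jk : (J k.+1 < k.+1)%N by rewrite J_lt.
have -> : (i == k.+1) = false by apply/negbTE; lia.
have -> : (k.+1 < i)%N = false by apply/negbTE; lia.
by rewrite dist_fuelE //; lia.
Qed.

Lemma tdist_refl i : tdist J i i = 0%N.
Proof. by case: i => [|i] //=; rewrite /tdist addnS /= eqxx. Qed.

Lemma tdist_sym i j : tdist J i j = tdist J j i.
Proof.
rewrite /tdist [(j + i)%N]addnC; move: (i + j)%N => f.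
elim: f i j => // f IH i j /=; rewrite eq_sym.
by case: ltngtP => // _; rewrite IH.
Qed.

Lemma bdepth_btree_of m i : (m <= n)%N -> (i <= m)%N ->
  bdepth (btree_of J m) i = depth J i.
Proof.
elim: m i => [|m IH] i mn im; first by have -> : i = 0%N by lia.
have um := uniq_btree_of (ltnW mn).
have Jm : (J m.+1 < m.+1)%N by rewrite J_lt.
have Jl : J m.+1 \in leaves (btree_of J m) by rewrite mem_btree_of // ltnW.
have nl : m.+1 \notin leaves (btree_of J m).
  by rewrite mem_btree_of ?ltnn // ltnW.
move: im; rewrite leq_eqVlt => /predU1P[->|im] /=.
  by rewrite bdepth_ins_new // depthS // IH // ltnW.
have il : i \in leaves (btree_of J m) by rewrite mem_btree_of // ltnW.
by rewrite bdepth_ins // IH // ltnW.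
Qed.

Lemma bdist_btree_of m i j : (m <= n)%N -> (i <= j)%N -> (j <= m)%N ->
  bdist (btree_of J m) i j = tdist J i j.
Proof.
elim: m i j => [|m IH] i j mn ij jm.
  have [-> ->] : i = 0%N /\ j = 0%N by lia.
  by [].
have um := uniq_btree_of (ltnW mn).
have Jm : (J m.+1 < m.+1)%N by rewrite J_lt.
have Jl : J m.+1 \in leaves (btree_of J m) by rewrite mem_btree_of // ltnW.
have nl : m.+1 \notin leaves (btree_of J m).
  by rewrite mem_btree_of ?ltnn // ltnW.
have [->|ij'] := eqVneq i j; first by rewrite bdist_refl tdist_refl.
have im : (i <= m)%N by lia.
move: jm; rewrite leq_eqVlt => /predU1P[ejm|jm]; last first.
  have jl : j \in leaves (btree_of J m) by rewrite mem_btree_of // ltnW.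
  have il : i \in leaves (btree_of J m) by rewrite mem_btree_of // ltnW.
  by rewrite /= bdist_ins // IH // ltnW.
have il : i \in leaves (btree_of J m) by rewrite mem_btree_of // ltnW.
rewrite ejm /= bdist_ins_new // tdistS //; congr S.
have [iJ|Ji] := leqP i (J m.+1); first by rewrite IH // ltnW.
by rewrite bdist_sym tdist_sym IH ?(ltnW Ji) // ltnW.
Qed.

Lemma total_length_btree_of m : (m <= n)%N ->
  total_length m.+1 J = bT (btree_of J m).
Proof.
move=> mn; rewrite bT_sum ?uniq_btree_of // (perm_big _ (leaves_btree_of mn)).
rewrite /total_length -[iota 0 m.+1]/(index_iota 0 m.+1) big_mkord.
by apply: eq_bigr => i _; rewrite bdepth_btree_of // -ltnS.
Qed.

Lemma wiener_btree_of m : (m <= n)%N -> wiener m.+1 J = bW (btree_of J m).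
Proof.
elim: m => [|m IH] mn; first by rewrite /wiener big_ord1 big1 // => i; case: i => -[].
have um := uniq_btree_of (ltnW mn).
have Jm : (J m.+1 < m.+1)%N by rewrite J_lt.
have Jl : J m.+1 \in leaves (btree_of J m) by rewrite mem_btree_of // ltnW.
rewrite /= bW_ins // -(IH (ltnW mn)) /wiener big_ord_recr /=.
rewrite [X in (_ + X)%N]big1 ?addn0; last first.
  by move=> i; rewrite ltnNge -ltnS ltn_ord.
have -> : (\sum_(i <- leaves (btree_of J m)) (bdist (btree_of J m) i (J m.+1)).+1
    = \sum_(i < m.+1) tdist J i m.+1)%N.
  rewrite (perm_big _ (leaves_btree_of (ltnW mn))).
  rewrite -[iota 0 m.+1]/(index_iota 0 m.+1) big_mkord; apply: eq_bigr => i _.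
  have im : (i <= m)%N by rewrite -ltnS.
  rewrite tdistS //; have [iJ|Ji] := leqP i (J m.+1).
    by rewrite bdist_btree_of // ltnW.
  by rewrite bdist_sym tdist_sym bdist_btree_of ?(ltnW Ji) // ltnW.
rewrite -big_split; apply: eq_bigr => i _ /=.
by rewrite [LHS]big_mkcond big_ord_recr /= -big_mkcond ltn_ord.
Qed.

End tree_of_parents.

(** * The growth kernel *)

Section growth.
Variable R : realType.
Implicit Types (theta : R) (b : btree) (F : btree -> R).

(** The successors of a shape with unnormalised weights. The root is the leftmost leaf, so [theta]
    is passed to the left; [s] consists of ordinary vertices, hence the parameter 1. The weights add
    up to [theta + bsize b - 1]. *)
Fixpoint wsuccs theta b : seq (R * btree) :=
  match b with
  | Leaf l => [:: (theta, Join (Leaf l) (Leaf 0))]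
  | Join r s => [seq (p.1, Join p.2 s) | p <- wsuccs theta r]
                ++ [seq (p.1, Join r p.2) | p <- wsuccs 1 s]
  end.

Definition gsum theta F b : R := \sum_(p <- wsuccs theta b) p.1 * F p.2.

(** The growth step without its weights: it restricts the comparison of summands to trees that can
    arise from [b]. *)
Inductive grow : btree -> btree -> Prop :=
| grow_leaf l : grow (Leaf l) (Join (Leaf l) (Leaf 0))
| grow_left r r' s : grow r r' -> grow (Join r s) (Join r' s)
| grow_right r s s' : grow s s' -> grow (Join r s) (Join r s').

(* [bE theta N] is the expectation over the Hoppe tree with [N + 1] vertices. *)
Fixpoint bE theta (N : nat) F : R :=
  match N with
  | 0 => F (Leaf 0)
  | m.+1 => bE theta m (fun b => gsum theta F b / (theta + m%:R))
  end.

Lemma gsum_leaf theta F l :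
  gsum theta F (Leaf l) = theta * F (Join (Leaf l) (Leaf 0)).
Proof. by rewrite /gsum big_seq1. Qed.

Lemma gsum_join theta F r s :
  gsum theta F (Join r s) = gsum theta (fun r' => F (Join r' s)) r
                            + gsum 1 (fun s' => F (Join r s')) s.
Proof. by rewrite /gsum /= big_cat !big_map. Qed.

Lemma le_gsum theta F G b : 0 <= theta ->
  (forall b', grow b b' -> F b' <= G b') -> gsum theta F b <= gsum theta G b.
Proof.
elim: b theta F G => [l|r Hr s Hs] theta F G t0 FG.
  by rewrite !gsum_leaf ler_wpM2l // FG //; constructor.
rewrite !gsum_join lerD //.
  by apply: Hr => // r' g; apply: FG; constructor.
by apply: Hs => // s' g; apply: FG; constructor.
Qed.

Lemma eq_gsum theta F G b : (forall b', grow b b' -> F b' = G b') ->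
  gsum theta F b = gsum theta G b.
Proof.
elim: b theta F G => [l|r Hr s Hs] theta F G FG.
  by rewrite !gsum_leaf FG //; constructor.
rewrite !gsum_join; congr (_ + _).
  by apply: Hr => // r' g; apply: FG; constructor.
by apply: Hs => // s' g; apply: FG; constructor.
Qed.

Lemma gsumD theta F G b :
  gsum theta (fun x => F x + G x) b = gsum theta F b + gsum theta G b.
Proof. by rewrite /gsum -big_split; apply: eq_bigr => p _; rewrite mulrDr. Qed.

Lemma gsumZ theta c F b : gsum theta (fun x => c * F x) b = c * gsum theta F b.
Proof. by rewrite /gsum big_distrr; apply: eq_bigr => p _; rewrite mulrCA. Qed.

Lemma gsum_cst theta c b : gsum theta (fun=> c) b = (theta + (bsize b)%:R - 1) * c.
Proof.
elim: b theta => [l|r Hr s Hs] theta; first by rewrite gsum_leaf /= addrK.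
by rewrite gsum_join Hr Hs /= natrD; ring.
Qed.

Lemma grow_bsize b b' : grow b b' -> bsize b' = (bsize b).+1.
Proof. by elim => //= r r' s _ -> //; rewrite addnS. Qed.

Lemma eq_bE theta N F G : (forall b, bsize b = N.+1 -> F b = G b) ->
  bE theta N F = bE theta N G.
Proof.
elim: N F G => [|N IH] F G FG /=; first exact: FG.
apply: IH => b bN; congr (_ / _); apply: eq_gsum => b' /grow_bsize b'b.
by apply: FG; rewrite b'b bN.
Qed.

Lemma le_bE theta N F G : 0 < theta ->
  (forall b, bsize b = N.+1 -> F b <= G b) -> bE theta N F <= bE theta N G.
Proof.
move=> t0; elim: N F G => [|N IH] F G FG /=; first exact: FG.
apply: IH => b bN; rewrite ler_pM2r ?invr_gt0 ?ltr_wpDr //.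
apply: le_gsum => [|b' /grow_bsize b'b]; first exact: ltW.
by apply: FG; rewrite b'b bN.
Qed.

Lemma bED theta N F G :
  bE theta N (fun x => F x + G x) = bE theta N F + bE theta N G.
Proof.
elim: N F G => //= N IH F G; rewrite -IH; apply: eq_bE => b _.
by rewrite gsumD mulrDl.
Qed.

Lemma bEZ theta N c F : bE theta N (fun x => c * F x) = c * bE theta N F.
Proof.
elim: N F => //= N IH F; rewrite -IH; apply: eq_bE => b _.
by rewrite gsumZ mulrA.
Qed.

Lemma bE_cst theta N c : 0 < theta -> bE theta N (fun=> c) = c.
Proof.
move=> t0; elim: N => //= N IH; rewrite -[RHS]IH; apply: eq_bE => b bN.
rewrite gsum_cst bN -natr1 addrA addrK mulrAC divff ?mul1r //.
by rewrite gt_eqF // ltr_wpDr.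
Qed.

Lemma bEB theta N F G :
  bE theta N (fun x => F x - G x) = bE theta N F - bE theta N G.
Proof.
rewrite -[- bE _ _ G]mulN1r -bEZ -bED; apply: eq_bE => b _.
by rewrite mulN1r.
Qed.

Lemma le_norm_bE theta N F : 0 < theta ->
  `|bE theta N F| <= bE theta N (fun b => `|F b|).
Proof.
move=> t0; rewrite ler_norml -[- bE _ _ _]mulN1r -bEZ; apply/andP; split.
  by apply: le_bE => // b _; rewrite mulN1r lerNl -normrN ler_norm.
by apply: le_bE => // b _; rewrite ler_norm.
Qed.

(** Distinct labels turn the choice of a parent [j] into the choice of the leaf to split. No leaf of
    the right part is the root, so all its weights are 1, as the kernel prescribes. *)
Lemma gsum_ins theta F b n : uniq (leaves b) ->
  gsum theta F (erase b) =
  \sum_(j <- leaves b)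
     (if j == lroot b then theta else 1) * F (erase (ins b j n)).
Proof.
elim: b theta F => [l|r Hr s Hs] theta F /=.
  by rewrite gsum_leaf big_seq1 eqxx.
rewrite cat_uniq => /and3P[ur /hasPn rs us].
rewrite gsum_join Hr // Hs // big_cat /=; congr (_ + _).
  rewrite big_seq_cond [in RHS]big_seq_cond; apply: eq_bigr => j /andP[jr _].
  rewrite (@ins_notin s) //; apply/negP => /rs; rewrite /=; by rewrite jr.
rewrite big_seq_cond [in RHS]big_seq_cond; apply: eq_bigr => j /andP[js _].
have jr := rs _ js; rewrite (@ins_notin r) //= if_same ifF //.
by apply/negbTE/eqP => e; move: jr; rewrite /= e lroot_leaves.
Qed.

End growth.

(** * The Hoppe law in terms of the growth kernel *)

Definition upd (J : nat -> nat) (n j : nat) : nat -> nat :=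
  fun k => if k == n then j else J k.

Lemma btree_of_upd J n j m : (m < n)%N ->
  btree_of (upd J n j) m = btree_of J m.
Proof.
elim: m => //= m IH mn; rewrite IH ?(ltnW mn) // /upd ifF //.
by apply/negbTE; rewrite neq_ltn mn.
Qed.

Section extend.
Variable n : nat.

Definition pext (x : {ffun 'I_n.+1 -> 'I_n.+1} * 'I_n.+1) :
    {ffun 'I_n.+2 -> 'I_n.+2} :=
  [ffun k : 'I_n.+2 => inord (if (k < n.+1)%N then x.1 (inord k) : nat else x.2)].

Definition prestr (p : {ffun 'I_n.+2 -> 'I_n.+2}) :
    {ffun 'I_n.+1 -> 'I_n.+1} * 'I_n.+1 :=
  ([ffun k : 'I_n.+1 => inord (p (inord k))], inord (p ord_max)).

Lemma pextE x (k : 'I_n.+2) :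
  pext x k = (if (k < n.+1)%N then x.1 (inord k) : nat else x.2) :> nat.
Proof.
rewrite ffunE inordK //; case: ifP => _; first exact: ltnW (ltn_ord _).
exact: ltnW (ltn_ord _).
Qed.

Lemma pextK x : prestr (pext x) = x.
Proof.
case: x => p j; rewrite /prestr; congr (_, _).
  apply/ffunP => k; rewrite ffunE.
  have -> : pext (p, j) (inord k) = p k :> nat.
    have kn := ltn_ord k.
    have e : (inord k : 'I_n.+2) = k :> nat by rewrite inordK // ltnS ltnW.
    by rewrite pextE e kn inord_val.
  by rewrite inord_val.
have -> : pext (p, j) ord_max = j :> nat by rewrite pextE ltnn.
by rewrite inord_val.
Qed.

(** Validity keeps every parent below [n.+1], so the casts by [inord] in [prestr] lose nothing. *)
Lemma prestrK (p : {ffun 'I_n.+2 -> 'I_n.+2}) :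
  valid_parents p -> pext (prestr p) = p.
Proof.
move=> /forallP vp; apply/ffunP => k; apply/ord_inj; rewrite pextE.
have := vp k; case: (ltnP k n.+1) => [kn|nk].
  have -> : (prestr p).1 (inord k) = inord (p k).
    have e : (inord k : 'I_n.+1) = k :> nat by rewrite inordK.
    by rewrite ffunE e inord_val.
  case: eqP => [_ /eqP ->|_ pk]; rewrite inordK //.
  exact: ltn_trans pk kn.
have -> : k = ord_max by apply/ord_inj/anti_leq; rewrite nk -ltnS ltn_ord.
by move=> /= pk; rewrite inordK.
Qed.

Lemma valid_pext x : valid_parents (pext x) = valid_parents x.1.
Proof.
apply/forallP/forallP => H k.
  have kn := ltn_ord k.
  have e : (inord k : 'I_n.+2) = k :> nat by rewrite inordK // ltnS ltnW.
  by have := H (inord k); rewrite pextE e kn inord_val.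
have := ltn_ord k; rewrite ltnS leq_eqVlt => /predU1P[kn|kn].
  by rewrite pextE kn ltnn /=.
have := H (inord k); rewrite pextE kn inordK //.
Qed.

Lemma parent_fun_pext x :
  parent_fun (pext x) = upd (parent_fun x.1) n.+1 x.2.
Proof.
apply/funext => k; rewrite /parent_fun /upd.
case: insubP => [i _ ik|] /=.
  rewrite pextE ik; case: eqP => [->|/eqP kn]; first by rewrite ltnn.
  have kn' : (k < n.+1)%N by have := ltn_ord i; rewrite ik; lia.
  rewrite kn'; case: insubP => [j _ jk|]; last by rewrite kn'.
  by rewrite /= -jk inord_val.
rewrite -leqNgt => kn; rewrite gtn_eqF //.
by case: insubP => // j; lia.
Qed.

Lemma valid_lt (p : {ffun 'I_n.+1 -> 'I_n.+1}) (k : nat) :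
  valid_parents p -> (0 < k <= n)%N -> (parent_fun p k < k)%N.
Proof.
move=> /forallP vp /andP[k0 kn]; rewrite /parent_fun.
case: insubP => [i _ ik|]; last by rewrite ltnS kn.
by have := vp i; rewrite ik /= gtn_eqF.
Qed.

End extend.

Section hoppe_law.
Variable R : realType.
Implicit Types theta : R.

Lemma hoppeE_eq theta n (g h : (nat -> nat) -> R) :
  (forall J, (forall k, (0 < k <= n)%N -> (J k < k)%N) -> g J = h J) ->
  hoppeE theta n.+1 g = hoppeE theta n.+1 h.
Proof.
move=> gh; apply: eq_bigr => p _; rewrite /hoppe_prob.
case: ifP => [vp|_]; last by rewrite !mul0r.
by rewrite gh // => k; exact: valid_lt.
Qed.

(** The weight is a product over the vertices, so the factor of the last one can be summed
    separately. Invalid vectors have weight 0 and are dropped before reindexing, because [pext]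
    inverts [prestr] on valid vectors only. *)
Lemma hoppeE_rec theta n (g : (nat -> nat) -> R) :
  hoppeE theta n.+2 g =
  hoppeE theta n.+1 (fun J => \sum_(j < n.+1)
    (if j == 0 :> nat then theta else 1) / (theta + n%:R) * g (upd J n.+1 j)).
Proof.
rewrite /hoppeE (bigID (@valid_parents n.+2)) /= [X in _ + X]big1 ?addr0; last first.
  by move=> p /negbTE vp; rewrite /hoppe_prob vp mul0r.
rewrite (reindex_onto (@pext n) (@prestr n)) /=; last exact: prestrK.
under eq_bigl => x do rewrite pextK eqxx andbT valid_pext.
rewrite [RHS](bigID (@valid_parents n.+1)) /= [X in _ = _ + X]big1 ?addr0; last first.
  by move=> p /negbTE vp; rewrite /hoppe_prob vp mul0r.
under [RHS]eq_bigr do rewrite big_distrr /=.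
rewrite pair_big_dep /=; apply: eq_big => [x|[p j] /= vp]; first by rewrite andbT.
rewrite parent_fun_pext /= mulrA; congr (_ * _).
rewrite /hoppe_prob valid_pext /= vp big_mkcond big_ord_recr /=; congr (_ * _).
  rewrite [RHS]big_mkcond; apply: eq_bigr => i _ /=.
  by rewrite pextE /= ltn_ord inord_val.
by rewrite pextE ltnn -natr1 addrA addrK.
Qed.

Lemma hoppeE_bE theta n F :
  hoppeE theta n.+1 (fun J => F (erase (btree_of J n))) = bE theta n F.
Proof.
elim: n F => [|n IH] F.
  rewrite /hoppeE /= (bigD1 [ffun=> ord0]) //= big1 ?addr0; last first.
    move=> p /eqP[]; apply/ffunP => i; rewrite ffunE; apply/ord_inj.
    by case: (p i) => -[].
  rewrite /hoppe_prob ifT; last first.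
    by apply/forallP => k; rewrite ffunE ord1 /=.
  by rewrite big_pred0 ?mul1r // => k; rewrite ord1.
rewrite hoppeE_rec /= -IH; apply: hoppeE_eq => J vJ.
have vJ' k : (0 < k <= n)%N -> (J k < k)%N by exact: vJ.
rewrite (gsum_ins _ _ n.+1) ?(uniq_btree_of vJ') //.
rewrite (perm_big _ (leaves_btree_of vJ' (leqnn n))).
rewrite -[iota 0 n.+1]/(index_iota 0 n.+1) big_mkord big_distrl /=.
apply: eq_bigr => j _; rewrite lroot_btree_of mulrAC; congr (_ * _ / _).
by rewrite /upd eqxx btree_of_upd.
Qed.

Lemma hoppeE_WT theta n (f : R -> R -> R) :
  hoppeE theta n.+1 (fun J => f (wiener n.+1 J)%:R (total_length n.+1 J)%:R) =
  bE theta n (fun b => f (bW b)%:R (bT b)%:R).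
Proof.
rewrite -hoppeE_bE; apply: hoppeE_eq => J vJ.
by rewrite bW_erase bT_erase (wiener_btree_of vJ) // (total_length_btree_of vJ).
Qed.

End hoppe_law.

(** * Moments and the martingale *)

(** The sum of the squared depths: hanging [s] one edge lower replaces [d^2] by [d^2 + 2 d + 1] at
    each of its vertices. *)
Fixpoint bQ (b : btree) : nat :=
  match b with
  | Leaf _ => 0
  | Join r s => (bQ r + bQ s + (bT s + bT s) + bsize s)%N
  end.

Lemma grow_bT b b' : grow b b' -> (bT b <= bT b')%N.
Proof.
by elim => //= [r r' s _|r s s' /grow_bsize ->] H; lia.
Qed.

Lemma grow_bW b b' : grow b b' -> (bW b <= bW b')%N.
Proof.
elim => //= [r r' s g|r s s' g] H; have := grow_bsize g; have := grow_bT g.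
  move=> H1 ->; have : (bsize s * bT r <= bsize s * bT r')%N by rewrite leq_mul.
  by lia.
move=> H1 ->; have : (bsize r * bT s <= bsize r * bT s')%N by rewrite leq_mul.
by lia.
Qed.

Section moments.
Variable R : realType.
Implicit Types (theta : R) (b : btree).
Local Notation sz b := ((bsize b)%:R : R).
Local Notation T b := ((bT b)%:R : R).
Local Notation W b := ((bW b)%:R : R).
Local Notation Q b := ((bQ b)%:R : R).

(* [dist i j <= depth i + depth j], summed over [i]. *)
Lemma grow_bW_le b b' : grow b b' ->
  W b' - W b <= T b + sz b * (T b' - T b).
Proof.
elim => [l|r r' s g|r s s' g] /=; first by lra.
  rewrite (grow_bsize g) !natrD !natrM -?natr1.
  by lra.
have := bsize_gt0 r; have := bsize_gt0 s.
rewrite (grow_bsize g) !natrD !natrM -?natr1 -!(ltr_nat R).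
by lra.
Qed.

(** Cauchy-Schwarz for the depths against the constant 1, carried out along the recursion of
    [bQ]. *)
Lemma bT2_le b : T b ^+ 2 <= sz b * Q b.
Proof.
elim: b => [l|r Hr s Hs] /=; first by lra.
have := bsize_gt0 r; have := bsize_gt0 s.
rewrite !natrD -!(ltr_nat R).
move: Hr Hs; set a := T r; set b := T s; set x := sz r; set y := sz s.
set A := Q r; set B := Q s => Hr Hs y0 x0.
(* In the square of [a + (b + y)] the two pure squares are bounded within the two parts; only this
   cross term is left. It is an arithmetic-geometric mean inequality, multiplied by [x * y] to avoid
   division. *)
suff : 2 * a * (b + y) <= x * (B + 2 * b + y) + y * A by nra.
rewrite -(ler_pM2l (mulr_gt0 x0 y0)).
have h1 : x ^+ 2 * (b + y) ^+ 2 <= x ^+ 2 * (y * (B + 2 * b + y)).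
  by rewrite ler_wpM2l ?sqr_ge0 //; nra.
have h2 : y ^+ 2 * a ^+ 2 <= y ^+ 2 * (x * A) by rewrite ler_wpM2l ?sqr_ge0.
have := sqr_ge0 (x * (b + y) - y * a); nra.
Qed.

(** A new vertex lies one deeper than its parent, and the root has depth 0; therefore [theta] enters
    here, and in the sums for squared depths below, only through the total weight. *)
Lemma gsum_T theta b : gsum theta (fun b' => T b') b =
  (theta + sz b - 1) * (T b + 1) + T b.
Proof.
elim: b theta => [l|r Hr s Hs] theta; first by rewrite gsum_leaf /=; ring.
rewrite gsum_join.
under [gsum theta _ _]eq_gsum => r' g do rewrite /= !natrD -addrA.
under [gsum 1 _ _]eq_gsum => s' g do
  rewrite /= (grow_bsize g) !natrD -addrA addrCA.
by rewrite !gsumD !gsum_cst Hr Hs /= !natrD -natr1; ring.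
Qed.

(** A child of [j] adds [dist i j + 1] over all [i]. With weight 1 for every [j] the distances add
    up to [2 W]; the excess weight [theta - 1] of the root contributes its distances to all
    vertices, which is [T]. *)
Lemma gsum_W theta b : gsum theta (fun b' => W b') b =
  (theta + sz b - 1) * (W b + sz b) + 2 * W b + (theta - 1) * T b.
Proof.
elim: b theta => [l|r Hr s Hs] theta; first by rewrite gsum_leaf /=; ring.
rewrite gsum_join.
under [gsum theta _ _]eq_gsum => r' g.
  rewrite /= (grow_bsize g) (_ : _%:R = W r' + (sz s * T r' +
    (W s + (sz r + 1) * T s + (sz r + 1) * sz s))); last first.
    by rewrite !natrD !natrM -?natr1; ring.
  over.
under [gsum 1 _ _]eq_gsum => s' g.
  rewrite /= (grow_bsize g) (_ : _%:R = W s' + (sz r * T s' +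
    (W r + (sz s + 1) * T r + (sz s + 1) * sz r))); last first.
    by rewrite !natrD !natrM -?natr1; ring.
  over.
by rewrite !gsumD !gsumZ !gsum_cst !gsum_T Hr Hs /= !natrD !natrM; ring.
Qed.

Lemma gsum_dT2 theta b : gsum theta (fun b' => (T b' - T b) ^+ 2) b =
  Q b + 2 * T b + (theta + sz b - 1).
Proof.
elim: b theta => [l|r Hr s Hs] theta; first by rewrite gsum_leaf /=; ring.
rewrite gsum_join.
under [gsum theta _ _]eq_gsum => r' g.
  rewrite /= (_ : _ ^+ 2 = (T r' - T r) ^+ 2); last by rewrite !natrD; ring.
  over.
under [gsum 1 _ _]eq_gsum => s' g.
  rewrite /= (grow_bsize g) (_ : _ ^+ 2 = (T s' - T s) ^+ 2 +
    (2 * T s' + (1 - 2 * T s))); last by rewrite !natrD -?natr1; ring.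
  over.
by rewrite !gsumD !gsumZ !gsum_cst !gsum_T Hr Hs /= !natrD; ring.
Qed.

Lemma gsum_Q theta b : gsum theta (fun b' => Q b') b =
  (theta + sz b - 1) * (Q b + 1) + Q b + 2 * T b.
Proof.
elim: b theta => [l|r Hr s Hs] theta; first by rewrite gsum_leaf /=; ring.
rewrite gsum_join.
under [gsum theta _ _]eq_gsum => r' g do rewrite /= !natrD -2!addrA.
under [gsum 1 _ _]eq_gsum => s' g.
  rewrite /= (grow_bsize g) (_ : _%:R = Q s' +
    (2 * T s' + (Q r + sz s + 1))); last by rewrite !natrD -?natr1; ring.
  over.
by rewrite !gsumD !gsumZ !gsum_cst !gsum_T Hr Hs /= !natrD; ring.
Qed.

(** The conditional mean minimises the mean square deviation. Martingale increments may thus be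
    estimated around any convenient centre [y0]. *)
Lemma gsum_var theta (Y : btree -> R) y y0 b : 0 < theta ->
  gsum theta Y b = (theta + sz b - 1) * y ->
  gsum theta (fun b' => (Y b' - y) ^+ 2) b <=
  gsum theta (fun b' => (Y b' - y0) ^+ 2) b.
Proof.
move=> t0 Yy; rewrite -subr_ge0.
have -> : gsum theta (fun b' => (Y b' - y0) ^+ 2) b =
   gsum theta (fun b' => (Y b' - y) ^+ 2) b
   + (2 * (y - y0) * gsum theta Y b
   + gsum theta (fun=> y0 ^+ 2 - y ^+ 2) b).
  by rewrite -gsumZ -!gsumD; apply: eq_gsum => b' _; ring.
have := bsize_gt0 b; rewrite -(ler_nat R) => s1.
rewrite Yy gsum_cst addrAC subrr add0r.
have -> : 2 * (y - y0) * ((theta + sz b - 1) * y) +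
  (theta + sz b - 1) * (y0 ^+ 2 - y ^+ 2) = (theta + sz b - 1) * (y - y0) ^+ 2
  by ring.
by rewrite mulr_ge0 ?sqr_ge0 //; lra.
Qed.

Definition harm theta (N : nat) : R := \sum_(i < N) (theta + i.+1%:R)^-1.

Lemma harmS theta N : harm theta N.+1 = harm theta N + (theta + N.+1%:R)^-1.
Proof. by rewrite /harm big_ord_recr. Qed.

Lemma harm_ge0 theta N : 0 < theta -> 0 <= harm theta N.
Proof.
by move=> t0; apply: sumr_ge0 => i _; rewrite invr_ge0 addr_ge0 // ltW.
Qed.

Definition meanT theta N : R := (theta + N%:R) * harm theta N.
(** Solves [z' = (s + 2) / s * z + s] with [s = theta + N] and initial value 0: dividing by
    [s (s + 1)] leaves the increments [2 / (s + 2) - 1 / (s + 1)], whose sum is [harm] plus a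
    telescoping part. *)
Definition meanZ theta N : R := (theta + N%:R) * (theta + N.+1%:R) *
  (harm theta N - 2 / (theta + 1) + 2 / (theta + N.+1%:R)).
Definition meanW theta N : R := meanZ theta N - (theta - 1) * meanT theta N.

Lemma bE_T theta N : 0 < theta -> bE theta N (fun b => T b) = meanT theta N.
Proof.
move=> t0; elim: N => [|N IH] /=; first by rewrite /meanT /harm big_ord0 mulr0.
have s0 : 0 < theta + N%:R by rewrite ltr_wpDr.
have s1 : 0 < theta + N.+1%:R by rewrite ltr_wpDr.
transitivity (bE theta N (fun b => (theta + N.+1%:R) / (theta + N%:R) * T b + 1)).
  apply: eq_bE => b bN; rewrite gsum_T bN -natr1.
  by move: s0; set x := N%:R => s0; field; rewrite gt_eqF.
rewrite bED bEZ bE_cst // IH /meanT harmS -natr1.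
move: s0 s1; rewrite -natr1; set x := N%:R => s0 s1.
by field; rewrite ?gt_eqF //=; lra.
Qed.

Lemma bE_Z theta N : 0 < theta ->
  bE theta N (fun b => W b + (theta - 1) * T b) = meanZ theta N.
Proof.
move=> t0; elim: N => [|N IH] /=.
  by rewrite /meanZ /harm big_ord0 sub0r addNr !mulr0 addr0.
have s0 : 0 < theta + N%:R by rewrite ltr_wpDr.
transitivity (bE theta N (fun b => (theta + N%:R + 2) / (theta + N%:R)
  * (W b + (theta - 1) * T b) + (theta + N%:R))).
  apply: eq_bE => b bN; rewrite gsumD gsumZ gsum_T gsum_W bN -natr1.
  by move: s0; set x := N%:R => s0; field; rewrite gt_eqF.
rewrite bED bEZ bE_cst // IH /meanZ harmS -?natr1.
have := ler0n R N; move: s0; set x := N%:R => s0 x0.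
by field; rewrite ?gt_eqF //=; lra.
Qed.

Lemma bE_W theta N : 0 < theta -> bE theta N (fun b => W b) = meanW theta N.
Proof.
by move=> t0; rewrite /meanW -bE_Z // -bE_T // bED bEZ addrK.
Qed.

(** The exact mean solves [q' = (s + 1) / s * q + 1 + 2 h], with [s = theta + N] and [h] the
    harmonic sum. The bound satisfies this recursion with a surplus of [1 + 1 / (s + 1)] in each
    step. *)
Lemma bE_Q theta N : 0 < theta ->
  bE theta N (fun b => Q b) <= (theta + N%:R) * (1 + harm theta N) ^+ 2.
Proof.
move=> t0; elim: N => [|N IH] /=; first by rewrite mulr_ge0 ?sqr_ge0 // ltW // addr0.
have s0 : 0 < theta + N%:R by rewrite ltr_wpDr.
rewrite (_ : bE _ _ _ = bE theta N (fun b => (theta + N.+1%:R) / (theta + N%:R)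
  * Q b + (1 + 2 / (theta + N%:R) * T b))); last first.
  apply: eq_bE => b bN; rewrite gsum_Q bN -natr1.
  by move: s0; set x := N%:R => s0; field; rewrite gt_eqF.
rewrite !bED !bEZ bE_cst // bE_T // /meanT harmS -[N.+1%:R]natr1.
have := ler0n R N; have := harm_ge0 N t0.
move: s0 IH; set x := N%:R; set h := harm _ _ => s0 IH h0 x0.
apply: (@le_trans _ _ ((theta + (x + 1)) / (theta + x) *
  ((theta + x) * (1 + h) ^+ 2) + (1 + 2 / (theta + x) * ((theta + x) * h)))).
  by rewrite lerD2r ler_wpM2l // divr_ge0; lra.
rewrite -subr_ge0 [X in 0 <= X](_ : _ = 1 + (theta + (x + 1))^-1); last first.
  by field; rewrite ?gt_eqF //; lra.
by rewrite addr_ge0 // invr_ge0; lra.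
Qed.

Definition martT theta N b : R := (T b - meanT theta N) / (theta + N%:R).
Definition martW theta N b : R :=
  (W b + (theta - 1) * T b - meanZ theta N)
  / ((theta + N%:R) * (theta + N.+1%:R)).

Lemma martT_step theta N b : 0 < theta -> bsize b = N.+1 ->
  gsum theta (martT theta N.+1) b = (theta + sz b - 1) * martT theta N b.
Proof.
move=> t0 bN; have s0 : 0 < theta + N%:R by rewrite ltr_wpDr.
have -> : gsum theta (martT theta N.+1) b = (theta + N.+1%:R)^-1 *
    (gsum theta (fun b => T b) b + gsum theta (fun=> - meanT theta N.+1) b).
  by rewrite -gsumD -gsumZ; apply: eq_gsum => b' _; rewrite /martT mulrC.
rewrite gsum_T gsum_cst /martT /meanT harmS bN -?natr1.
have := ler0n R N; move: s0; set x := N%:R => s0 x0.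
by field; rewrite ?gt_eqF //=; lra.
Qed.

Lemma martW_step theta N b : 0 < theta -> bsize b = N.+1 ->
  gsum theta (martW theta N.+1) b = (theta + sz b - 1) * martW theta N b.
Proof.
move=> t0 bN; have s0 : 0 < theta + N%:R by rewrite ltr_wpDr.
have -> : gsum theta (martW theta N.+1) b =
    ((theta + N.+1%:R) * (theta + N.+2%:R))^-1 *
    (gsum theta (fun b => W b) b + (theta - 1) * gsum theta (fun b => T b) b
     + gsum theta (fun=> - meanZ theta N.+1) b).
  rewrite -gsumZ -!gsumD -gsumZ; apply: eq_gsum => b' _.
  by rewrite /martW mulrC.
rewrite gsum_W gsum_T gsum_cst /martW /meanZ harmS bN -?natr1.
have := ler0n R N; move: s0; set x := N%:R => s0 x0.
by field; rewrite ?gt_eqF //=; lra.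
Qed.

Lemma bE_dT2 theta N : 0 < theta ->
  bE theta N (fun b => gsum theta (fun b' => (T b' - T b) ^+ 2) b
                       / (theta + N%:R)) <= 2 * (1 + harm theta N) ^+ 2.
Proof.
move=> t0; have s0 : 0 < theta + N%:R by rewrite ltr_wpDr.
rewrite (_ : bE _ _ _ = bE theta N (fun b => (theta + N%:R)^-1
  * Q b + (2 / (theta + N%:R) * T b + 1))); last first.
  apply: eq_bE => b bN; rewrite gsum_dT2 bN -natr1.
  by move: s0; set x := N%:R => s0; field; rewrite gt_eqF.
rewrite !bED !bEZ bE_cst // bE_T // /meanT.
have := bE_Q N t0; rewrite -ler_pdivrMl //.
have -> : 2 / (theta + N%:R) * ((theta + N%:R) * harm theta N) = 2 * harm theta N.
  by field; rewrite gt_eqF.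
by have := sqr_ge0 (harm theta N); nra.
Qed.

(* The tail of the variances of the martingale increments telescopes. *)
Definition Lyap theta N : R := (4 + harm theta N) ^+ 2 / (theta + N.+1%:R).

Lemma Lyap_ge0 theta N : 0 < theta -> 0 <= Lyap theta N.
Proof. by move=> t0; rewrite divr_ge0 ?sqr_ge0 // addr_ge0 // ltW. Qed.

(** With [m = theta + N + 1] and [h] the harmonic sum, [Lyap] drops by [((4 + h)^2 - 2 (4 + h) - 1 /
    m) / (m (m + 1))]. The offset 4 keeps the square ahead of the terms coming from the growth of
    [h]; the factor 8 leaves room for [m + 1 <= 2 m]. *)
Lemma Lyap_step theta N : 0 < theta ->
  (1 + harm theta N) ^+ 2 / (theta + N.+1%:R) ^+ 2 <=
  8 * (Lyap theta N - Lyap theta N.+1).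
Proof.
move=> t0; rewrite /Lyap harmS -[N.+2%:R]natr1.
have m1 : 1 <= theta + N.+1%:R by rewrite -natr1; have := ler0n R N; lra.
have := harm_ge0 N t0; move: m1; set h := harm _ _; rewrite [theta + (_ + 1)]addrA.
set m := theta + N.+1%:R => m1 h0.
have m0 : 0 < m by lra.
rewrite -subr_ge0.
have -> : 8 * ((4 + h) ^+ 2 / m - (4 + (h + m^-1)) ^+ 2 / (m + 1)) -
  (1 + h) ^+ 2 / m ^+ 2 = (8 * m * ((4 + h) ^+ 2 - 2 * (4 + h) - m^-1)
    - (m + 1) * (1 + h) ^+ 2) / (m ^+ 2 * (m + 1)).
  by field; rewrite ?gt_eqF //; lra.
apply: divr_ge0; last by rewrite mulr_ge0 ?sqr_ge0 //; lra.
have mV : m^-1 <= 1 by rewrite invf_le1.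
have : 8 * m * ((4 + h) ^+ 2 - 2 * (4 + h) - 1) <=
       8 * m * ((4 + h) ^+ 2 - 2 * (4 + h) - m^-1).
  by rewrite ler_wpM2l //; lra.
by nra.
Qed.

Lemma martT_incr theta N : 0 < theta ->
  bE theta N (fun b => gsum theta
    (fun b' => (martT theta N.+1 b' - martT theta N b) ^+ 2) b
    / (theta + N%:R)) <= 144 * (Lyap theta N - Lyap theta N.+1).
Proof.
move=> t0; have s0 : 0 < theta + N%:R by rewrite ltr_wpDr.
have s1 : 0 < theta + N.+1%:R by rewrite ltr_wpDr.
apply: (@le_trans _ _ (bE theta N (fun b => (theta + N.+1%:R) ^- 2 *
   (gsum theta (fun b' => (T b' - T b) ^+ 2) b / (theta + N%:R))))).
  apply: le_bE => // b bN; rewrite mulrA ler_wpM2r ?invr_ge0 ?(ltW s0) //.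
  (* This centre reduces the increment to [T b' - T b] over [theta + N.+1]: the deterministic means
     cancel. *)
  apply: (le_trans (gsum_var ((T b - meanT theta N.+1) / (theta + N.+1%:R)) t0
    (martT_step t0 bN))).
  rewrite -gsumZ le_eqVlt; apply/predU1P; left; apply: eq_gsum => b' _.
  rewrite /martT; move: s1; set m := theta + N.+1%:R => s1.
  by field; rewrite gt_eqF.
rewrite bEZ; have := Lyap_step N t0; have := bE_dT2 N t0.
set m := theta + N.+1%:R; rewrite -/m in s1.
rewrite -(@ler_pM2l _ (m ^- 2)) ?invr_gt0 ?exprn_gt0 // => h1 h2.
apply: (le_trans h1).
have : 0 <= (1 + harm theta N) ^+ 2 / m ^+ 2.
  by rewrite divr_ge0 ?sqr_ge0.
by rewrite mulrCA [_^-1 * _]mulrC; lra.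
Qed.

(** With [d] the increment of [T], the combination [W + (theta - 1) T] moves by at most [T + 2 m d]:
    one [m d] bounds the distances and one the root excess. The square is at most
    [2 T^2 + 8 m^2 d^2], where [T^2 <= m Q]; its mean is at most [18 m^2 (1 + harm)^2], and
    [144 = 18 * 8]. *)
Lemma martW_incr theta N : 0 < theta ->
  bE theta N (fun b => gsum theta
    (fun b' => (martW theta N.+1 b' - martW theta N b) ^+ 2) b
    / (theta + N%:R)) <= 144 * (Lyap theta N - Lyap theta N.+1).
Proof.
move=> t0; have s0 : 0 < theta + N%:R by rewrite ltr_wpDr.
have := ler0n R N => N0.
have s1 : 0 < theta + N.+1%:R by rewrite ltr_wpDr.
have s2 : 0 < theta + N.+2%:R by rewrite ltr_wpDr.
set m := theta + N.+1%:R in s1 *; set m' := theta + N.+2%:R in s2 *.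
apply: (@le_trans _ _ (bE theta N (fun b => (m * m') ^- 2 *
   (2 * m * Q b + 8 * m ^+ 2 *
   (gsum theta (fun b' => (T b' - T b) ^+ 2) b / (theta + N%:R)))))).
  apply: le_bE => // b bN.
  rewrite ler_pdivrMr //.
  apply: (le_trans (gsum_var ((W b + (theta - 1) * T b - meanZ theta N.+1)
    / (m * m')) t0 (martW_step t0 bN))).
  set G := gsum theta (fun b' => (T b' - T b) ^+ 2) b.
  have -> : (m * m') ^- 2 * (2 * m * Q b + 8 * m ^+ 2 * (G / (theta + N%:R)))
     * (theta + N%:R) = (m * m') ^- 2 * (gsum theta (fun=> 2 * m * Q b) b
      + 8 * m ^+ 2 * G).
    rewrite gsum_cst bN -[N.+1%:R]natr1 [theta + (_ + 1)]addrA addrK.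
    by field; rewrite !gt_eqF.
  rewrite /G -gsumZ -gsumD -gsumZ; apply: le_gsum => [|b' g]; first exact: ltW.
  rewrite [leLHS](_ : _ = (m * m') ^- 2 *
    ((W b' - W b) + (theta - 1) * (T b' - T b)) ^+ 2); last first.
    by rewrite /martW -/m -/m'; field; rewrite !gt_eqF.
  rewrite ler_wpM2l // ?invr_ge0 ?sqr_ge0 //.
  have := grow_bW_le g; have := grow_bW g; have := grow_bT g.
  rewrite -!(ler_nat R); have := bT2_le b; have := ler0n R (bT b); have := ler0n R (bQ b).
  have szm : sz b <= m by rewrite bN /m; lra.
  have tm : `|theta - 1| <= m.
    by rewrite /m -natr1 ler_norml; lra.
  move=> q0 T0 hT2 hT hW hWT.
  set d := T b' - T b in hWT *; set e := W b' - W b in hWT *.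
  have d0 : 0 <= d by rewrite /d; lra.
  have e0 : 0 <= e by rewrite /e; lra.
  have hb : `|e + (theta - 1) * d| <= T b + 2 * m * d.
    apply: (le_trans (ler_normD _ _)).
    rewrite (ger0_norm e0) normrM (ger0_norm d0).
    have : sz b * d <= m * d by rewrite ler_wpM2r.
    have : `|theta - 1| * d <= m * d by rewrite ler_wpM2r.
    by lra.
  rewrite -real_normK ?num_real //.
  apply: (@le_trans _ _ ((T b + 2 * m * d) ^+ 2)).
    by rewrite ler_sqr ?nnegrE // ?(le_trans _ hb).
  have : sz b * Q b <= m * Q b by rewrite ler_wpM2r.
  have := sqr_ge0 (T b - 2 * m * d); nra.
rewrite bEZ bED !bEZ.
have hQ := bE_Q N t0; have hT := bE_dT2 N t0; have hL := Lyap_step N t0.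
have sm : theta + N%:R <= m by rewrite /m -natr1; lra.
have mm' : m <= m' by rewrite /m /m' -?natr1; lra.
set H2 := (1 + harm theta N) ^+ 2 in hQ hT hL *.
have H20 : 0 <= H2 by rewrite sqr_ge0.
apply: (@le_trans _ _ ((m * m') ^- 2 * (18 * m ^+ 2 * H2))).
  rewrite ler_wpM2l ?invr_ge0 ?sqr_ge0 //.
  have : m * bE theta N (fun b => Q b) <= m * (m * H2).
    by rewrite ler_wpM2l ?(ltW s1) // (le_trans hQ) // ler_wpM2r.
  have : m ^+ 2 * bE theta N (fun b => gsum theta (fun b' => (T b' - T b) ^+ 2) b
       / (theta + N%:R)) <= m ^+ 2 * (2 * H2) by rewrite ler_wpM2l ?sqr_ge0.
  by move: (bE _ _ _) (bE _ _ _) => u v; nra.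
have -> : (m * m') ^- 2 * (18 * m ^+ 2 * H2) = 18 * (H2 / m' ^+ 2).
  by field; rewrite !gt_eqF.
have : H2 / m' ^+ 2 <= H2 / m ^+ 2.
  by rewrite ler_wpM2l // lef_pV2 ?posrE ?exprn_gt0 //
    lerXn2r ?nnegrE ?(ltW s1) ?(ltW s2).
by move: hL; rewrite -/m; lra.
Qed.

End moments.

(** * Borel functions on the plane *)

Section plane.
Variable R : realType.
Implicit Types f : R * R -> R.

(** Measurability on the plane refers to the product sigma-algebra, so an open set is written as a
    countable union of boxes with rational centres and radii [1 / (k + 1)]. *)
Lemma open_measurable2 (O : set (R * R)) : open O -> measurable O.
Proof.
move=> oO; pose I := (rat * rat * nat)%type.
pose B (i : I) : set (R * R) :=
  ball (ratr i.1.1 : R) (i.2.+1%:R^-1) `*` ball (ratr i.1.2 : R) (i.2.+1%:R^-1).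
have -> : O = \bigcup_(i in [set i | B i `<=` O]) B i.
  apply/seteqP; split => [p Op|p [i iO ip]]; last exact: iO.
  have /nbhs_ballP[e /= e0 pe] : nbhs p O by exact: open_nbhs_nbhs.
  have [k _ /(_ k (leqnn k)) ke] :=
    near_infty_natSinv_lt (PosNum (divr_gt0 e0 (ltr0Sn R 1))).
  move: ke; set r : R := k.+1%:R^-1 => /= ke.
  have r0 : 0 < r by rewrite invr_gt0.
  have dq (x : R) : exists q : rat, ball (ratr q : R) r x.
    have /rat_in_itvoo[q] : x - r < x + r by lra.
    rewrite in_itv /= => xq; exists q; rewrite /ball /= ltr_distl; lra.
  have [q1 hq1] := dq p.1; have [q2 hq2] := dq p.2.
  exists (q1, q2, k); last by split.
  move=> z [/= z1 z2]; apply: pe; split.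
    by apply: (@ball_split _ _ (ratr q1 : R)); [apply: ball_sym|];
      apply: le_ball; [exact: ltW ke|by []|exact: ltW ke|by []].
  by apply: (@ball_split _ _ (ratr q2 : R)); [apply: ball_sym|];
      apply: le_ball; [exact: ltW ke|by []|exact: ltW ke|by []].
rewrite bigcup_mkcond; apply: countable_bigcupT_measurable => [|i].
  exact: countableP.
by case: ifPn => // _; apply: measurableX; exact: measurable_ball.
Qed.

Lemma continuous_measurable_fun2 f : continuous f -> measurable_fun setT f.
Proof.
move=> /continuousP cf; apply: (measurability _ (RGenOpens.measurableE R)).
move=> _ [_ [a [b ->] <-]]; rewrite setTI; apply: open_measurable2.
exact/cf/interval_open.
Qed.

Definition rays2 : set (set (R * R)) :=
  [set A | exists a c, A = `]a, +oo[ `*` `]c, +oo[].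

Lemma rays_cover (x : R) : exists k : nat, - k%:R < x.
Proof.
exists (Num.trunc `|x|).+1; rewrite ltrNl.
by rewrite (le_lt_trans _ (truncnS_gt _)) // -normrN ler_norm.
Qed.

(** A half-plane is a countable union of quadrants, so both coordinates are measurable for the
    sigma-algebra that the quadrants generate. Quadrants are stable under intersection, as
    uniqueness of measures requires. *)
Lemma measurable_rays2 : @measurable _ (R * R)%type = <<s rays2 >>.
Proof.
apply/seteqP; split; last first.
  apply: smallest_sub; first exact: sigma_algebra_measurable.
  by move=> _ [a [c ->]]; exact: measurableX.
rewrite measurable_prod_measurableType; apply: smallest_sub.
  exact: smallest_sigma_algebra.
pose T := g_sigma_algebraType rays2.
have m1 : measurable_fun setT (fst : T -> R).
  apply: (measurability _ (RGenOInfty.measurableE R)).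
  move=> _ [_ [a ->] <-]; rewrite setTI.
  have -> : (fst : T -> R) @^-1` `]a, +oo[ =
      \bigcup_(k : nat) (`]a, +oo[ `*` `](- k%:R), +oo[ : set (R * R)).
    apply/seteqP; split => [[x y] xa|[x y] [k _ []]] //.
    have [k ky] := rays_cover y; exists k => //; split => //=.
    by rewrite in_itv /= ky.
  by apply: bigcupT_measurable => k; apply: sub_sigma_algebra; exists a, (- k%:R).
have m2 : measurable_fun setT (snd : T -> R).
  apply: (measurability _ (RGenOInfty.measurableE R)).
  move=> _ [_ [a ->] <-]; rewrite setTI.
  have -> : (snd : T -> R) @^-1` `]a, +oo[ =
      \bigcup_(k : nat) (`](- k%:R), +oo[ `*` `]a, +oo[ : set (R * R)).
    apply/seteqP; split => [[x y] xa|[x y] [k _ []]] //.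
    have [k ky] := rays_cover x; exists k => //; split => //=.
    by rewrite in_itv /= ky.
  by apply: bigcupT_measurable => k; apply: sub_sigma_algebra; exists (- k%:R), a.
move=> _ [A mA [B mB <-]].
have -> : A `*` B = ((setT `&` fst @^-1` A) `&` (setT `&` snd @^-1` B) : set T).
  by rewrite !setTI.
by apply: (@measurableI _ T); [exact: m1|exact: m2].
Qed.

Lemma eq_measure_rays2 (m1 m2 : probability (R * R)%type R) :
  (forall a c, m1 (`]a, +oo[ `*` `]c, +oo[) = m2 (`]a, +oo[ `*` `]c, +oo[)) ->
  forall A, measurable A -> m1 A = m2 A.
Proof.
move=> m12 A mA.
apply: (measure_unique rays2
   (fun k => `](- k%:R), +oo[ `*` `](- k%:R), +oo[)) => //.
- exact: measurable_rays2.
- move=> _ _ [a [c ->]] [a' [c' ->]]; exists (Num.max a a'), (Num.max c c').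
  rewrite -setXI; congr (_ `*` _);
    by apply/seteqP; split => [x /=|x /=]; rewrite !in_itv /= !andbT gt_max => /andP.
- by move=> k; exists (- k%:R), (- k%:R).
- apply/seteqP; split => // -[x y] _.
  have [k kx] := rays_cover x; have [l ly] := rays_cover y.
  exists (maxn k l) => //; split => /=; rewrite in_itv /= andbT.
    by rewrite (le_lt_trans _ kx) // lerN2 ler_nat leq_maxl.
  by rewrite (le_lt_trans _ ly) // lerN2 ler_nat leq_maxr.
- by move=> _ [a [c ->]]; exact: m12.
- move=> k; rewrite (le_lt_trans (probability_le1 _ _)) ?ltry //.
  exact: measurableX.
Qed.

End plane.

(** * Completeness of [L2] *)

Section L2_complete.
Context d (T : measurableType d) (R : realType) (P : probability T R).
Local Open Scope ereal_scope.

Lemma measurable_sqrB (f g : T -> R) : measurable_fun setT f ->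
  measurable_fun setT g ->
  measurable_fun setT (fun x => ((f x - g x) ^+ 2)%R%:E).
Proof.
by move=> mf mg; apply/measurable_EFinP/measurable_funX; exact: measurable_funB.
Qed.

(** Integrates [|f| <= c / 2 + f^2 / (2 c)], which stays within nonnegative integrals and needs no
    prior integrability. *)
Lemma integral_norm_le (f : T -> R) (c : R) : (0 < c)%R ->
  measurable_fun setT f -> \int[P]_x ((f x) ^+ 2)%:E <= (c ^+ 2)%:E ->
  \int[P]_x (`|f x|)%:E <= c%:E.
Proof.
move=> c0 mf fc.
have mf2 : measurable_fun setT (fun x => ((f x) ^+ 2)%:E).
  exact/measurable_EFinP/measurable_funX.
apply: (@le_trans _ _ (\int[P]_x ((c / 2)%:E + (2 * c)^-1%:E * ((f x) ^+ 2)%:E))).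
  apply: ge0_le_integral => //.
  - by apply/measurable_EFinP; exact: measurableT_comp.
  - by apply: emeasurable_funD => //; exact: measurable_funeM.
  - move=> x _; rewrite -EFinM -EFinD lee_fin.
    have := sqr_ge0 (`|f x| - c)%R; rewrite -[(f x ^+ 2)%R]real_normK ?num_real //.
    set a := (`|f x|)%R => h.
    rewrite -subr_ge0 [X in (0 <= X)%R](_ : _ = (a - c) ^+ 2 / (2 * c))%R; last first.
      by field; rewrite gt_eqF.
    by rewrite divr_ge0 // mulr_ge0 // ltW.
have c20 : (0 <= (2 * c)^-1)%R by rewrite invr_ge0 mulr_ge0 // ltW.
rewrite ge0_integralD //; first last.
- exact: measurable_funeM.
- by move=> x _; rewrite -EFinM lee_fin mulr_ge0 // sqr_ge0.
- by move=> x _; rewrite lee_fin divr_ge0 // ltW.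
rewrite integral_cst //= probability_setT mule1 ge0_integralZl //; last first.
  by move=> x _; rewrite lee_fin sqr_ge0.
apply: (@le_trans _ _ ((c / 2)%:E + (2 * c)^-1%:E * (c ^+ 2)%:E)).
  by rewrite leeD2l // lee_wpmul2l.
by rewrite -EFinM -EFinD lee_fin le_eqVlt; apply/predU1P; left; field; rewrite gt_eqF.
Qed.

Variable u : nat -> T -> R.
Hypothesis mu_ : forall n, measurable_fun setT (u n).
Hypothesis u_cauchy : forall e : R, (0 < e)%R -> exists N, forall m n,
  (N <= m)%N -> (N <= n)%N -> \int[P]_x ((u m x - u n x) ^+ 2)%:E <= e%:E.

(** Riesz-Fischer: along a subsequence whose increments have norm at most [2^-k] the increments are
    absolutely summable almost everywhere, and Fatou's lemma carries the Cauchy estimate to the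
    limit. *)
Lemma L2_complete : exists2 g : T -> R, measurable_fun setT g &
  forall e : R, (0 < e)%R -> exists N, forall n, (N <= n)%N ->
    \int[P]_x ((u n x - g x) ^+ 2)%:E <= e%:E.
Proof.
have c0 (k : nat) : (0 < 2^-1 ^+ k :> R)%R by rewrite exprn_gt0.
have /choice[N hN] : forall k : nat, exists N, forall m n, (N <= m)%N -> (N <= n)%N ->
    \int[P]_x ((u m x - u n x) ^+ 2)%:E <= ((2^-1 ^+ k) ^+ 2)%:E.
  by move=> k; apply: u_cauchy; rewrite exprn_gt0.
(* Nondecreasing and above [N k], as the increments require, and at least [k], so that
   [phi (k + N0)] is beyond [N0]. *)
pose phi k := (k + \sum_(i < k.+1) N i)%N.
have phiN k : (N k <= phi k)%N by rewrite /phi big_ord_recr /= addnA leq_addl.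
have phiS k : (phi k <= phi k.+1)%N.
  by rewrite /phi leq_add // [leqRHS]big_ord_recr /= leq_addr.
pose D k x := (u (phi k.+1) x - u (phi k) x)%R.
have mD k : measurable_fun setT (D k) by exact: measurable_funB.
have mDE k : measurable_fun setT (fun x => (`|D k x|)%:E).
  by apply/measurable_EFinP; exact: measurableT_comp.
have intD k : \int[P]_x (`|D k x|)%:E <= (2^-1 ^+ k)%:E.
  apply: integral_norm_le => //; apply: hN => //.
  exact: leq_trans (phiN k) (phiS k).
pose S x := \sum_(0 <= k <oo) (`|D k x|)%:E.
have mS : measurable_fun setT S.
  by apply: ge0_emeasurable_sum.
have S0 x : 0 <= S x by apply: nneseries_ge0.
have intS : \int[P]_x S x < +oo.
  rewrite integral_nneseries //.
  apply: (@le_lt_trans _ _ (\sum_(0 <= k <oo) (2^-1 ^+ k)%:E)).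
    by apply: lee_nneseries => // k _ _; exact: integral_ge0.
  apply: (@le_lt_trans _ _ 2%:E); last exact: ltry.
  apply: lime_le; first by apply: is_cvg_nneseries => k _ _; rewrite lee_fin ltW.
  apply: nearW => n; rewrite sumEFin lee_fin.
  have := @geometric_le_lim R n 1 2^-1 ler01.
  rewrite /series /=; under eq_bigr do rewrite mul1r.
  rewrite mul1r (_ : (1 - 2^-1)^-1 = 2)%R; last by field.
  by apply; rewrite ?invr_gt0 // ger0_norm ?invr_ge0 // invf_lt1 // ltr1n.
have iS : P.-integrable setT S.
  apply/integrableP; split => //.
  by under eq_integral do rewrite gee0_abs //.
have good : {ae P, forall x, cvgn (fun k => u (phi k) x)}.
  have := integrable_ae measurableT iS; apply: filterS => x /(_ Logic.I) fS.
  have cn : cvgn [normed series (D ^~ x)].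
    apply: nondecreasing_is_cvgn.
      by apply/nondecreasing_seqP => n; rewrite /normed_series_of seriesSr lerDl /=.
    exists (fine (S x)) => _ [n _ <-]; rewrite -lee_fin fineK //.
    by rewrite /normed_series_of /series /= -sumEFin; exact: nneseries_lim_ge.
  have := normed_cvg cn => /cvg_ex[l hl].
  have e : (fun k => u (phi k) x) = (fun k => u (phi 0%N) x + series (D^~ x) k)%R.
    apply/funext => k; rewrite (_ : series _ k = u (phi k) x - u (phi 0%N) x)%R.
      by rewrite addrC subrK.
    by rewrite /series /= telescope_sumr.
  rewrite e; apply/cvg_ex; exists (u (phi 0%N) x + l)%R.
  by apply: cvgD => //; exact: cvg_cst.
(* The upper limit is measurable without exceptional set and equals the limit wherever that
   exists. *)
pose g x := fine (limn_esup (fun k => (u (phi k) x)%:E)).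
have mg : measurable_fun setT g.
  apply: (@measurableT_comp _ _ _ _ _ _ (@fine R)) => //.
  by apply: measurable_fun_limn_esup => k; exact/measurable_EFinP.
have goodg : {ae P, forall x, (fun k => u (phi k) x) @ \oo --> g x}.
  apply: filterS good => x /cvg_ex[l ul].
  have ulE : (fun k => (u (phi k) x)%:E) @ \oo --> l%:E.
    by apply: cvg_EFin => //; exact: nearW.
  by rewrite /g (cvg_limn_einf_sup ulE).2.
exists g => // e e0.
have [N0 hN0] := u_cauchy e0; exists N0 => n nN0.
have hphi k : (N0 <= phi (k + N0))%N.
  by rewrite /phi -addnA addnCA leq_addr.
pose f k x := ((u n x - u (phi (k + N0)%N) x) ^+ 2)%:E.
have mf k : measurable_fun setT (f k) by exact: measurable_sqrB.
have f0 k x : setT x -> 0 <= f k x by move=> _; rewrite lee_fin sqr_ge0.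
apply: (@le_trans _ _ (\int[P]_x limn_einf (f^~ x))).
  apply: ae_ge0_le_integral => //.
  - by move=> x _; rewrite lee_fin sqr_ge0.
  - exact: measurable_sqrB.
  - move=> x _; rewrite limn_einf_lim; apply: lime_ge; first exact: is_cvg_einfs.
    by apply: nearW => k; apply: le_ereal_inf_tmp => _ [j _ <-]; exact: f0.
  - rewrite /limn_einf; apply: measurableT_comp => //.
    by apply: measurable_fun_limn_esup => k; exact: measurableT_comp.
  apply: filterS goodg => x ux _.
  suff fx : f^~ x @ \oo --> ((u n x - g x) ^+ 2)%:E.
    by rewrite (cvg_limn_einf_sup fx).1.
  apply: cvg_EFin; first exact: nearW.
  have ux' : (fun k => u (phi (k + N0)%N) x) @ \oo --> g x.
    by rewrite (cvg_shiftn N0 (fun k => u (phi k) x)).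
  have : (fun k => u n x - u (phi (k + N0)%N) x)%R @ \oo --> (u n x - g x)%R.
    by apply: cvgB => //; exact: cvg_cst.
  by move/(cvg_comp _ (fun y : R => y ^+ 2)%R); apply; exact: exprn_continuous.
apply: (le_trans (fatou _ _ mf f0)) => //.
rewrite limn_einf_lim; apply: lime_le; first exact: is_cvg_einfs.
apply: nearW => k; apply: ge_ereal_inf; exists (\int[P]_x f k x); last exact: hN0.
by exists k => /=.
Qed.
End L2_complete.

(** * Coupling all tree sizes on the unit interval *)

Section select.
Variables (R : realType) (A : Type) (a0 : A).
Implicit Types s : seq (R * A).

(* The value at [u] of the step function with consecutive steps
   [(length, value)] starting at [c]. *)
Fixpoint sel s (c u : R) : A :=
  match s with
  | [::] => a0
  | p :: s' => if u < c + p.1 then p.2 else sel s' (c + p.1) u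
  end.

Lemma measurable_sel (F : A -> R) s c : measurable_fun setT (fun u => F (sel s c u)).
Proof.
elim: s c => [|p s IH] c /=; first exact: measurable_cst.
rewrite (_ : (fun u => _) =
   (fun u => if u < c + p.1 then F p.2 else F (sel s (c + p.1) u))); last first.
  by apply/funext => u; case: ifP.
by apply: measurable_fun_ifT => //; exact: measurable_fun_ltr.
Qed.

Lemma integral_sel (F : A -> R) s c : all (fun p => 0 <= p.1) s ->
  (\int[lebesgue_measure]_(u in `[c, (c + \sum_(p <- s) p.1)%R[) (F (sel s c u))%:E
   = (\sum_(p <- s) p.1 * F p.2)%R%:E)%E.
Proof.
elim: s c => [|p s IH] c /=.
  by move=> _; rewrite !big_nil addr0 set_itvco0 integral_set0.
move=> /andP[p0 s0]; rewrite !big_cons addrA.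
have S0 : 0 <= \sum_(q <- s) q.1.
  elim: s s0 {IH} => [|q s IH] /=; first by rewrite big_nil.
  by move=> /andP[q0 s0]; rewrite big_cons addr_ge0 // IH.
rewrite (@itv_bndbnd_setU _ _ _ (BLeft (c + p.1))); last 2 first.
  by rewrite bnd_simp lerDl.
  by rewrite bnd_simp lerDl.
rewrite integral_setU //=; last 2 first.
- apply/measurable_EFinP; apply: (measurable_funS measurableT) => //.
  exact: (measurable_sel F (p :: s) c).
- apply/disj_setPS => u [] /=; rewrite !in_itv /= => /andP[_ h1] /andP[h2 _].
  by move: h1; rewrite ltNge h2.
rewrite EFinD; congr (_ + _)%E.
  rewrite (eq_integral (cst (F p.2)%:E)); last first.
    by move=> u; rewrite inE /= in_itv /= => /andP[_ ->].
  rewrite integral_cst //= lebesgue_measure_itv /= lte_fin ltrDl.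
  rewrite EFinM muleC; case: ltP => [h|h].
    by rewrite -EFinD addrAC subrr add0r.
  have -> : p.1 = 0 by apply/eqP; rewrite eq_le h.
  by [].
rewrite -(IH (c + p.1)) //; apply: eq_integral => u; rewrite inE /= in_itv /= => /andP[h _].
by rewrite ltNge h.
Qed.

Lemma sel_cat s1 s2 c u : all (fun p => 0 <= p.1) s1 -> c <= u ->
  sel (s1 ++ s2) c u = if u < c + \sum_(p <- s1) p.1 then sel s1 c u
                       else sel s2 (c + \sum_(p <- s1) p.1) u.
Proof.
elim: s1 c => [|p s IH] c /=.
  by rewrite big_nil addr0 ltNge => _ ->.
move=> /andP[p0 s0] cu; rewrite big_cons addrA.
case: (ltP u (c + p.1)) => h; last by rewrite IH.
have S0 : 0 <= \sum_(q <- s) q.1.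
  elim: s s0 {IH} => [|q s IH] /=; first by rewrite big_nil.
  by move=> /andP[q0 s0]; rewrite big_cons addr_ge0 // IH.
by rewrite (lt_le_trans h) // lerDl.
Qed.

End select.

Section select_eq.
Variables (R : realType) (A : eqType) (a0 : A).
Implicit Types s : seq (R * A).

Lemma mem_sel s c u : c <= u < c + \sum_(p <- s) p.1 ->
  sel a0 s c u \in map snd s.
Proof.
elim: s c => [|p s IH] c /=; first by rewrite big_nil addr0; lra.
rewrite big_cons addrA; case: (ltP u (c + p.1)) => [_ _|h1 /andP[_ h2]].
  by rewrite mem_head.
by rewrite in_cons IH ?orbT // h1.
Qed.

(** Every step of [s] is cut into consecutive pieces in the proportions given by [k]. *)
Definition expand (k : A -> seq (R * A)) s : seq (R * A) :=
  flatten [seq [seq (p.1 * q.1, q.2) | q <- k p.2] | p <- s].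

(** The pieces of a step fill exactly that step, so [pr] recovers the coarse value at the same point
    [u]. The successive refinements are thereby coupled pointwise and not merely in law. *)
Lemma sel_expand (k : A -> seq (R * A)) (pr : A -> A) s c u :
  all (fun p => 0 <= p.1) s ->
  (forall a, all (fun q => (0 <= q.1) && (pr q.2 == a)) (k a)) ->
  (forall a, \sum_(q <- k a) q.1 = 1) ->
  c <= u < c + \sum_(p <- s) p.1 ->
  pr (sel a0 (expand k s) c u) = sel a0 s c u.
Proof.
move=> + k0 k1; elim: s c => [|p s IH] c /=.
  by move=> _; rewrite big_nil addr0 => /andP[h]; rewrite ltNge h.
move=> /andP[p0 s0]; rewrite big_cons => cu.
have S1 : \sum_(x <- [seq (p.1 * q.1, q.2) | q <- k p.2]) x.1 = p.1.
  by rewrite big_map /= -big_distrr /= k1 mulr1.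
rewrite /expand /= sel_cat ?S1; last 2 first.
- rewrite all_map; apply/allP => q /= qk; rewrite mulr_ge0 //.
  by have /allP/(_ _ qk)/andP[] := k0 p.2.
- by case/andP: cu.
case: ltP => h; last by rewrite IH // h /= -addrA; case/andP: cu.
have := @mem_sel [seq (p.1 * q.1, q.2) | q <- k p.2] c u.
rewrite S1 h andbT => /(_ (proj1 (andP cu)))/mapP[x /mapP[q qk ->] ->].
by have /allP/(_ _ qk)/andP[_ /eqP] := k0 p.2.
Qed.

End select_eq.

HB.instance Definition _ := gen_eqMixin btree.

(** * The growing tree as a function of one uniform variable *)

Section coupling.
Variables (R : realType) (theta : R).
Hypothesis theta_gt0 : 0 < theta.

(** States are histories, latest tree first: the tree of any smaller size is obtained by [drop], and
    conditioning on the past is conditioning on the tail. *)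
Definition kappa (h : seq btree) : seq (R * seq btree) :=
  [seq (q.1 / (theta + (bsize (head (Leaf 0) h))%:R - 1), q.2 :: h)
  | q <- wsuccs theta (head (Leaf 0) h)].

Fixpoint hist (N : nat) : seq (R * seq btree) :=
  match N with
  | 0 => [:: (1, [:: Leaf 0])]
  | m.+1 => expand kappa (hist m)
  end.

Definition unif01 : probability (measurableTypeR R) R := uniform_prob (@ltr01 R).

Definition hproc (N : nat) (u : R) : seq btree := sel [::] (hist N) 0 u.
Definition bproc (N : nat) (u : R) : btree := head (Leaf 0) (hproc N u).

Lemma wsuccsP (t : R) b q : 0 <= t -> q \in wsuccs t b ->
  0 <= q.1 /\ bsize q.2 = (bsize b).+1.
Proof.
elim: b t q => [l|r Hr s Hs] t q t0 /=.
  by rewrite mem_seq1 => /eqP ->.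
rewrite mem_cat => /orP[] /mapP[p pr ->] /=.
  by have [? ->] := Hr _ _ t0 pr.
by have [? ->] := Hs _ _ ler01 pr; rewrite addnS.
Qed.

Lemma weight_gt0 b : 0 < theta + (bsize b)%:R - 1.
Proof. by have := bsize_gt0 b; have := theta_gt0; rewrite -(ler_nat R); lra. Qed.

Lemma kappa_all h : all (fun q => (0 <= q.1) && (behead q.2 == h)) (kappa h).
Proof.
apply/allP => _ /mapP[q qs ->] /=; rewrite eqxx andbT.
have [q0 _] := wsuccsP (ltW theta_gt0) qs.
by rewrite divr_ge0 // ltW // weight_gt0.
Qed.

Lemma kappa_sum (F : btree -> seq btree -> R) h :
  \sum_(q <- kappa h) q.1 * F (head (Leaf 0) q.2) (behead q.2) =
  gsum theta (fun b => F b h) (head (Leaf 0) h)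
    / (theta + (bsize (head (Leaf 0) h))%:R - 1).
Proof.
rewrite big_map /= /gsum big_distrl /=; apply: eq_bigr => q _.
by rewrite mulrAC.
Qed.

Lemma kappa1 h : \sum_(q <- kappa h) q.1 = 1.
Proof.
have := kappa_sum (fun _ _ => 1) h; under eq_bigr do rewrite mulr1.
by move=> ->; rewrite gsum_cst mulr1 divff // gt_eqF // weight_gt0.
Qed.

Lemma hist_all N p : p \in hist N ->
  0 <= p.1 /\ bsize (head (Leaf 0) p.2) = N.+1.
Proof.
elim: N p => [|N IH] p /=; first by rewrite mem_seq1 => /eqP ->.
move=> /flatten_mapP[x /IH[x0 xN]] /mapP[q qk ->] /=.
have /allP/(_ _ qk)/andP[q0 _] := kappa_all x.2; split; first exact: mulr_ge0.
move: qk => /mapP[y ys ->] /=; have [_ ->] := wsuccsP (ltW theta_gt0) ys.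
by rewrite xN.
Qed.

Lemma hist_ge0 N : all (fun p => 0 <= p.1) (hist N).
Proof. by apply/allP => p /hist_all[]. Qed.

Lemma big_histS N (F : btree -> seq btree -> R) :
  \sum_(p <- hist N.+1) p.1 * F (head (Leaf 0) p.2) (behead p.2) =
  \sum_(p <- hist N) p.1 *
    (gsum theta (fun b => F b p.2) (head (Leaf 0) p.2) / (theta + N%:R)).
Proof.
rewrite /= /expand big_flatten big_map big_seq [in RHS]big_seq.
apply: eq_bigr => p /hist_all[_ pN]; rewrite big_map /=.
under eq_bigr do rewrite -mulrA.
by rewrite -big_distrr /= kappa_sum pN -natr1 addrA addrK.
Qed.

Lemma big_hist N (F : btree -> R) :
  \sum_(p <- hist N) p.1 * F (head (Leaf 0) p.2) = bE theta N F.
Proof.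
elim: N F => [|N IH] F; first by rewrite big_seq1 /= mul1r.
rewrite (big_histS N (fun b _ => F b)).
exact: (IH (fun b => gsum theta F b / (theta + N%:R))).
Qed.

Lemma hist1 N : \sum_(p <- hist N) p.1 = 1.
Proof.
have := big_hist N (fun=> 1); under eq_bigr do rewrite mulr1.
by rewrite bE_cst.
Qed.

Lemma integral_unif01 (f : R -> \bar R) : measurable_fun setT f ->
  (\int[unif01]_x f x = \int[lebesgue_measure]_(x in `[0%R, 1%R[) f x)%E.
Proof.
move=> mf.
have h (g : R -> \bar R) : measurable_fun setT g -> (forall x, (0 <= g x)%E) ->
  (\int[unif01]_x g x = \int[lebesgue_measure]_(x in `[0%R, 1%R[) g x)%E.
  move=> mg g0; rewrite integral_uniform // subr0 invr1 mul1e.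
  by rewrite [RHS]integral_itv_bndo_bndc //; exact: measurable_funS mg.
rewrite integralE [RHS]integralE !h //.
- exact: measurable_funeneg.
- exact: measurable_funepos.
Qed.

Lemma measurable_hproc (F : seq btree -> R) N :
  measurable_fun setT (fun u => F (hproc N u)).
Proof. exact: measurable_sel. Qed.

Lemma integral_hproc (F : seq btree -> R) N :
  (\int[unif01]_u (F (hproc N u))%:E = (\sum_(p <- hist N) p.1 * F p.2)%R%:E)%E.
Proof.
rewrite integral_unif01; last by apply/measurable_EFinP; exact: (measurable_hproc F N).
by rewrite -(@integral_sel _ _ [::] F (hist N) 0) ?hist_ge0 // hist1 add0r.
Qed.

Lemma hproc_drop N k u : 0 <= u < 1 -> drop k (hproc (N + k) u) = hproc N u.
Proof.
move=> u01; elim: k => [|k IH]; first by rewrite addn0 drop0.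
rewrite -IH -addn1 -drop_drop drop1 addnA addn1; congr drop.
apply: sel_expand => [||a|]; [exact: hist_ge0|exact: kappa_all|exact: kappa1|].
by rewrite hist1 add0r.
Qed.

Lemma measurable_bproc (F : btree -> R) N :
  measurable_fun setT (fun u => F (bproc N u)).
Proof. exact: (measurable_hproc (fun h => F (head (Leaf 0) h))). Qed.

Lemma integral_bproc (F : btree -> R) N :
  (\int[unif01]_u (F (bproc N u))%:E = (bE theta N F)%:E)%E.
Proof.
by rewrite (integral_hproc (fun h => F (head (Leaf 0) h))) big_hist.
Qed.

(* Orthogonality of martingale increments, in the coupled space. *)
Lemma mart_L2_dist (m : nat -> btree -> R) (D : nat -> R) :
  (forall N b, bsize b = N.+1 ->
     gsum theta (m N.+1) b = (theta + (bsize b)%:R - 1) * m N b) ->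
  (forall N, bE theta N (fun b => gsum theta
    (fun b' => (m N.+1 b' - m N b) ^+ 2) b / (theta + N%:R)) <= D N - D N.+1) ->
  forall N k, (\int[unif01]_u ((m (N + k)%N (bproc (N + k) u)
     - m N (bproc N u)) ^+ 2)%R%:E <= (D N - D (N + k)%N)%R%:E)%E.
Proof.
move=> mart incr N k.
pose G h := (m (N + k)%N (head (Leaf 0) h) - m N (head (Leaf 0) (drop k h))) ^+ 2.
rewrite (_ : (\int[unif01]_u _)%E =
    (\int[unif01]_u (G (hproc (N + k) u))%:E)%E); last first.
  rewrite !integral_unif01; last 2 first.
  - by apply/measurable_EFinP; exact: (measurable_hproc G).
  - apply/measurable_EFinP/measurable_funX/measurable_funB;
      exact: measurable_bproc.
  apply: eq_integral => u; rewrite inE /= in_itv /= => u01.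
  by rewrite /G hproc_drop.
rewrite (integral_hproc G) lee_fin /G {G}.
elim: k => [|k IH].
  rewrite addn0 subrr big1 // => p _; by rewrite drop0 subrr expr0n mulr0.
rewrite addnS.
have -> : \sum_(p <- hist (N + k).+1) p.1 * (m (N + k).+1 (head (Leaf 0) p.2)
    - m N (head (Leaf 0) (drop k.+1 p.2))) ^+ 2
  = \sum_(p <- hist (N + k).+1) p.1 * (m (N + k).+1 (head (Leaf 0) p.2)
    - m N (head (Leaf 0) (drop k (behead p.2)))) ^+ 2.
  by apply: eq_bigr => p _; rewrite -drop1 drop_drop addn1.
rewrite (big_histS _ (fun b h => (m (N + k).+1 b
    - m N (head (Leaf 0) (drop k h))) ^+ 2)).
have s0 : 0 < theta + (N + k)%:R by rewrite ltr_wpDr.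
rewrite [leLHS](_ : _ = \sum_(p <- hist (N + k)) p.1 *
   (m (N + k)%N (head (Leaf 0) p.2) - m N (head (Leaf 0) (drop k p.2))) ^+ 2
   + bE theta (N + k) (fun b => gsum theta
    (fun b' => (m (N + k).+1 b' - m (N + k)%N b) ^+ 2) b / (theta + (N + k)%:R))).
  by have := lerD IH (incr (N + k)%N); lra.
rewrite -big_hist -big_split /= big_seq [in RHS]big_seq.
apply: eq_bigr => p /hist_all[_ pN]; rewrite -mulrDr; congr (_ * _).
set b := head _ p.2 in pN *; set y := m N _; set M := (N + k)%N in s0 pN *.
(* The square is expanded around [m M b]. As [y] depends on the history only, the martingale
   property cancels the cross term. *)
have -> : gsum theta (fun b0 => (m M.+1 b0 - y) ^+ 2) b =
   gsum theta (fun b' => (m M.+1 b' - m M b) ^+ 2) b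
   + (2 * (m M b - y) * gsum theta (m M.+1) b
   + gsum theta (fun=> y ^+ 2 - m M b ^+ 2) b).
  by rewrite -gsumZ -!gsumD; apply: eq_gsum => b' _; ring.
rewrite mart // gsum_cst pN -[M.+1%:R]natr1 [theta + (_ + 1)]addrA addrK.
by move: s0; set s := theta + _ => s0; field; rewrite gt_eqF.
Qed.

End coupling.

(** * Expectations and mean-square convergence *)

Section expectation.
Context d (T : measurableType d) (R : realType) (P : probability T R).
Implicit Types (f g h : T -> R).

Definition integ f : Prop := P.-integrable setT (EFin \o f).
Definition ex f : R := \int[P]_x f x.

Lemma integ_dom f g : measurable_fun setT f -> integ g ->
  (forall x, `|f x| <= g x) -> integ f.
Proof.
move=> mf ig fg; apply: le_integrable ig => //; first exact/measurable_EFinP.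
move=> x _ /=; rewrite lee_fin (le_trans (fg x)) //; exact: ler_norm.
Qed.

Lemma integ_cst (c : R) : integ (fun=> c).
Proof. exact: finite_measure_integrable_cst. Qed.

Lemma integ_bounded f (M : R) : measurable_fun setT f ->
  (forall x, `|f x| <= M) -> integ f.
Proof. by move=> mf fM; exact: integ_dom mf (integ_cst M) fM. Qed.

Lemma integD f g : integ f -> integ g -> integ (fun x => f x + g x).
Proof.
move=> intf intg; rewrite /integ (_ : _ \o _ = (EFin \o f) \+ (EFin \o g))%E //.
exact: integrableD.
Qed.

Lemma integZ (c : R) f : integ f -> integ (fun x => c * f x).
Proof.
move=> intf; rewrite /integ (_ : _ \o _ = (fun x => c%:E * (EFin \o f) x)%E) //.
exact: integrableZl.
Qed.

Lemma integN f : integ f -> integ (fun x => - f x).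
Proof.
move=> /(integZ (-1)); rewrite (_ : (fun x => _) = (fun x => - f x)) //.
by apply/funext => x; rewrite mulN1r.
Qed.

Lemma integB f g : integ f -> integ g -> integ (fun x => f x - g x).
Proof. by move=> intf intg; apply: integD => //; exact: integN. Qed.

Lemma integ_normr f : integ f -> integ (fun x => `|f x|).
Proof. exact: integrable_norm. Qed.

Lemma ex_cst (c : R) : ex (fun=> c) = c.
Proof. by rewrite /ex Rintegral_cst //= probability_setT mulr1. Qed.

Lemma exD f g : integ f -> integ g -> ex (fun x => f x + g x) = ex f + ex g.
Proof. exact: RintegralD. Qed.

Lemma exB f g : integ f -> integ g -> ex (fun x => f x - g x) = ex f - ex g.
Proof. exact: RintegralB. Qed.

Lemma exZ (c : R) f : integ f -> ex (fun x => c * f x) = c * ex f.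
Proof. exact: RintegralZl. Qed.

Lemma eq_ex f g : f =1 g -> ex f = ex g.
Proof. by move=> fg; apply: eq_Rintegral => x _; exact: fg. Qed.

Lemma le_ex f g : integ f -> integ g -> (forall x, f x <= g x) -> ex f <= ex g.
Proof. by move=> intf intg fg; apply: le_Rintegral => // x _; exact: fg. Qed.

Lemma ex_ge0 f : (forall x, 0 <= f x) -> 0 <= ex f.
Proof. by move=> f0; apply: Rintegral_ge0 => x _; exact: f0. Qed.

Lemma le_norm_ex f : integ f -> `|ex f| <= ex (fun x => `|f x|).
Proof. exact: le_normr_Rintegral. Qed.

Lemma EFin_ex f : integ f -> (ex f)%:E = (\int[P]_x (f x)%:E)%E.
Proof. by move=> intf; rewrite /ex /Rintegral fineK //; exact: integrable_fin_num. Qed.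

Lemma le_norm_exB f g h : integ f -> integ g -> integ h ->
  (forall x, `|f x - g x| <= h x) -> `|ex f - ex g| <= ex h.
Proof.
move=> intf intg inth fgh; rewrite -exB //; have intB := integB intf intg.
by apply: (le_trans (le_norm_ex intB)); apply: le_ex => //; exact: integ_normr.
Qed.

Definition sqi f : Prop := measurable_fun setT f /\ integ (fun x => f x ^+ 2).

Lemma sqiM f g : sqi f -> sqi g -> integ (fun x => f x * g x).
Proof.
move=> [mf if2] [mg ig2]; apply: (integ_dom _ (integD if2 ig2)).
  exact: measurable_funM.
move=> x; rewrite normrM -[f x ^+ 2]real_normK ?num_real //.
rewrite -[g x ^+ 2]real_normK ?num_real //.
have := sqr_ge0 (`|f x| - `|g x|); have := sqr_ge0 `|f x|.
by have := sqr_ge0 `|g x|; nra.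
Qed.

Lemma sqi_cst (c : R) : sqi (fun=> c).
Proof. by split; [exact: measurable_cst|exact: integ_cst]. Qed.

Lemma sqi_integ f : sqi f -> integ f.
Proof.
move=> /sqiM/(_ (sqi_cst 1)); congr integ.
by apply/funext => x; rewrite mulr1.
Qed.

Lemma sqiD f g : sqi f -> sqi g -> sqi (fun x => f x + g x).
Proof.
move=> sf sg; have [mf if2] := sf; have [mg ig2] := sg; split.
  exact: measurable_funD.
rewrite (_ : (fun x => _) = (fun x => f x ^+ 2 + g x ^+ 2 + 2 * (f x * g x))).
  by apply: integD; [exact: integD|exact: integZ (sqiM sf sg)].
by apply/funext => x; ring.
Qed.

Lemma sqiZ (c : R) f : sqi f -> sqi (fun x => c * f x).
Proof.
move=> [mf if2]; split; first by apply: measurable_funM.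
rewrite (_ : (fun x => _) = (fun x => c ^+ 2 * f x ^+ 2)); first exact: integZ.
by apply/funext => x; rewrite exprMn.
Qed.

Lemma sqiB f g : sqi f -> sqi g -> sqi (fun x => f x - g x).
Proof.
move=> sf sg; rewrite (_ : (fun x => _) = (fun x => f x + -1 * g x)).
  by apply: sqiD => //; exact: sqiZ.
by apply/funext => x; rewrite mulN1r.
Qed.

Lemma sqi_normr f : sqi f -> sqi (fun x => `|f x|).
Proof.
move=> [mf if2]; split; first exact: measurableT_comp.
by under eq_fun do rewrite real_normK ?num_real //.
Qed.

Lemma cauchy_schwarz f g : sqi f -> sqi g ->
  ex (fun x => f x * g x) ^+ 2 <= ex (fun x => f x ^+ 2) * ex (fun x => g x ^+ 2).
Proof.
move=> sf sg; have [_ if2] := sf; have [_ ig2] := sg.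
have ifg := sqiM sf sg.
set A := ex (fun x => f x ^+ 2); set B := ex (fun x => g x ^+ 2).
set C := ex _.
have A0 : 0 <= A by apply: ex_ge0 => x; exact: sqr_ge0.
have B0 : 0 <= B by apply: ex_ge0 => x; exact: sqr_ge0.
have key (t : R) : 0 <= A + 2 * t * C + t ^+ 2 * B.
  rewrite /A /B /C -!exZ // -exD //; last exact: integZ.
  rewrite -exD //; [|apply: integD => //; exact: integZ|exact: integZ].
  apply: ex_ge0 => x.
  rewrite [X in 0 <= X](_ : _ = (f x + t * g x) ^+ 2) ?sqr_ge0 //.
  by ring.
have [B00|B1] := eqVneq B 0.
  have [->|C0] := eqVneq C 0; first by rewrite expr0n B00 mulr0.
  (* For [B = 0] the polynomial in [t] is affine, and a nonzero [C] would let it reach -1. *)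
  have := key (- (A + 1) / (2 * C)); rewrite B00 mulr0 addr0.
  have -> : A + 2 * (- (A + 1) / (2 * C)) * C = -1 by field.
  by rewrite ler0N1.
have Bp : 0 < B by rewrite lt_def B1.
have := key (- C / B).
have -> : A + 2 * (- C / B) * C + (- C / B) ^+ 2 * B = (A * B - C ^+ 2) / B.
  by field; rewrite gt_eqF.
by rewrite pmulr_lge0 ?invr_gt0 // subr_ge0.
Qed.

Definition sqnorm f : R := ex (fun x => f x ^+ 2).

Lemma n2_ge0 f : 0 <= sqnorm f.
Proof. by apply: ex_ge0 => x; exact: sqr_ge0. Qed.

Lemma norm_exM_le f g : sqi f -> sqi g ->
  `|ex (fun x => f x * g x)| <= Num.sqrt (sqnorm f) * Num.sqrt (sqnorm g).
Proof.
move=> sf sg; rewrite -sqrtrM ?n2_ge0 // -sqrtr_sqr ler_wsqrtr //.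
exact: cauchy_schwarz.
Qed.

Lemma ex_norm_le f : sqi f -> ex (fun x => `|f x|) <= Num.sqrt (sqnorm f).
Proof.
move=> sf; have := norm_exM_le (sqi_normr sf) (sqi_cst 1).
rewrite /sqnorm expr1n ex_cst sqrtr1 mulr1.
under [X in ex X]eq_fun do rewrite mulr1.
under [X in _ <= Num.sqrt (ex X)]eq_fun do rewrite real_normK ?num_real //.
by apply: le_trans; exact: ler_norm.
Qed.

Lemma n2D_le f g : sqi f -> sqi g -> sqnorm (fun x => f x + g x) <= 2 * sqnorm f + 2 * sqnorm g.
Proof.
move=> sf sg; have [_ if2] := sf; have [_ ig2] := sg.
rewrite /sqnorm -!exZ // -exD //; try exact: integZ.
apply: le_ex; first by have [] := sqiD sf sg.
  by apply: integD; exact: integZ.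
by move=> x; have := sqr_ge0 (f x - g x); nra.
Qed.

Lemma n2Z (c : R) f : sqi f -> sqnorm (fun x => c * f x) = c ^+ 2 * sqnorm f.
Proof.
move=> [_ if2]; rewrite /sqnorm -exZ //; apply: eq_ex => x.
by rewrite exprMn.
Qed.

Definition L2cvg (u : nat -> T -> R) f : Prop :=
  (fun n => sqnorm (fun x => u n x - f x)) @ \oo --> 0.

Lemma L2cvgZ (u : nat -> T -> R) f (a : nat -> R) (c : R) :
  (forall n, sqi (u n)) -> sqi f -> L2cvg u f -> a @ \oo --> c ->
  L2cvg (fun n x => a n * u n x) (fun x => c * f x).
Proof.
move=> su sf uf ac.
apply: (@squeeze_cvgr _ _ _ _ (cst 0) (fun n =>
  2 * (a n ^+ 2 * sqnorm (fun x => u n x - f x)) + 2 * ((a n - c) ^+ 2 * sqnorm f))).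
- apply: nearW => n; rewrite n2_ge0 /=.
  rewrite -!n2Z //; last exact: sqiB.
  rewrite (_ : sqnorm _ = sqnorm (fun x => a n * (u n x - f x) + (a n - c) * f x)).
    by apply: n2D_le; apply: sqiZ => //; exact: sqiB.
  by congr sqnorm; apply/funext => x; ring.
- exact: cvg_cst.
- have -> : 0 = 2 * (c ^+ 2 * 0) + 2 * ((c - c) ^+ 2 * sqnorm f) :> R by ring.
  apply: cvgD; apply: cvgM; (try exact: cvg_cst); apply: cvgM => //;
    (try exact: cvg_cst).
    by apply: (cvg_comp _ (fun y : R => y ^+ 2) ac); exact: exprn_continuous.
  apply: (cvg_comp _ (fun y : R => y ^+ 2) _ (@exprn_continuous _ 2 (c - c))).
  by apply: cvgB => //; exact: cvg_cst.
Qed.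

Lemma L2cvgD (u v : nat -> T -> R) f g :
  (forall n, sqi (u n)) -> sqi f -> (forall n, sqi (v n)) -> sqi g ->
  L2cvg u f -> L2cvg v g ->
  L2cvg (fun n x => u n x + v n x) (fun x => f x + g x).
Proof.
move=> su sf sv sg uf vg.
apply: (@squeeze_cvgr _ _ _ _ (cst 0) (fun n =>
  2 * sqnorm (fun x => u n x - f x) + 2 * sqnorm (fun x => v n x - g x))).
- apply: nearW => n; rewrite n2_ge0 /=.
  rewrite (_ : sqnorm _ = sqnorm (fun x => (u n x - f x) + (v n x - g x))).
    by apply: n2D_le; exact: sqiB.
  by congr sqnorm; apply/funext => x; ring.
- exact: cvg_cst.
- have -> : 0 = 2 * 0 + 2 * 0 :> R by ring.
  by apply: cvgD; apply: cvgM => //; exact: cvg_cst.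
Qed.

Lemma sqrt_cvg0 (a : nat -> R) : a @ \oo --> 0 ->
  (fun n => Num.sqrt (a n)) @ \oo --> 0.
Proof.
move=> a0; rewrite -[X in _ --> X](@sqrtr0 R).
by apply: (cvg_comp _ (@Num.sqrt R) a0); exact: sqrt_continuous.
Qed.

Lemma L2cvg_exM (u v : nat -> T -> R) f g :
  (forall n, sqi (u n)) -> sqi f -> (forall n, sqi (v n)) -> sqi g ->
  L2cvg u f -> L2cvg v g ->
  (fun n => ex (fun x => u n x * v n x)) @ \oo --> ex (fun x => f x * g x).
Proof.
move=> su sf sv sg uf vg.
have su' n : sqi (fun x => u n x - f x) by exact: sqiB.
have sv' n : sqi (fun x => v n x - g x) by exact: sqiB.
have E n : ex (fun x => u n x * v n x) = ex (fun x => f x * g x)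
   + (ex (fun x => (u n x - f x) * (v n x - g x))
      + (ex (fun x => (u n x - f x) * g x) + ex (fun x => f x * (v n x - g x)))).
  have i1 := sqiM (su' n) (sv' n); have i2 := sqiM (su' n) sg.
  have i3 := sqiM sf (sv' n); have i4 := sqiM sf sg.
  rewrite -exD // -exD //; last exact: integD.
  rewrite -exD //; last by apply: integD => //; exact: integD.
  by apply: eq_ex => x; ring.
have z (p q : nat -> T -> R) : (forall n, sqi (p n)) -> (forall n, sqi (q n)) ->
    (fun n => Num.sqrt (sqnorm (p n)) * Num.sqrt (sqnorm (q n))) @ \oo --> 0 ->
    (fun n => ex (fun x => p n x * q n x)) @ \oo --> 0.
  move=> sp sq h; apply/norm_cvg0P.
  apply: (@squeeze_cvgr _ _ _ _ (cst 0) _ _ _ _ _ h); last exact: cvg_cst.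
  by apply: nearW => n; rewrite normr_ge0 /=; exact: norm_exM_le.
rewrite (funext E).
rewrite -[X in _ --> X]addr0 -[X in _ + X]addr0 -[X in _ + (_ + X)]addr0.
apply: cvgD; first exact: cvg_cst.
apply: cvgD; last apply: cvgD; apply: z => //.
- by rewrite -[X in _ --> X](mulr0 0); apply: cvgM; exact: sqrt_cvg0.
- rewrite -[X in _ --> X](mul0r (Num.sqrt (sqnorm g))).
  by apply: cvgM; [exact: sqrt_cvg0|exact: cvg_cst].
- rewrite -[X in _ --> X](mulr0 (Num.sqrt (sqnorm f))).
  by apply: cvgM; [exact: cvg_cst|exact: sqrt_cvg0].
Qed.

End expectation.

Section L2_limit.
Context d (T : measurableType d) (R : realType) (P : probability T R).

Lemma L2_limit (u : nat -> T -> R) : (forall n, sqi P (u n)) ->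
  (forall e : R, 0 < e -> exists N, forall m n, (N <= m)%N -> (N <= n)%N ->
     sqnorm P (fun x => u m x - u n x) <= e) ->
  exists2 g, sqi P g & L2cvg P u g.
Proof.
move=> su cu.
have su' m n : integ P (fun x => (u m x - u n x) ^+ 2).
  by have [] := sqiB (su m) (su n).
have [|e e0|g mg ug] := @L2_complete _ T R P u.
- by move=> n; have [] := su n.
- have [N hN] := cu e e0; exists N => m n Nm Nn.
  by rewrite -(EFin_ex (su' m n)) lee_fin; exact: hN.
have mug n : measurable_fun setT (fun x => u n x - g x).
  by apply: measurable_funB => //; have [] := su n.
have sug : exists N, forall n, (N <= n)%N -> sqi P (fun x => u n x - g x).
  have [N hN] := ug 1 ltr01; exists N => n Nn; split => //.
  apply/integrableP; split; first exact/measurable_EFinP/measurable_funX.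
  apply: (@le_lt_trans _ _ 1%E); last exact: ltry.
  have := hN n Nn; congr (_ <= _)%E; apply: eq_integral => x _ /=.
  by rewrite ger0_norm // sqr_ge0.
have [N hN] := sug.
have sg : sqi P g.
  rewrite (_ : g = fun x => u N x - (u N x - g x)); last first.
    by apply/funext => x; rewrite opprB addrC subrK.
  by apply: sqiB => //; exact: hN.
exists g => //; apply/cvgrPdist_le => e e0.
have [M hM] := ug e e0; near=> n; rewrite sub0r normrN ger0_norm ?n2_ge0 //.
rewrite -lee_fin /sqnorm EFin_ex; first by apply: hM; near: n; exists M.
by have [] := sqiB (su n) sg.
Unshelve. all: by end_near. Qed.

End L2_limit.

(** * The limit law *)

Section lipschitz.
Variable R : realType.
Implicit Types (h : R * R -> R) (L : R).

Definition Lip L h : Prop :=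
  forall x y, `|h x - h y| <= L * (`|x.1 - y.1| + `|x.2 - y.2|).

Lemma Lip_continuous L h : Lip L h -> continuous h.
Proof.
move=> hL x; apply/cvgrPdist_le => e e0 /=.
have K0 : 0 < 2 * `|L| + 1 by have := normr_ge0 L; lra.
suff : nbhs x [set y | `|h x - h y| <= e] by [].
apply/nbhs_ballP; exists (e / (2 * `|L| + 1)) => /=; first by rewrite divr_gt0.
move=> y [/= /ltW y1 /ltW y2]; apply: (le_trans (hL x y)).
apply: (@le_trans _ _ (`|L| * (`|x.1 - y.1| + `|x.2 - y.2|))).
  by rewrite ler_wpM2r ?addr_ge0 // ler_norm.
apply: (@le_trans _ _ (`|L| * (2 * (e / (2 * `|L| + 1))))).
  by rewrite ler_wpM2l // mulr2n mulrDl mul1r lerD.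
rewrite -subr_ge0.
rewrite [X in 0 <= X](_ : _ = e / (2 * `|L| + 1)); last by field; rewrite gt_eqF.
by rewrite divr_ge0 // ltW.
Qed.

Lemma Lip_measurable L h : Lip L h -> measurable_fun setT h.
Proof. by move=> /Lip_continuous; exact: continuous_measurable_fun2. Qed.

End lipschitz.

Lemma normT_martE (R : realFieldType) (theta x mT t : R) :
  0 < theta -> 0 <= x ->
  (theta + x) / (x + 1) * ((t - mT) / (theta + x)) = (t - mT) / (x + 1).
Proof. by move=> t0 x0; field; rewrite !gt_eqF //; lra. Qed.

(** Passage from the martingale normalisation to the powers of the size [x + 1]. As [x] grows, the
    coefficient of the Wiener martingale tends to 1 and that of the length martingale to 0. *)
Lemma normW_martE (R : realFieldType) (theta x mT mZ w t : R) :
  0 < theta -> 0 <= x ->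
  (theta + x) / (x + 1) * ((theta + x) / (x + 1) + (x + 1)^-1) *
    ((w + (theta - 1) * t - mZ) / ((theta + x) * (theta + (x + 1)))) +
  - (theta - 1) * ((theta + x) / (x + 1) * (x + 1)^-1) *
    ((t - mT) / (theta + x)) =
  (w - (mZ - (theta - 1) * mT)) / (x + 1) ^+ 2.
Proof. by move=> t0 x0; field; rewrite !gt_eqF //; lra. Qed.

Section limit_law.
Variables (R : realType) (theta : R).
Hypothesis theta_gt0 : 0 < theta.

Definition nW N (b : btree) : R := ((bW b)%:R - meanW theta N) / (N.+1%:R ^+ 2).
Definition nT N (b : btree) : R := ((bT b)%:R - meanT theta N) / N.+1%:R.

Lemma hoppe_normE_bE N f :
  hoppe_normE theta N.+1 f = bE theta N (fun b => f (nW N b, nT N b)).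
Proof.
rewrite /hoppe_normE /hoppe_normalized.
rewrite (hoppeE_WT theta N (fun w _ => w)) (hoppeE_WT theta N (fun _ t => t)).
rewrite bE_W // bE_T //.
exact: (hoppeE_WT theta N (fun w t => f ((w - meanW theta N) / N.+1%:R ^+ 2,
  (t - meanT theta N) / N.+1%:R))).
Qed.

Let P : probability (measurableTypeR R) R := unif01 R.

Lemma sqi_bproc (F : btree -> R) N : sqi P (fun u => F (bproc theta N u)).
Proof.
split; first exact: measurable_bproc.
apply/integrableP; split.
  by apply/measurable_EFinP; exact: (measurable_bproc _ (fun b => F b ^+ 2)).
rewrite (_ : (\int[_]_x _)%E = (bE theta N (fun b => F b ^+ 2))%:E) ?ltry //.
rewrite -(integral_bproc theta_gt0); apply: eq_integral => x _ /=.
by rewrite ger0_norm // sqr_ge0.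
Qed.

Lemma ex_bproc (F : btree -> R) N : ex P (fun u => F (bproc theta N u)) = bE theta N F.
Proof. by rewrite /ex /Rintegral integral_bproc. Qed.

(** The squared distance between two times is at most the drop of [144 * Lyap] between them. That
    sequence is nonincreasing and nonnegative, so it converges and the martingale is Cauchy. *)
Lemma mart_limit (m : nat -> btree -> R) :
  (forall N b, bsize b = N.+1 ->
     gsum theta (m N.+1) b = (theta + (bsize b)%:R - 1) * m N b) ->
  (forall N, bE theta N (fun b => gsum theta
    (fun b' => (m N.+1 b' - m N b) ^+ 2) b / (theta + N%:R)) <=
     144 * (Lyap theta N - Lyap theta N.+1)) ->
  exists2 g, sqi P g & L2cvg P (fun N u => m N (bproc theta N u)) g.
Proof.
move=> mart incr; apply: L2_limit => [n|e e0]; first exact: sqi_bproc.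
pose D N := 144 * Lyap theta N.
have Dstep N : 0 <= D N - D N.+1.
  have := Lyap_step N theta_gt0; rewrite /D.
  have : 0 <= (1 + harm theta N) ^+ 2 / (theta + N.+1%:R) ^+ 2.
    by rewrite divr_ge0 ?sqr_ge0.
  by lra.
have D0 N : 0 <= D N by rewrite mulr_ge0 // Lyap_ge0.
have /cvg_ex[l Dl] : cvgn D.
  apply: nonincreasing_is_cvgn.
    by apply/nonincreasing_seqP => n; have := Dstep n; lra.
  by exists 0 => _ [n _ <-].
have e20 : 0 < e / 2 by rewrite divr_gt0.
have /cvgrPdist_le/(_ _ e20)[N _ hN] := Dl.
exists N.
have h m' n : (N <= n)%N -> (n <= m')%N ->
   sqnorm P (fun x => m m' (bproc theta m' x) - m n (bproc theta n x)) <= e.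
  move=> Nn nm; have := hN n Nn; have := hN m' (leq_trans Nn nm).
  rewrite /= !ler_distl => /andP[h1 h2] /andP[h3 h4].
  have := @mart_L2_dist R theta theta_gt0 m D mart _ n (m' - n)%N.
  rewrite subnKC // => /(_ _); rewrite -EFin_ex; last first.
    by have [] := sqiB (sqi_bproc (m m') m') (sqi_bproc (m n) n).
  rewrite lee_fin => H; apply: le_trans (H _) _; last by lra.
  by move=> k; apply: (le_trans (incr k)); rewrite /D; lra.
move=> m' n Nm Nn; have [nm|/ltnW mn] := leqP n m'; first exact: h.
rewrite (_ : sqnorm _ _ = sqnorm P (fun x => m n (bproc theta n x) - m m' (bproc theta m' x))).
  exact: h.
by apply: eq_ex => x; rewrite -sqrrN opprB.
Qed.

Let a N : R := (theta + N%:R) / N.+1%:R.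

Lemma a_cvg : a @ \oo --> (1 : R).
Proof.
rewrite (_ : a = fun N => 1 + (theta - 1) * harmonic N); last first.
  apply/funext => N; rewrite /a /harmonic -natr1 /=.
  by have := ler0n R N; set x := N%:R => x0; field; rewrite gt_eqF //; lra.
have e : 1 = 1 + (theta - 1) * 0 :> R by rewrite mulr0 addr0.
rewrite [X in _ --> X]e.
apply: cvgD; first exact: cvg_cst.
by apply: cvgM; [exact: cvg_cst|exact: cvg_harmonic].
Qed.

Theorem limit_law : exists mu : probability (R * R)%type R,
  [/\ centered_L2 mu,
   (fun n => (hoppe_normE theta n (fun x => x.1 ^+ 2))%:E) @ \oo -->
     (\int[mu]_x (x.1 ^+ 2)%:E)%E /\
   (fun n => (hoppe_normE theta n (fun x => x.2 ^+ 2))%:E) @ \oo -->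
     (\int[mu]_x (x.2 ^+ 2)%:E)%E /\
   (fun n => (hoppe_normE theta n (fun x => x.1 * x.2))%:E) @ \oo -->
     (\int[mu]_x (x.1 * x.2)%:E)%E &
   exists2 delta : nat -> R, delta @ \oo --> (0 : R) &
     forall L h N, 0 <= L -> Lip L h ->
       `|bE theta N (fun b => h (nW N b, nT N b)) - ex mu h| <= L * delta N].
Proof.
have [gT sgT cT] := mart_limit (fun N b bN => martT_step theta_gt0 bN)
  (fun N => martT_incr N theta_gt0).
have [gW sgW cW] := mart_limit (fun N b bN => martW_step theta_gt0 bN)
  (fun N => martW_incr N theta_gt0).
pose uT N u := nT N (bproc theta N u); pose uW N u := nW N (bproc theta N u).
have suT N : sqi P (uT N) by exact: sqi_bproc.
have suW N : sqi P (uW N) by exact: sqi_bproc.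
(* The factors 1 and 0 are the limits of the normalising coefficients, kept visible to match the
   form of [L2cvgZ] and [L2cvgD]. *)
pose XT u := 1 * gT u; pose XW u := 1 * gW u + 0 * gT u.
have sXT : sqi P XT by exact: sqiZ.
have sXW : sqi P XW by apply: sqiD; exact: sqiZ.
have cuT : L2cvg P uT XT.
  have -> : uT = fun N u => a N * martT theta N (bproc theta N u).
    apply/funext => N; apply/funext => u.
    by rewrite /uT /nT /martT /a -natr1 normT_martE.
  exact: L2cvgZ (fun N => sqi_bproc (martT theta N) N) sgT cT a_cvg.
have cuW : L2cvg P uW XW.
  have hh : harmonic @ \oo --> (0 : R) by exact: cvg_harmonic.
  have c1 : (fun N => a N * (a N + harmonic N)) @ \oo --> (1 : R).
    have e : 1 = 1 * (1 + 0) :> R by rewrite addr0 mulr1.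
    rewrite [X in _ --> X]e.
    by apply: cvgM; [exact: a_cvg|apply: cvgD; [exact: a_cvg|exact: hh]].
  have c2 : (fun N => - (theta - 1) * (a N * harmonic N)) @ \oo --> (0 : R).
    have e : 0 = - (theta - 1) * (1 * 0) :> R by rewrite !mulr0.
    rewrite [X in _ --> X]e.
    apply: cvgM; first exact: cvg_cst.
    by apply: cvgM; [exact: a_cvg|exact: hh].
  have h1 := L2cvgZ (fun N => sqi_bproc (martW theta N) N) sgW cW c1.
  have h2 := L2cvgZ (fun N => sqi_bproc (martT theta N) N) sgT cT c2.
  have -> : uW = fun N u =>
      a N * (a N + harmonic N) * martW theta N (bproc theta N u)
      + - (theta - 1) * (a N * harmonic N) * martT theta N (bproc theta N u).
    apply/funext => N; apply/funext => u.
    rewrite /uW /nW /martW /martT /a /meanW /harmonic /= -[N.+1%:R]natr1.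
    by rewrite normW_martE.
  exact: L2cvgD (fun N => sqiZ _ (sqi_bproc (martW theta N) N)) (sqiZ _ sgW)
    (fun N => sqiZ _ (sqi_bproc (martT theta N) N)) (sqiZ _ sgT) h1 h2.
have mX : measurable_fun setT (fun u : measurableTypeR R => (XW u, XT u)).
  by apply: measurable_fun_pair; [case: sXW|case: sXT].
pose X : {mfun measurableTypeR R >-> (R * R)%type} :=
  HB.pack (fun u : measurableTypeR R => (XW u, XT u))
   (isMeasurableFun.Build _ _ _ _ _ mX).
pose mu : probability (R * R)%type R := distribution P X.
have integ_mu h : measurable_fun setT h -> integ P (fun u => h (XW u, XT u)) ->
    integ mu h.
  move=> mh ih; apply: integrable_pushforward => //; exact/measurable_EFinP.
have int_mu h : measurable_fun setT h -> integ P (fun u => h (XW u, XT u)) ->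
    (\int[mu]_x (h x)%:E = (ex P (fun u => h (XW u, XT u)))%:E)%E.
  move=> mh ih; rewrite EFin_ex // integral_distribution //.
  exact/measurable_EFinP.
have ex_mu h : measurable_fun setT h -> integ P (fun u => h (XW u, XT u)) ->
    ex mu h = ex P (fun u => h (XW u, XT u)).
  by move=> mh ih; rewrite /ex {1}/Rintegral int_mu.
have m1 : measurable_fun setT (fst : R * R -> R) by exact: measurable_fst.
have m2 : measurable_fun setT (snd : R * R -> R) by exact: measurable_snd.
have i1 := sqi_integ sXW; have i2 := sqi_integ sXT.
have seq_shift (u : nat -> R) (l : \bar R) : (fun n => (u n.+1)%:E) @ \oo --> l ->
    (fun n => (u n)%:E) @ \oo --> l.
  by move=> h; rewrite -(cvg_shiftS (fun n => (u n)%:E)).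
(* Means pass to the mean-square limit as products with the constant 1. *)
have mean0 (u : nat -> R -> R) F g : (forall N, sqi P (u N)) -> sqi P g ->
    L2cvg P u g -> (forall N x, u N x = F N (bproc theta N x)) ->
    (forall N, bE theta N (F N) = 0) -> ex P g = 0.
  move=> su sg cu uF F0.
  have := L2cvg_exM su sg (fun=> sqi_cst P 1) (sqi_cst P 1) cu _.
  have E : L2cvg P (fun _ _ => 1) (fun=> 1).
    rewrite /L2cvg /sqnorm; under eq_fun do under [X in ex _ X]eq_fun do rewrite subrr expr0n.
    by rewrite /= ex_cst; exact: cvg_cst.
  move=> /(_ E); under eq_fun do under [X in ex _ X]eq_fun do rewrite mulr1 uF.
  under eq_fun do rewrite ex_bproc F0.
  under [X in _ --> ex _ X]eq_fun do rewrite mulr1.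
  by move=> h; apply/esym/(cvg_unique _ (cvg_cst _) h).
exists mu; split.
- split; [split|split].
  + by apply: integ_mu; [exact: measurable_funX|case: sXW].
  + by apply: integ_mu; [exact: measurable_funX|case: sXT].
  + rewrite int_mu //; congr EFin.
    apply: (mean0 uW (fun N => nW N) XW) => // N.
    rewrite /nW; under [bE _ _ _]eq_bE do rewrite mulrC.
    by rewrite bEZ bEB bE_W // bE_cst // subrr mulr0.
  + rewrite int_mu //; congr EFin.
    apply: (mean0 uT (fun N => nT N) XT) => // N.
    rewrite /nT; under [bE _ _ _]eq_bE do rewrite mulrC.
    by rewrite bEZ bEB bE_T // bE_cst // subrr mulr0.
- have cvgE (u v : nat -> R -> R) f g (h : R * R -> R) : 
      (forall n, sqi P (u n)) -> sqi P f -> (forall n, sqi P (v n)) -> sqi P g ->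
      L2cvg P u f -> L2cvg P v g ->
      (forall N x, u N x * v N x = h (nW N (bproc theta N x), nT N (bproc theta N x))) ->
      (forall x, f x * g x = h (XW x, XT x)) -> measurable_fun setT h ->
      (fun n => (hoppe_normE theta n h)%:E) @ \oo --> (\int[mu]_x (h x)%:E)%E.
    move=> su sf sv sg cu cv uv fg mh; apply: seq_shift.
    have ih : integ P (fun u => h (XW u, XT u)).
      by have := sqiM sf sg; congr integ; apply/funext.
    rewrite int_mu //; apply: cvg_EFin; first exact: nearW.
    have := L2cvg_exM su sf sv sg cu cv.
    under [X in _ --> ex _ X -> _]eq_fun do rewrite fg.
    apply: cvg_trans; apply: near_eq_cvg; apply: nearW => n /=.
    rewrite hoppe_normE_bE -ex_bproc; exact: eq_ex.
  split; [|split].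
  + apply: (cvgE uW uW XW XW) => //; exact: measurable_funX.
  + apply: (cvgE uT uT XT XT) => //; exact: measurable_funX.
  + apply: (cvgE uW uT XW XT) => //; exact: measurable_funM.
(* A test function with constant [L] moves by at most [L] times the l1 error, whose mean is bounded
   by these norms; [h] itself does not enter the rate. *)
- exists (fun N => Num.sqrt (sqnorm P (fun u => uW N u - XW u))
                 + Num.sqrt (sqnorm P (fun u => uT N u - XT u))).
    by rewrite -[X in _ --> X]addr0; apply: cvgD; exact: sqrt_cvg0.
  move=> L h N L0 hL; have mh := Lip_measurable hL.
  have sW := sqiB (suW N) sXW; have sT := sqiB (suT N) sXT.
  have ih : integ P (fun u => h (XW u, XT u)).
    apply: (@integ_dom _ _ _ _ _ (fun u => `|h (0, 0)| + L * (`|XW u| + `|XT u|))).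
    - exact: (measurableT_comp mh mX).
    - apply: integD; first exact: integ_cst.
      by apply/integZ/integD; exact: integ_normr.
    - move=> u; have := hL (XW u, XT u) (0, 0); rewrite /= !subr0 => hx.
      by have := lerB_dist (h (XW u, XT u)) (h (0, 0)); lra.
  rewrite ex_mu // -ex_bproc.
  apply: (@le_trans _ _ (ex P (fun u => L * (`|uW N u - XW u| + `|uT N u - XT u|)))).
    apply: le_norm_exB => //.
    - exact: sqi_integ (sqi_bproc (fun b => h (nW N b, nT N b)) N).
    - by apply/integZ/integD; apply/integ_normr/sqi_integ.
  rewrite exZ; last by apply: integD; apply/integ_normr/sqi_integ.
  rewrite ler_wpM2l // exD; try by apply/integ_normr/sqi_integ.
  by apply: lerD; exact: ex_norm_le.
Qed.

End limit_law.

(** * Test functions *)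

Lemma ex_bounded_cvg d (T : measurableType d) (R : realType)
    (P : probability T R) (f : nat -> T -> R) (g : T -> R) (M : R) :
  (forall k, measurable_fun setT (f k)) -> (forall k x, `|f k x| <= M) ->
  (forall x, (f ^~ x) @ \oo --> g x) ->
  measurable_fun setT g /\ (fun k => ex P (f k)) @ \oo --> ex P g.
Proof.
move=> mf fM fg.
have mg : measurable_fun setT g.
  by apply: (measurable_fun_cvg mf) => x _; exact: fg.
split => //; apply: fine_cvg.
have [] := @dominated_convergence _ T R P setT measurableT
  (fun k x => (f k x)%:E) (fun x => (g x)%:E) (fun=> M%:E) _ _ _ _ _ => //.
- by move=> k; exact/measurable_EFinP.
- exact/measurable_EFinP.
- by apply: aeW => x _; apply: cvg_EFin; [exact: nearW|exact: fg].
- exact: integ_cst.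
- by apply: aeW => x k _; rewrite lee_fin.
- move=> ig _; rewrite fineK //; exact: integrable_fin_num.
Qed.

Section test_functions.
Variable R : realType.
Implicit Types (f h : R * R -> R) (L : R).

Definition l1dist (x y : R * R) : R := `|x.1 - y.1| + `|x.2 - y.2|.

Lemma l1dist_ge0 x y : 0 <= l1dist x y.
Proof. by rewrite addr_ge0. Qed.

Lemma l1dist_triangle x y z : l1dist x z <= l1dist x y + l1dist y z.
Proof.
rewrite /l1dist addrACA; apply: lerD.
  by rewrite -[x.1 - z.1](subrKA y.1); exact: ler_normD.
by rewrite -[x.2 - z.2](subrKA y.2); exact: ler_normD.
Qed.

Lemma l1distC x y : l1dist x y = l1dist y x.
Proof. by rewrite /l1dist distrC [`|x.2 - _|]distrC. Qed.

(** With the distance in place of its square this is the Pasch-Hausdorff envelope: for bounded [f],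
    the largest [k]-Lipschitz function below [f]. *)
Definition moreau f (k : nat) (x : R * R) : R :=
  inf [set f y + k%:R * l1dist x y | y in setT].

Section moreau_bounded.
Variables (f : R * R -> R) (M : R).
Hypothesis fM : forall x, `|f x| <= M.

Let lbM k x : lbound [set f y + k%:R * l1dist x y | y in setT] (- M).
Proof.
move=> _ [y _ <-]; have := fM y; rewrite ler_norml => /andP[h _].
by have := mulr_ge0 (ler0n R k) (l1dist_ge0 x y); lra.
Qed.

Lemma moreau_le k x y : moreau f k x <= f y + k%:R * l1dist x y.
Proof. by apply: ge_inf; [exists (- M); exact: lbM|exists y]. Qed.

Lemma le_moreau k x c : (forall y, c <= f y + k%:R * l1dist x y) ->
  c <= moreau f k x.
Proof.
move=> h; apply: lb_le_inf; first by exists (f x + k%:R * l1dist x x), x.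
by move=> _ [y _ <-].
Qed.

Lemma moreau_le_self k x : moreau f k x <= f x.
Proof. by have := moreau_le k x x; rewrite /l1dist !subrr normr0 addr0 mulr0 addr0. Qed.

Lemma moreau_bounded k x : `|moreau f k x| <= M.
Proof.
rewrite ler_norml (le_trans (moreau_le_self k x)); last first.
  by rewrite (le_trans (ler_norm _)).
rewrite andbT; apply: le_moreau => y; exact: (lbM (ex_intro2 _ _ y Logic.I erefl)).
Qed.

Lemma moreau_Lip k : Lip k%:R (moreau f k).
Proof.
have h x y : moreau f k x - moreau f k y <= k%:R * l1dist x y.
  rewrite lerBlDr -lerBlDl; apply: le_moreau => z.
  have := moreau_le k x z; have := l1dist_triangle x y z.
  move=> /(ler_wpM2l (ler0n R k)); rewrite mulrDr; lra.
move=> x y; rewrite ler_norml; have := h x y; have := h y x.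
by rewrite l1distC /l1dist; lra.
Qed.

Lemma moreau_cvg : continuous f ->
  forall x, (fun k => moreau f k x) @ \oo --> f x.
Proof.
move=> cf x; apply/cvgrPdist_le => e e0.
have : nbhs x [set y | `|f x - f y| <= e].
  by have := cf x => /cvgrPdist_le/(_ e e0).
move=> /nbhs_ballP[eta /= eta0 xeta].
near=> k.
rewrite ger0_norm ?subr_ge0 ?moreau_le_self // lerBlDr -lerBlDl.
apply: le_moreau => y.
have [y_near|y_far] := ltP (l1dist x y) eta.
  have : ball x eta y.
    by split; rewrite /ball /=; apply: le_lt_trans y_near;
      rewrite /l1dist ?lerDl ?lerDr.
  move=> /xeta /=; rewrite ler_distl => /andP[_ h].
  by have := mulr_ge0 (ler0n R k) (l1dist_ge0 x y); lra.
(* Far from [x] the penalty exceeds the oscillation of [f], so only nearby points can lower the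
   infimum. *)
have : 2 * M <= k%:R * l1dist x y.
  apply: (@le_trans _ _ (k%:R * eta)); last by rewrite ler_wpM2l.
  rewrite -ler_pdivrMr //; near: k; exact: nbhs_infty_ger.
have := fM x; have := fM y; rewrite !ler_norml; lra.
Unshelve. all: by end_near. Qed.

End moreau_bounded.

(** Lipschitz envelopes from below, with monotonicity, bound the lower limit; the same bound for
    [- f], with oddness, bounds the upper limit. *)
Lemma portmanteau (mu : probability (R * R)%type R)
    (E : nat -> (R * R -> R) -> R) :
  (forall n f g, (forall x, f x <= g x) -> E n f <= E n g) ->
  (forall n f, E n (fun x => - f x) = - E n f) ->
  (forall L h M, 0 <= L -> Lip L h -> (forall x, `|h x| <= M) ->
     (fun n => E n h) @ \oo --> ex mu h) ->
  forall f M, continuous f -> (forall x, `|f x| <= M) ->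
    (fun n => E n f) @ \oo --> ex mu f.
Proof.
move=> Emono EN Elip.
have lower f M e : continuous f -> (forall x, `|f x| <= M) -> 0 < e ->
    \forall n \near \oo, ex mu f - e <= E n f.
  move=> cf fM e0; have e20 : 0 < e / 2 by rewrite divr_gt0.
  have [_ mc] := @ex_bounded_cvg _ _ _ mu (moreau f) f M
    (fun k => Lip_measurable (moreau_Lip fM k))
    (fun k x => moreau_bounded fM k x) (moreau_cvg fM cf).
  have /cvgrPdist_le/(_ _ e20)[k _ /(_ k (leqnn k)) hk] := mc.
  have := Elip k%:R (moreau f k) M (ler0n R k) (moreau_Lip fM k)
    (moreau_bounded fM k).
  move=> /cvgrPdist_le/(_ _ e20); apply: filterS => n.
  have := Emono n (moreau f k) f (fun x => moreau_le_self fM k x).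
  by move: hk; rewrite /= !ler_distl; lra.
move=> f M cf fM; apply/cvgrPdist_le => e e0.
have h1 := lower f M e cf fM e0.
have h2 := lower (fun x => - f x) M e _ _ e0.
have cNf : continuous (fun x => - f x) by move=> x; apply: cvgN; exact: cf.
have NfM x : `|- f x| <= M by rewrite normrN.
have := h2 cNf NfM; apply: filterS2 h1 => n h3.
have -> : ex mu (fun x => - f x) = - ex mu f.
  rewrite -mulN1r -exZ; first by apply: eq_ex => x; rewrite mulN1r.
  by apply: integ_bounded fM; exact: continuous_measurable_fun2.
by rewrite EN ler_distl; move: h3; lra.
Qed.

Definition clamp (t : R) : R := Num.min 1 (Num.max 0 t).

Lemma clamp01 t : 0 <= clamp t <= 1.
Proof. by rewrite /clamp le_min ler01 le_max lexx ge_min lexx. Qed.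

Lemma clamp_lip s t : `|clamp s - clamp t| <= `|s - t|.
Proof.
rewrite /clamp ler_norml; have := ler_norm (s - t); have := ler_norm (t - s).
rewrite [`|t - s|]distrC.
case: (leP 0 s) => hs; case: (leP 0 t) => ht; case: (leP 1 s) => hs1;
  case: (leP 1 t) => ht1; rewrite ?(min_r ler01); lra.
Qed.

Lemma clamp_cvg (t : R) : (fun k : nat => clamp (k%:R * t)) @ \oo --> ((0 < t)%R%:R : R).
Proof.
have [t0|t0] := ltP 0 t.
  apply: cvg_near_cst; near=> k.
  have : 1 <= k%:R * t by rewrite -ler_pdivrMr //; near: k; exact: nbhs_infty_ger.
  by move=> h; rewrite /clamp max_r ?min_l // (le_trans ler01).
apply: cvg_near_cst; near=> k.
have : k%:R * t <= 0 by rewrite mulr_ge0_le0.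
by move=> h; rewrite /clamp max_l // min_r.
Unshelve. all: by end_near. Qed.

(** The functions [clamp (k * (t - a))] tend to the indicator of []a, +oo[]. Products of two of them
    are bounded and Lipschitz and tend to the indicators of quadrants. *)
Lemma eq_measure_Lip (m1 m2 : probability (R * R)%type R) :
  (forall L h M, 0 <= L -> Lip L h -> (forall x, `|h x| <= M) ->
     ex m1 h = ex m2 h) ->
  forall A, measurable A -> m1 A = m2 A.
Proof.
move=> m12; apply: eq_measure_rays2 => a c.
pose h (k : nat) (x : R * R) := clamp (k%:R * (x.1 - a)) * clamp (k%:R * (x.2 - c)).
pose g (x : R * R) : R := (0 < x.1 - a)%R%:R * (0 < x.2 - c)%R%:R.
have hL k : Lip k%:R (h k).
  move=> x y; rewrite /h [leRHS]mulrDr.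
  have lipk (u v w : R) :
      `|clamp (k%:R * (u - w)) - clamp (k%:R * (v - w))| <= k%:R * `|u - v|.
    apply: (le_trans (clamp_lip _ _)); rewrite -mulrBr normrM ger0_norm //.
    by rewrite opprB addrA subrK.
  have hrp := lipk x.1 y.1 a; have hqs := lipk x.2 y.2 c.
  have := clamp01 (k%:R * (x.2 - c)); have := clamp01 (k%:R * (y.1 - a)).
  set s := clamp (k%:R * (x.1 - a)) in hrp *.
  set p := clamp (k%:R * (y.1 - a)) in hrp *.
  set q := clamp (k%:R * (x.2 - c)) in hqs *.
  set r := clamp (k%:R * (y.2 - c)) in hqs * => hp hq.
  rewrite (_ : s * q - p * r = (s - p) * q + p * (q - r)); last by ring.
  apply: (le_trans (ler_normD _ _)); rewrite !normrM.
  rewrite (@ger0_norm _ q) 1?(@ger0_norm _ p); try lra.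
  apply: lerD.
    by apply: le_trans hrp; rewrite ler_piMr //; lra.
  by apply: le_trans hqs; rewrite ler_piMl //; lra.
have h1 k x : `|h k x| <= 1.
  rewrite /h; have /andP[p0 p1] := clamp01 (k%:R * (x.1 - a)).
  have /andP[q0 q1] := clamp01 (k%:R * (x.2 - c)).
  by rewrite ger0_norm ?mulr_ge0 // mulr_ile1.
have hg x : (h ^~ x) @ \oo --> g x by apply: cvgM; exact: clamp_cvg.
have mh k := Lip_measurable (hL k).
have [mg c1] := ex_bounded_cvg m1 mh h1 hg.
have [_ c2] := ex_bounded_cvg m2 mh h1 hg.
have e12 : ex m1 g = ex m2 g.
  have e k : ex m1 (h k) = ex m2 (h k) := m12 _ _ _ (ler0n R k) (hL k) (h1 k).
  by move: c1; rewrite (funext e) => c1; exact: cvg_unique c1 c2.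
have gE (m : probability (R * R)%type R) : (ex m g)%:E = m (`]a, +oo[ `*` `]c, +oo[).
  have mA : measurable (`]a, +oo[ `*` `]c, +oo[ : set (R * R)) by exact: measurableX.
  rewrite EFin_ex; last first.
    apply: (@integ_bounded _ _ _ m g 1) => // x; rewrite /g.
    by case: (_ < _); case: (_ < _); rewrite ?mulr0 ?mulr1 ?normr0 ?normr1.
  rewrite -(setIT (_ `*` _)) -integral_indic //; apply: eq_integral => x _.
  rewrite /g !subr_gt0 indicE; congr EFin.
  rewrite (_ : (x \in _) = (a < x.1) && (c < x.2)); last first.
    by apply/idP/idP; rewrite inE /= !in_itv /= !andbT => /andP.
  by case: (_ < _); case: (_ < _); rewrite ?mulr0 ?mulr1.
by rewrite -!gE e12.
Qed.

End test_functions.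

(** * Beta integrals, Bernstein operators and the split at vertex 1 *)

Section beta_integral.
Variable R : realType.

Lemma is_derive_onem_powR (c v : R) : 0 < c -> v < 1 ->
  is_derive v 1 (fun x : R => - ((1 - x) `^ c) / c) ((1 - v) `^ (c - 1)).
Proof.
move=> c0 v1; have v0 : 1 - v \in `]0, +oo[ by rewrite in_itv /= andbT subr_gt0.
have dp : is_derive (1 - v) 1 (@powR R ^~ c) (c * (1 - v) `^ (c - 1)).
  apply: DeriveDef; first exact: derivable_powR.
  by rewrite -derive1E powR_derive1.
have d1 : is_derive v 1 (fun x : R => 1 - x) (-1).
  have := is_deriveB (is_derive_cst (1 : R) v 1) (is_derive_id v 1).
  by rewrite sub0r.
have dc := @is_derive1_comp R (@powR R ^~ c) (fun x => 1 - x) v _ _ dp d1.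
have -> : (1 - v) `^ (c - 1) = (- c^-1) *: (c * (1 - v) `^ (c - 1) * -1).
  by rewrite /GRing.scale /=; field; rewrite gt_eqF.
rewrite (_ : (fun x : R => _) = (- c^-1) \*: ((@powR R ^~ c) \o (fun x => 1 - x))).
  exact: is_deriveZ.
by apply/funext => x; rewrite /= mulNr mulrC -mulNr.
Qed.

(** For [c < 1] the integrand blows up at 1, so the fundamental theorem is applied on
    [[0, 1 - 1 / (n + 2)]] and monotone convergence fills the interval. *)
Lemma integral_onem_powR (c : R) : 0 < c ->
  (\int[lebesgue_measure]_(v in `[0%R, 1%R[) ((1 - v) `^ (c - 1))%:E = (c^-1)%:E)%E.
Proof.
move=> c0.
pose F (x : R) : R := - ((1 - x) `^ c) / c.
pose r (n : nat) : R := 1 - n.+2%:R^-1.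
have r1 n : r n < 1 by rewrite /r ltrBlDr ltrDl invr_gt0.
have r0 n : 0 < r n by rewrite subr_gt0 invf_lt1 // ltr1n.
have mf : measurable_fun setT (fun v : R => ((1 - v) `^ (c - 1))%:E).
  apply/measurable_EFinP; apply: (measurableT_comp (measurable_powR _)).
  exact: measurable_funB.
have FTC n : (\int[lebesgue_measure]_(v in `[0%R, r n]) ((1 - v) `^ (c - 1))%:E
    = (c^-1 - (n.+2%:R^-1) `^ c / c)%:E)%E.
  have dF (x : R) : x < 1 -> is_derive x 1 F ((1 - x) `^ (c - 1)).
    by move=> x1; exact: is_derive_onem_powR.
  have cF (x : R) : x < 1 -> {for x, continuous F}.
    move=> /dF h; apply: differentiable_continuous; apply/derivable1_diffP.
    exact: ex_derive.
  rewrite (@continuous_FTC2 _ _ F) //.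
  - rewrite -EFinB; congr EFin.
    by rewrite /F /r subr0 powR1 subKr; field; rewrite gt_eqF.
  - apply: continuous_in_subspaceT => x; rewrite inE /= in_itv /= => /andP[_ xr].
    have x1 : x < 1 := le_lt_trans xr (r1 n).
    apply: (@continuous_comp _ _ _ (fun y : R => 1 - y) (@powR R ^~ (c - 1))).
      by apply: cvgB; [exact: cvg_cst|exact: cvg_id].
    apply: differentiable_continuous; apply/derivable1_diffP.
    by apply: derivable_powR; rewrite in_itv /= andbT subr_gt0.
  - split.
    + move=> x; rewrite in_itv /= => /andP[_ xr].
      by have := dF x (lt_trans xr (r1 n)) => h; exact: ex_derive.
    + by apply: cvg_at_right_filter; exact: cF.
    + by apply: cvg_at_left_filter; exact: cF.
  - move=> x; rewrite in_itv /= => /andP[_ xr]; rewrite derive1E.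
    by have := dF x (lt_trans xr (r1 n)) => h; exact: derive_val.
have cup : \bigcup_n `[0, r n]%classic = `[0, 1[%classic :> set R.
  apply/seteqP; split => x /=.
    by move=> [n _] /=; rewrite !in_itv /= => /andP[-> /le_lt_trans]; apply.
  rewrite in_itv /= => /andP[x0 x1].
  have x10 : 0 < 1 - x by rewrite subr_gt0.
  have [k _ /(_ k (leqnn k)) /= hk] := near_infty_natSinv_lt (PosNum x10).
  exists k => //=; rewrite in_itv /= x0 /r /= lerBrDr -lerBrDl.
  apply: le_trans (ltW hk); rewrite lef_pV2 ?posrE // ler_nat //.
have nd : nondecreasing_seq (fun n => `[0, r n]%classic : set R).
  apply/nondecreasing_seqP => n; rewrite subsetEset => x /=.
  rewrite !in_itv /= => /andP[-> /le_trans] -> //.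
  by rewrite lerB // lef_pV2 ?posrE // ler_nat.
have f0 (n : nat) (x : R) : `[0, r n]%classic x -> (0 <= ((1 - x) `^ (c - 1))%:E)%E.
  by move=> _; rewrite lee_fin powR_ge0.
have := @ge0_nondecreasing_set_cvg_integral _ _ R _ _ lebesgue_measure nd
  (fun=> measurable_itv _) (fun i => measurable_funTS mf) f0.
rewrite cup (funext FTC) => H; apply: (cvg_unique _ H) => //.
apply: cvg_EFin; first exact: nearW.
rewrite -[X in _ --> X]subr0 -[X in _ - X](mul0r c^-1).
apply: cvgB; first exact: cvg_cst.
apply: cvgM; last exact: cvg_cst.
have /cvg_at_rightP := powR_cvg0 c0; apply; split => [n|]; first by rewrite invr_gt0.
have h : (@harmonic R) @ \oo --> (0 : R) by exact: cvg_harmonic.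
by move: h; rewrite -(cvg_shiftS (@harmonic R : nat -> R)).
Qed.

Lemma integral_onem_powR_oo (c : R) : 0 < c ->
  (\int[lebesgue_measure]_(v in `]0%R, 1%R[) ((1 - v) `^ (c - 1))%:E = (c^-1)%:E)%E.
Proof.
move=> c0; rewrite integral_itv_obnd_cbnd ?integral_onem_powR //.
apply: (measurable_funS measurableT) => //.
apply/measurable_EFinP; apply: (measurableT_comp (measurable_powR _)).
exact: measurable_funB.
Qed.

End beta_integral.

Section beta_expectation.
Variables (R : realType) (theta : R).
Hypothesis theta_gt0 : 0 < theta.
Local Notation D01 := (`]0, 1[%classic : set R).
Local Notation w := (beta1_dens theta).
Local Notation leb := (@lebesgue_measure R).
Implicit Types g h : R -> R.

Definition beta_ex g : R := \int[leb]_(v in D01) (w v * g v).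
Definition bbd (M : R) g : Prop :=
  measurable_fun D01 g /\ forall v, D01 v -> `|g v| <= M.

Lemma dens_ge0 v : 0 <= w v.
Proof. by rewrite mulr_ge0 ?(ltW theta_gt0) // powR_ge0. Qed.

Lemma measurable_dens : measurable_fun D01 w.
Proof.
apply: (measurable_funS measurableT) => //; apply: measurable_funM => //.
apply: (measurableT_comp (measurable_powR _)).
exact: measurable_funB.
Qed.

Lemma integral_dens_onem b :
  (\int[leb]_(v in D01) (w v * (1 - v) ^+ b)%:E = (theta / (theta + b%:R))%:E)%E.
Proof.
have tb : 0 < theta + b%:R by rewrite ltr_wpDr.
transitivity (\int[leb]_(v in D01) (theta%:E * ((1 - v) `^ (theta + b%:R - 1))%:E))%E.
  apply: eq_integral => v; rewrite inE /= in_itv /= => /andP[v0 v1].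
  rewrite -EFinM; congr EFin.
  have v1' : 0 < 1 - v by rewrite subr_gt0.
  rewrite /beta1_dens -mulrA -powR_mulrn ?(ltW v1') // -powRD.
    by rewrite addrAC.
  by rewrite (gt_eqF v1') implybT.
rewrite ge0_integralZl //; last 3 first.
- apply: (measurable_funS measurableT) => //.
  apply/measurable_EFinP; apply: (measurableT_comp (measurable_powR _)).
  exact: measurable_funB.
- by move=> v _; rewrite lee_fin powR_ge0.
- by rewrite lee_fin ltW.
by rewrite integral_onem_powR_oo.
Qed.

Lemma integrable_dens : leb.-integrable D01 (EFin \o w).
Proof.
apply/integrableP; split; first by apply/measurable_EFinP; exact: measurable_dens.
rewrite (_ : (\int[_]_(x in _) _)%E
    = (\int[leb]_(v in D01) (w v * (1 - v) ^+ 0)%:E)%E); last first.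
  by apply: eq_integral => v _ /=; rewrite expr0 mulr1 ger0_norm ?dens_ge0.
by rewrite integral_dens_onem ltry.
Qed.

Lemma integrable_Mdens (M : R) : leb.-integrable D01 (fun v => (M * w v)%:E).
Proof.
rewrite (_ : (fun v => _) = (fun v => M%:E * (EFin \o w) v)%E) //.
by apply: integrableZl => //; exact: integrable_dens.
Qed.

Lemma bbd_integrable M g : bbd M g ->
  leb.-integrable D01 (EFin \o (fun v => w v * g v)).
Proof.
move=> [mg gM]; apply: le_integrable (integrable_Mdens M) => //.
- by apply/measurable_EFinP/measurable_funM => //; exact: measurable_dens.
- move=> v Dv /=; rewrite lee_fin normrM [`|w v|]ger0_norm ?dens_ge0 //.
  rewrite mulrC (le_trans _ (ler_norm _)) // ler_wpM2r ?dens_ge0 //; exact: gM.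
Qed.

Lemma bbd_cst c : bbd `|c| (fun=> c).
Proof. by split. Qed.

Lemma bbdD M M' g h : bbd M g -> bbd M' h -> bbd (M + M') (fun v => g v + h v).
Proof.
move=> [mg gM] [mh hM]; split; first exact: measurable_funD.
by move=> v Dv; rewrite (le_trans (ler_normD _ _)) // lerD // ?gM ?hM.
Qed.

Lemma bbdZ M c g : bbd M g -> bbd (`|c| * M) (fun v => c * g v).
Proof.
move=> [mg gM]; split; first exact: measurable_funM.
by move=> v Dv; rewrite normrM ler_wpM2l // gM.
Qed.

Lemma exbD M M' g h : bbd M g -> bbd M' h ->
  beta_ex (fun v => g v + h v) = beta_ex g + beta_ex h.
Proof.
move=> bg bh; rewrite /beta_ex -RintegralD //; try exact: bbd_integrable; last 2 first.
- exact: bbd_integrable bg.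
- exact: bbd_integrable bh.
by apply: eq_Rintegral => v _; rewrite mulrDr.
Qed.

Lemma exbZ M c g : bbd M g -> beta_ex (fun v => c * g v) = c * beta_ex g.
Proof.
move=> bg; rewrite /beta_ex -RintegralZl //; last exact: bbd_integrable bg.
by apply: eq_Rintegral => v _; rewrite mulrCA.
Qed.

Lemma exbB M M' g h : bbd M g -> bbd M' h ->
  beta_ex (fun v => g v - h v) = beta_ex g - beta_ex h.
Proof.
move=> bg bh; rewrite -[- beta_ex h]mulN1r -(exbZ _ bh) -(exbD bg (bbdZ (-1) bh)).
by apply: eq_Rintegral => v _; rewrite mulN1r.
Qed.

Lemma le_exb M M' g h : bbd M g -> bbd M' h -> (forall v, D01 v -> g v <= h v) ->
  beta_ex g <= beta_ex h.
Proof.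
move=> bg bh gh; apply: le_Rintegral => //.
- exact: bbd_integrable bg.
- exact: bbd_integrable bh.
- by move=> v Dv; rewrite ler_wpM2l ?dens_ge0 // gh.
Qed.

Lemma eq_exb g h : (forall v, D01 v -> g v = h v) -> beta_ex g = beta_ex h.
Proof.
by move=> gh; apply: eq_Rintegral => v; rewrite inE => Dv; rewrite gh.
Qed.

Lemma exb_cvg M (g : nat -> R -> R) h : (forall n, bbd M (g n)) ->
  (forall v, D01 v -> (g ^~ v) @ \oo --> h v) ->
  bbd M h /\ (fun n => beta_ex (g n)) @ \oo --> beta_ex h.
Proof.
move=> bg gh.
have mh : measurable_fun D01 h.
  by apply: (@measurable_fun_cvg _ _ _ _ g) => // n; have [] := bg n.
have bh : bbd M h.
  split => // v Dv; have h1 : (fun n => `|g n v|) @ \oo --> `|h v|.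
    by apply: cvg_norm; exact: gh.
  have near_le : \forall n \near \oo, (fun n => `|g n v|) n <= M.
    by apply: nearW => n; have [_] := bg n; apply.
  exact: cvgr_to_le h1 near_le.
split => //; apply: fine_cvg.
have iM := integrable_Mdens M.
have [] := @dominated_convergence _ _ R leb D01 _
  (fun k v => (w v * g k v)%:E) (fun v => (w v * h v)%:E)
  (fun v => (M * w v)%:E) _ _ _ iM _ => //.
- move=> k; apply/measurable_EFinP/measurable_funM; first exact: measurable_dens.
  by have [] := bg k.
- by apply/measurable_EFinP/measurable_funM => //; exact: measurable_dens.
- apply: aeW => v Dv; apply: cvg_EFin; first exact: nearW.
  by apply: cvgM; [exact: cvg_cst|exact: gh].
- apply: aeW => v k Dv; rewrite lee_fin normrM [`|w v|]ger0_norm ?dens_ge0 //.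
  by rewrite mulrC ler_wpM2r ?dens_ge0 //; have [_] := bg k; apply.
- by move=> ih _; rewrite fineK //; exact: integrable_fin_num.
Qed.

Definition bmono (a b : nat) (v : R) : R := v ^+ a * (1 - v) ^+ b.
Definition beta_moment (a b : nat) : R := beta_ex (bmono a b).

Lemma bbd_bmono a b : bbd 1 (bmono a b).
Proof.
split.
  apply: (measurable_funS measurableT) => //; apply: measurable_funM.
    exact: measurable_funX.
  by apply: measurable_funX; exact: measurable_funB.
move=> v; rewrite /= in_itv /= => /andP[v0 v1]; rewrite /bmono.
rewrite ger0_norm; last by rewrite mulr_ge0 // exprn_ge0 //; lra.
by rewrite mulr_ile1 ?exprn_ge0 ?exprn_ile1 //; lra.
Qed.

Lemma bI0 b : beta_moment 0 b = theta / (theta + b%:R).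
Proof.
rewrite /beta_moment /beta_ex /Rintegral /bmono.
by under eq_integral do rewrite expr0 mul1r; rewrite integral_dens_onem.
Qed.

Lemma bI_split a b : beta_moment a b = beta_moment a.+1 b + beta_moment a b.+1.
Proof.
rewrite /beta_moment -(exbD (bbd_bmono _ _) (bbd_bmono _ _)); apply: eq_exb => v _.
by rewrite /bmono !exprS; ring.
Qed.

(** The functional equation of the beta function. It follows from the explicit value at [a = 0] and
    from [v + (1 - v) = 1], by induction on [a]. *)
Lemma bI_rec a b : (theta + (a + b).+1%:R) * beta_moment a.+1 b = a.+1%:R * beta_moment a b.
Proof.
elim: a b => [|a IH] b.
  have := bI_split 0 b; rewrite !bI0 add0n -natr1 => E.
  have -> : beta_moment 1 b = theta / (theta + b%:R) - theta / (theta + (b%:R + 1)) by lra.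
  have := ler0n R b; have := theta_gt0; set x := b%:R => t0 x0.
  by field; rewrite !gt_eqF //=; lra.
have := IH b; have := IH b.+1; have := bI_split a.+1 b; have := bI_split a b.
rewrite addnS !addSn -!natr1 !natrD.
set p := beta_moment a.+2 b; set q := beta_moment a.+1 b; set r := beta_moment a b.
set s := beta_moment a.+1 b.+1; set t := beta_moment a b.+1; set x := a%:R; set y := b%:R => h1 h2 h3 h4.
have -> : p = q - s by lra.
have e3 : (theta + (x + y + 1 + 1)) * s = (x + 1) * (r - q).
  by rewrite h3 h1; ring.
rewrite mulrBr e3; nra.
Qed.

Lemma exb_cst c : beta_ex (fun=> c) = c.
Proof.
have := bI0 0; rewrite /beta_moment addr0 divff ?gt_eqF // => E.
rewrite -[RHS]mulr1 -[X in _ = _ * X]E -(exbZ c (bbd_bmono 0 0)).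
by apply: eq_exb => v _; rewrite /bmono !expr0 !mulr1.
Qed.

Lemma le_norm_exb M M' g h : bbd M g -> bbd M' h ->
  (forall v, D01 v -> `|g v| <= h v) -> `|beta_ex g| <= beta_ex h.
Proof.
move=> bg bh gh; rewrite ler_norml; apply/andP; split.
  rewrite -mulN1r -(exbZ _ bh); apply: (le_exb (bbdZ _ bh) bg) => v Dv.
  by have := gh v Dv; rewrite ler_norml; lra.
apply: (le_exb bg bh) => v Dv.
by have := gh v Dv; rewrite ler_norml; lra.
Qed.

End beta_expectation.

(** * Bernstein operators as binomial expectations *)

Section bernstein.
Variable R : realType.
Implicit Types (v : R) (g : nat -> R).

Lemma pascal_sum (N : nat) (x : nat -> R) :
  \sum_(j < N.+2) 'C(N.+1, j)%:R * x j =
  \sum_(j < N.+1) 'C(N, j)%:R * (x j + x j.+1).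
Proof.
rewrite big_ord_recl bin0 mul1r.
under eq_bigr => i _ do rewrite /= /bump leq0n add1n binS natrD mulrDl.
rewrite big_split /= big_ord_recr /= bin_small // mul0r addr0 addrA.
under [RHS]eq_bigr => i _ do rewrite mulrDr.
rewrite [RHS]big_split /=; congr (_ + _).
rewrite [RHS]big_ord_recl /= bin0 mul1r; congr (_ + _).
Qed.

Definition Bern (N : nat) v g : R :=
  \sum_(j < N.+1) 'C(N, j)%:R * (v ^+ j * (1 - v) ^+ (N - j) * g j).

Lemma BernS N v g :
  Bern N.+1 v g = (1 - v) * Bern N v g + v * Bern N v (fun j => g j.+1).
Proof.
rewrite /Bern (pascal_sum N (fun j => v ^+ j * (1 - v) ^+ (N.+1 - j) * g j)).
rewrite !big_distrr -big_split /=; apply: eq_bigr => j _.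
rewrite subSS subSn; last by rewrite -ltnS.
by rewrite !exprS; ring.
Qed.

Lemma Bern0 v g : Bern 0 v g = g 0%N.
Proof. by rewrite /Bern big_ord1 bin0 !expr0 !mul1r. Qed.

Lemma Bern_cst N v c : Bern N v (fun=> c) = c.
Proof. by elim: N => [|N IH]; rewrite ?Bern0 // BernS IH; ring. Qed.

Lemma BernD N v g h : Bern N v (fun j => g j + h j) = Bern N v g + Bern N v h.
Proof. by rewrite /Bern -big_split; apply: eq_bigr => j _; rewrite /= !mulrDr. Qed.

Lemma BernZ N v c g : Bern N v (fun j => c * g j) = c * Bern N v g.
Proof. by rewrite /Bern big_distrr; apply: eq_bigr => j _; rewrite /=; ring. Qed.

(** Variance plus squared bias of a binomial law; the centre is left free because one more coin toss
    shifts it by 1. *)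
Lemma Bern_sqr N v c :
  Bern N v (fun j => (j%:R - c) ^+ 2) = N%:R * (v * (1 - v)) + (N%:R * v - c) ^+ 2.
Proof.
elim: N c => [|N IH] c; first by rewrite Bern0; ring.
rewrite BernS IH.
have -> : (fun j : nat => (j.+1%:R - c) ^+ 2) = (fun j : nat => (j%:R - (c - 1)) ^+ 2).
  by apply/funext => j; rewrite -natr1; ring.
by rewrite IH -natr1; ring.
Qed.

Lemma le_Bern N v g h : 0 <= v <= 1 ->
  (forall j, (j <= N)%N -> g j <= h j) -> Bern N v g <= Bern N v h.
Proof.
move=> /andP[v0 v1] gh; apply: ler_sum => j _; rewrite ler_wpM2l //.
rewrite ler_wpM2l //; last by apply: gh; rewrite -ltnS.
by rewrite mulr_ge0 // exprn_ge0 //; lra.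
Qed.

Lemma le_norm_Bern N v g h : 0 <= v <= 1 ->
  (forall j, (j <= N)%N -> `|g j| <= h j) -> `|Bern N v g| <= Bern N v h.
Proof.
move=> v01 gh; rewrite ler_norml; apply/andP; split.
  rewrite -mulN1r -BernZ; apply: le_Bern => // j /gh; rewrite ler_norml; lra.
by apply: le_Bern => // j /gh; rewrite ler_norml; lra.
Qed.

End bernstein.

(** * Splitting the Hoppe tree at vertex 1 *)

Section split.
Variables (R : realType) (theta : R).
Hypothesis theta_gt0 : 0 < theta.

Lemma bE_gsum (t : R) N F : 0 < t ->
  bE t N (gsum t F) = (t + N%:R) * bE t N.+1 F.
Proof.
move=> t0; rewrite /= -bEZ; apply: eq_bE => b _.
by rewrite mulrCA mulfV ?mulr1 // gt_eqF // ltr_wpDr.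
Qed.

Lemma gsum_bE (t t' : R) j (F : btree -> btree -> R) r :
  gsum t (fun r' => bE t' j (F r')) r = bE t' j (fun s => gsum t (fun r' => F r' s) r).
Proof.
rewrite /gsum; elim: (wsuccs t r) => [|p l IH].
  rewrite big_nil; under [bE _ _ _]eq_bE do rewrite big_nil -(mul0r 0).
  by rewrite bEZ mul0r.
rewrite big_cons IH.
under [bE _ _ (fun s => \sum_(_ <- _ :: _) _)]eq_bE do rewrite big_cons.
by rewrite bED bEZ.
Qed.

Definition bE2 (p q : nat) (F : btree -> btree -> R) : R :=
  bE theta q (fun r => bE 1 p (fun s => F r s)).

(** A two-colour Polya urn: when [j] of the [N] vertices after vertex 1 have joined its subtree [s],
    the parts have weights [theta + (N - j)] and [1 + j]. These are also their own normalising
    constants, so given the sizes both parts grow independently as a Hoppe tree and a random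
    recursive tree. The beta moments obey the same recursion as the urn. *)
Lemma bE_split_sum N (F : btree -> R) : bE theta N.+1 F =
  \sum_(j < N.+1) 'C(N, j)%:R *
    (beta_moment theta j (N - j) * bE2 j (N - j) (fun r s => F (Join r s))).
Proof.
elim: N F => [|N IH] F.
  rewrite big_ord1 bin0 mul1r bI0 // /bE2 /= gsum_leaf addr0.
  by rewrite mulrAC.
transitivity (bE theta N.+1 (fun b => gsum theta F b / (theta + N.+1%:R))); first by [].
rewrite IH.
rewrite (pascal_sum N (fun j => beta_moment theta j (N.+1 - j) * bE2 j (N.+1 - j)
  (fun r s => F (Join r s)))).
apply: eq_bigr => j _; congr (_ * _).
have jN : (j <= N)%N by rewrite -ltnS.
rewrite subSS subSn //.
set F2 := fun r s => F (Join r s).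
have s0 : 0 < theta + N.+1%:R by rewrite ltr_wpDr.
have -> : bE2 j (N - j) (fun r s => gsum theta F (Join r s) / (theta + N.+1%:R)) =
   (theta + N.+1%:R)^-1 * ((theta + (N - j)%:R) * bE2 j (N - j).+1 F2
     + (1 + j%:R) * bE2 j.+1 (N - j) F2).
  rewrite /bE2 -bE_gsum // -bEZ -bED -bEZ; apply: eq_bE => r _.
  rewrite gsum_bE -bE_gsum // -bED -bEZ; apply: eq_bE => s _.
  by rewrite gsum_join mulrC.
have h1 := bI_rec theta_gt0 j (N - j); have h2 := bI_split theta_gt0 j (N - j).
rewrite subnKC // in h1.
have -> : beta_moment theta j.+1 (N - j) = (theta + N.+1%:R)^-1 * (j.+1%:R * beta_moment theta j (N - j)).
  by rewrite -h1 mulKf // gt_eqF.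
have -> : beta_moment theta j (N - j).+1 = (theta + N.+1%:R)^-1 *
    ((theta + (N - j)%:R) * beta_moment theta j (N - j)).
  have -> : beta_moment theta j (N - j).+1 = beta_moment theta j (N - j) - beta_moment theta j.+1 (N - j) by lra.
  apply: (mulfI (lt0r_neq0 s0)); rewrite mulrBr h1 mulVKf ?gt_eqF //.
  by rewrite natrB // -!natr1; ring.
by rewrite -!natr1; ring.
Qed.

Lemma bE_split N (F : btree -> R) : bE theta N.+1 F =
  beta_ex theta (fun v => Bern N v (fun j => bE2 j (N - j) (fun r s => F (Join r s)))).
Proof.
rewrite bE_split_sum /Bern.
pose A (j : nat) := bE2 j (N - j) (fun r s => F (Join r s)).
(* The induction runs over arbitrary lists of indices and carries the bound that additivity of the
   integral asks for. *)
have h (l : seq 'I_N.+1) : exists2 M, bbd M (fun v => \sum_(j <- l)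
     'C(N, j)%:R * (v ^+ j * (1 - v) ^+ (N - j) * A j)) &
   \sum_(j <- l) 'C(N, j)%:R * (beta_moment theta j (N - j) * A j) =
   beta_ex theta (fun v => \sum_(j <- l)
     'C(N, j)%:R * (v ^+ j * (1 - v) ^+ (N - j) * A j)).
  elim: l => [|j l [M bM E]].
    have e : (fun v : R => \sum_(j <- [::] : seq 'I_N.+1)
        'C(N, j)%:R * (v ^+ j * (1 - v) ^+ (N - j) * A j)) = (fun=> 0).
      by apply/funext => v; rewrite big_nil.
    by exists `|0 : R|; rewrite e; [exact: bbd_cst|rewrite big_nil exb_cst].
  have bm := bbdZ ('C(N, j)%:R * A j) (bbd_bmono R j (N - j)).
  have fE : (fun v => \sum_(i <- j :: l)
     'C(N, i)%:R * (v ^+ i * (1 - v) ^+ (N - i) * A i)) =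
     (fun v => 'C(N, j)%:R * A j * bmono j (N - j) v + \sum_(i <- l)
     'C(N, i)%:R * (v ^+ i * (1 - v) ^+ (N - i) * A i)).
    by apply/funext => v; rewrite big_cons /bmono; ring.
  exists (`|'C(N, j)%:R * A j| * 1 + M); rewrite fE; first exact: bbdD.
  rewrite big_cons E (exbD theta_gt0 bm bM) (exbZ theta_gt0 _ (bbd_bmono R j (N - j))).
  by rewrite -/(beta_moment _ _ _); ring.
by have [M _ E] := h (index_enum 'I_N.+1); exact: E.
Qed.

End split.

(** * Asymptotics of the means *)

Section digamma.
Variables (R : realType) (theta : R).
Hypothesis theta_gt0 : 0 < theta.
Local Notation psi := (digamma (theta + 1)).

Lemma ln_succ (n : nat) :
  (n.+2%:R^-1 : R) <= ln n.+2%:R - ln n.+1%:R <= (n.+1%:R^-1 : R).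
Proof.
have n1 : 0 < n.+1%:R :> R by [].
have n2_gt0 : 0 < n.+2%:R :> R by [].
have e : n.+2%:R = n.+1%:R + 1 :> R by rewrite natr1.
apply/andP; split.
  rewrite -lerN2 opprB -ln_div ?posrE //.
  rewrite (_ : n.+1%:R / n.+2%:R = 1 + - n.+2%:R^-1).
    by apply: le_ln1Dx; rewrite ltrN2 invf_lt1 // ltr1n.
  rewrite e; move: n1; set x := n.+1%:R => n1.
  by field; rewrite gt_eqF //; lra.
rewrite -ln_div ?posrE // (_ : n.+2%:R / n.+1%:R = 1 + n.+1%:R^-1).
  by apply: le_ln1Dx; rewrite (lt_trans _ (_ : 0 < _)) ?ltrN10 // invr_gt0.
rewrite e; move: n1; set x := n.+1%:R => n1.
by field; rewrite gt_eqF.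
Qed.

(** [digamma] is a bare [limn], so convergence has to be established. Past [n = 0], where the
    logarithm has its default value, the sequence [u] increases, while [u n + (theta + 2) / (n + 1)]
    decreases; the constant is the gap between [n + 1] and [theta + n + 3]. *)
Lemma digamma_cvg : (fun n : nat => ln n%:R - harm theta n.+1) @ \oo --> psi.
Proof.
have sE (n : nat) : \sum_(k < n.+1) (theta + 1 + k%:R)^-1 = harm theta n.+1.
  by apply: eq_bigr => k _; rewrite -addrA nat1r.
have -> : psi = limn (fun n : nat => ln n%:R - harm theta n.+1).
  by rewrite /digamma; congr (limn _); apply/funext => n; rewrite sE.
pose u (n : nat) : R := ln n.+1%:R - harm theta n.+2.
suff cu : cvgn u.
  have /cvg_ex[l ul] := cu.
  have cl : (fun n : nat => ln n%:R - harm theta n.+1) @ \oo --> l.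
    by rewrite -(cvg_shiftS (fun n : nat => ln n%:R - harm theta n.+1)).
  by apply/cvg_ex; exists l.
have ustep n : u n.+1 - u n = ln n.+2%:R - ln n.+1%:R - (theta + n.+3%:R)^-1.
  by rewrite /u (harmS _ n.+2); lra.
have t0 := theta_gt0.
have c1 n : 0 < n.+1%:R :> R by [].
apply: nondecreasing_is_cvgn.
  apply/nondecreasing_seqP => n; rewrite -subr_ge0 ustep.
  have /andP[h _] := ln_succ n.
  have : (theta + n.+3%:R)^-1 <= n.+2%:R^-1.
    have h3 : n.+2%:R <= theta + n.+3%:R by rewrite -[n.+3%:R]natr1; lra.
    by rewrite lef_pV2 ?posrE // (lt_le_trans _ h3).
  by move=> h2; rewrite subr_ge0 (le_trans h2).
exists (u 0%N + (theta + 2)) => _ [n _ <-].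
have : u n + (theta + 2) / n.+1%:R <= u 0%N + (theta + 2) / 1%:R.
  elim: n => [//|n IH]; apply: le_trans IH.
  have /andP[_ h] := ln_succ n; have := ustep n; move: h.
  have : n.+1%:R^-1 - (theta + n.+3%:R)^-1 <=
      (theta + 2) / n.+1%:R - (theta + 2) / n.+2%:R.
    rewrite -subr_ge0 -[n.+3%:R]natr1 -[n.+2%:R]natr1.
    have := c1 n; set x := n.+1%:R => x0.
    rewrite [X in 0 <= X](_ : _ = (theta + 2) * (theta + 1) /
      (x * (x + 1) * (theta + (x + 1 + 1)))); last by field; rewrite !gt_eqF //; lra.
    apply: divr_ge0; first by apply: mulr_ge0; lra.
    by apply: mulr_ge0; [apply: mulr_ge0; lra|lra].
  move: ((theta + 2) / n.+1%:R) ((theta + 2) / n.+2%:R) => p q.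
  by move: (u _) (u _) (ln _ - ln _) (_^-1) (_^-1) => *; lra.
have : 0 <= (theta + 2) / n.+1%:R by rewrite divr_ge0 // addr_ge0 // ltW.
by rewrite divr1; move: (_ / _) (u _) (u _) => *; lra.
Qed.

Lemma harm_ln_cvg : (fun N : nat => harm theta N - ln N.+1%:R) @ \oo --> - psi.
Proof.
have t0 := theta_gt0.
rewrite -(cvg_shiftS (fun N : nat => harm theta N - ln N.+1%:R)).
have z1 : (fun N : nat => ln N.+2%:R - ln N.+1%:R) @ \oo --> (0 : R).
  apply: (@squeeze_cvgr _ _ _ _ (cst 0) (@harmonic R)).
  - apply: nearW => n; have /andP[h1 h2] := ln_succ n.
    by rewrite /= h2 andbT; apply: le_trans h1; rewrite invr_ge0.
  - exact: cvg_cst.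
  - exact: cvg_harmonic.
have z2 : (fun N : nat => (theta + N.+2%:R)^-1) @ \oo --> (0 : R).
  apply: (@squeeze_cvgr _ _ _ _ (cst 0) (@harmonic R)).
  - apply: nearW => n; rewrite /= invr_ge0 addr_ge0 ?(ltW t0) //=.
    have h3 : n.+1%:R <= theta + n.+2%:R by rewrite -[n.+2%:R]natr1; lra.
    by rewrite lef_pV2 ?posrE // (lt_le_trans _ h3).
  - exact: cvg_cst.
  - exact: cvg_harmonic.
have d1 : (fun n : nat => ln n.+1%:R - harm theta n.+2) @ \oo --> psi.
  by rewrite (cvg_shiftS (fun n : nat => ln n%:R - harm theta n.+1)); exact: digamma_cvg.
have e N : harm theta N.+1 - ln N.+2%:R =
    - (ln N.+1%:R - harm theta N.+2) - (ln N.+2%:R - ln N.+1%:R) - (theta + N.+2%:R)^-1.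
  by rewrite (harmS _ N.+1); lra.
rewrite (funext e) (_ : - psi = - psi - 0 - 0); last by rewrite !subr0.
by apply: cvgB => //; apply: cvgB => //; exact: cvgN.
Qed.

(** [Lyap] decreases, so [(4 + harm)^2] is at most linear in [N]: a growth of order [sqrt N] is slow
    enough here. *)
Lemma harm_div_cvg0 : (fun N => harm theta N * harmonic N) @ \oo --> (0 : R).
Proof.
have t0 := theta_gt0.
pose C := (theta + 1) * Lyap theta 0.
have C0 : 0 <= C by rewrite mulr_ge0 ?Lyap_ge0 //; lra.
have Lmono N : Lyap theta N <= Lyap theta 0.
  elim: N => // N; apply: le_trans; have := Lyap_step N t0.
  have : 0 <= (1 + harm theta N) ^+ 2 / (theta + N.+1%:R) ^+ 2.
    by rewrite divr_ge0 ?sqr_ge0.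
  by lra.
have h N : (harm theta N * harmonic N) ^+ 2 <= C * harmonic N.
  have n1 : 1 <= N.+1%:R :> R by rewrite ler1n.
  rewrite /harmonic /= exprMn exprVn -ler_pdivlMr ?invr_gt0 ?exprn_gt0 //.
  rewrite invrK; have := Lmono N; rewrite /Lyap.
  rewrite ler_pdivrMr ?ltr_wpDr // => hl.
  have h0 := harm_ge0 N t0.
  apply: (@le_trans _ _ ((4 + harm theta N) ^+ 2)); first by nra.
  apply: (le_trans hl).
  rewrite /C; have L0 := Lyap_ge0 0 t0.
  have -> : (theta + 1) * Lyap theta 0 / N.+1%:R * N.+1%:R ^+ 2 =
    Lyap theta 0 * ((theta + 1) * N.+1%:R) by field; rewrite gt_eqF //; lra.
  by rewrite ler_wpM2l //; nra.
apply: (@squeeze_cvgr _ _ _ _ (cst 0) (fun N => Num.sqrt (C * harmonic N))).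
- apply: nearW => N; have p0 : 0 <= harm theta N * harmonic N.
    by rewrite mulr_ge0 ?harm_ge0 // /harmonic /= invr_ge0.
  rewrite p0 /= -(ger0_norm p0) -sqrtr_sqr ler_wsqrtr //.
- exact: cvg_cst.
- apply: sqrt_cvg0; rewrite -[X in _ --> X](mulr0 C).
  by apply: cvgM; [exact: cvg_cst|exact: cvg_harmonic].
Qed.

(** With [n = N + 1] vertices, the remainders in [E T / n = ln n - psi] and
    [E W / n^2 = ln n - psi - 2 / (theta + 1)]. *)
Definition errT N : R := meanT theta N / N.+1%:R - ln N.+1%:R + psi.
Definition errW N : R :=
  meanW theta N / N.+1%:R ^+ 2 - ln N.+1%:R + psi + 2 / (theta + 1).

Lemma errT_cvg0 : errT @ \oo --> (0 : R).
Proof.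
have t0 := theta_gt0.
have e N : errT N = (harm theta N - ln N.+1%:R + psi)
    + (theta - 1) * (harm theta N * harmonic N).
  rewrite /errT /meanT /harmonic /= -[N.+1%:R]natr1.
  have := ler0n R N; set l := ln _; set h := harm _ _; set p := psi.
  set x := N%:R => x0.
  by field; rewrite gt_eqF //; lra.
rewrite (funext e) (_ : 0 = (- psi + psi) + (theta - 1) * 0); last by ring.
apply: cvgD; first by apply: cvgD; [exact: harm_ln_cvg|exact: cvg_cst].
by apply: cvgM; [exact: cvg_cst|exact: harm_div_cvg0].
Qed.

Lemma errW_cvg0 : errW @ \oo --> (0 : R).
Proof.
have t0 := theta_gt0.
have hh : (@harmonic R) @ \oo --> (0 : R) by exact: cvg_harmonic.
pose k N := (2 * theta - 1) + theta * (theta - 1) * @harmonic R N.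
pose a N := 1 + (theta - 1) * @harmonic R N.
have e N : errW N = (harm theta N - ln N.+1%:R + psi)
    + k N * (harm theta N * harmonic N)
    - 2 / (theta + 1) * (k N * harmonic N) + 2 * (a N * harmonic N)
    - (theta - 1) * (a N * (harm theta N * harmonic N)).
  rewrite /errW /meanW /meanZ /meanT /k /a /harmonic /= -[N.+1%:R]natr1.
  have := ler0n R N; set l := ln _; set h := harm _ _; set p := psi.
  set x := N%:R => x0.
  by field; rewrite !gt_eqF //; lra.
have ck : k @ \oo --> (2 * theta - 1) + theta * (theta - 1) * 0.
  apply: cvgD; first exact: cvg_cst.
  by apply: cvgM => //; exact: cvg_cst.
have ca : a @ \oo --> 1 + (theta - 1) * 0.
  by apply: cvgD; [exact: cvg_cst|apply: cvgM => //; exact: cvg_cst].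
have hd := harm_div_cvg0.
rewrite (funext e) (_ : 0 = (- psi + psi)
   + ((2 * theta - 1) + theta * (theta - 1) * 0) * 0
   - 2 / (theta + 1) * (((2 * theta - 1) + theta * (theta - 1) * 0) * 0)
   + 2 * ((1 + (theta - 1) * 0) * 0)
   - (theta - 1) * ((1 + (theta - 1) * 0) * 0)); last by ring.
apply: cvgB; last by apply: cvgM; [exact: cvg_cst|exact: cvgM].
apply: cvgD; last by apply: cvgM; [exact: cvg_cst|exact: cvgM].
apply: cvgB; last by apply: cvgM; [exact: cvg_cst|exact: cvgM].
apply: cvgD; last exact: cvgM.
by apply: cvgD; [exact: harm_ln_cvg|exact: cvg_cst].
Qed.

End digamma.

(** * The toll of the normalised recursion *)

Lemma tollW_eq (R : realFieldType) (p k wr ws tr ts m1 m2 m3 m4 m5 : R) :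
  0 < p -> 0 < k -> let n := p + k in let x := k / n in
  (wr + ws + p * ts + k * tr + p * k - m5) / n ^+ 2 =
  ((1 - x) ^+ 2 * ((wr - m1) / p ^+ 2) + x * (1 - x) * ((tr - m3) / p))
  + (x ^+ 2 * ((ws - m2) / k ^+ 2) + x * (1 - x) * ((ts - m4) / k))
  + ((1 - x) ^+ 2 * (m1 / p ^+ 2) + x ^+ 2 * (m2 / k ^+ 2)
  + x * (1 - x) * (m3 / p) + x * (1 - x) * (m4 / k) + x * (1 - x) - m5 / n ^+ 2).
Proof. by move=> p0 k0; rewrite /=; field; rewrite !gt_eqF //; lra. Qed.

Lemma tollT_eq (R : realFieldType) (p k tr ts m3 m4 m5 : R) :
  0 < p -> 0 < k -> let n := p + k in let x := k / n in
  (tr + ts + k - m5) / n = (1 - x) * ((tr - m3) / p) + x * ((ts - m4) / k)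
  + ((1 - x) * (m3 / p) + x * (m4 / k) + x - m5 / n).
Proof. by move=> p0 k0; rewrite /=; field; rewrite !gt_eqF //; lra. Qed.

Lemma size_split (R : pzSemiRingType) N j : (j <= N)%N ->
  N.+2%:R = (N - j).+1%:R + j.+1%:R :> R.
Proof. by move=> jN; rewrite -natrD; congr (_%:R); lia. Qed.

Section toll.
Variables (R : realType) (theta : R).
Hypothesis theta_gt0 : 0 < theta.

(* The tree has [N + 2] vertices, [j + 1] of them in the subtree of vertex 1. *)
Definition frac (N j : nat) : R := j.+1%:R / N.+2%:R.

(** The deterministic remainder after both parts and the whole have been centred and scaled. It
    depends on the tree only through the share [x] of the subtree of vertex 1. *)
Definition tollW N j : R := let x := frac N j in let q := (N - j)%N in
  (1 - x) ^+ 2 * (meanW theta q / q.+1%:R ^+ 2)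
  + x ^+ 2 * (meanW 1 j / j.+1%:R ^+ 2)
  + x * (1 - x) * (meanT theta q / q.+1%:R)
  + x * (1 - x) * (meanT 1 j / j.+1%:R)
  + x * (1 - x) - meanW theta N.+1 / N.+2%:R ^+ 2.

Definition tollT N j : R := let x := frac N j in let q := (N - j)%N in
  (1 - x) * (meanT theta q / q.+1%:R) + x * (meanT 1 j / j.+1%:R)
  + x - meanT theta N.+1 / N.+2%:R.

Lemma norm_join N j r s : (j <= N)%N -> bsize r = (N - j).+1 -> bsize s = j.+1 ->
  (nW theta N.+1 (Join r s), nT theta N.+1 (Join r s)) =
  Mleft (frac N j) (nW theta (N - j) r, nT theta (N - j) r)
  + Mright (frac N j) (nW 1 j s, nT 1 j s) + (tollW N j, tollT N j).
Proof.
move=> jN rN sN; rewrite /nW /nT /Mleft /Mright /tollW /tollT /frac /=.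
rewrite !(size_split R jN) !natrD !natrM rN sN.
by rewrite (tollW_eq _ _ _ _ (meanW theta (N - j)) (meanW 1 j)
  (meanT theta (N - j)) (meanT 1 j)) // (tollT_eq _ _ (meanT theta (N - j)) (meanT 1 j)).
Qed.

(** Here [b_hoppe] arises. As [(1 - x)^2 + x (1 - x) = 1 - x] and [x^2 + x (1 - x) = x], the
    logarithms of the sizes combine to [entropyE x] and the constants [psi] to their difference
    times [x]. In the first coordinate [x (1 - x)] and the constants [2 / (theta + 1)], equal to 1
    for the recursive tree, give the polynomial. Every coefficient of a remainder lies in
    [[0, 1]]. *)
Lemma toll_err N j : (j <= N)%N ->
  `|tollW N j - (b_hoppe theta (frac N j)).1| +
  `|tollT N j - (b_hoppe theta (frac N j)).2| <=
  `|errW theta (N - j)| + `|errW 1 j| + 2 * `|errT theta (N - j)| + 2 * `|errT 1 j|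
  + `|errW theta N.+1| + `|errT theta N.+1|.
Proof.
move=> jN; set x := frac N j; set q := (N - j)%N.
have p0 := ltr0Sn R q; have k0 := ltr0Sn R j; have n0 := ltr0Sn R N.+1.
have x0 : 0 < x by rewrite divr_gt0.
have xE : 1 - x = q.+1%:R / N.+2%:R.
  by rewrite /x /frac (size_split R jN); field; rewrite gt_eqF // addr_gt0.
have x1 : 0 < 1 - x by rewrite xE divr_gt0.
have lnx : ln x = ln j.+1%:R - ln N.+2%:R by rewrite ln_div ?posrE.
have ln1x : ln (1 - x) = ln q.+1%:R - ln N.+2%:R by rewrite xE ln_div ?posrE.
have dg : digamma (1 + 1) = digamma 2 :> R by congr digamma.
have t1 : theta + 1 != 0 by rewrite gt_eqF // addr_gt0.
have eW : tollW N j - (b_hoppe theta x).1 = (1 - x) ^+ 2 * errW theta q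
   + x ^+ 2 * errW 1 j + x * (1 - x) * errT theta q + x * (1 - x) * errT 1 j
   - errW theta N.+1.
  rewrite /tollW /errW /errT /b_hoppe /entropyE -/x -/q lnx ln1x dg /=.
  move: (meanW _ _ / _) (meanW _ _ / _) (meanW _ _ / _) (meanT _ _ / _).
  move: (meanT _ _ / _) (ln _) (ln _) (ln _) (digamma _) (digamma _).
  by move=> m4 l1 l2 l3 d1 d2 m1 m2 m5 m3; field.
have eT : tollT N j - (b_hoppe theta x).2 = (1 - x) * errT theta q
   + x * errT 1 j - errT theta N.+1.
  rewrite /tollT /errT /b_hoppe /entropyE -/x -/q lnx ln1x dg /=.
  move: (meanT _ _ / _) (meanT _ _ / _) (meanT _ _ / _).
  by move: (ln _) (ln _) (ln _) (digamma _) (digamma _) => l1 l2 l3 d1 d2 m1 m2 m3; ring.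
have bnd (c e : R) : 0 <= c <= 1 -> `|c * e| <= `|e|.
  by move=> /andP[c0 c1]; rewrite normrM ger0_norm // ler_piMl.
have h1 : `|(1 - x) ^+ 2 * errW theta q| <= `|errW theta q|.
  by apply: bnd; rewrite exprn_ge0 ?exprn_ile1 //; lra.
have h2 : `|x ^+ 2 * errW 1 j| <= `|errW 1 j|.
  by apply: bnd; rewrite exprn_ge0 ?exprn_ile1 //; lra.
have h3 : `|x * (1 - x) * errT theta q| <= `|errT theta q|.
  by apply: bnd; apply/andP; split; nra.
have h4 : `|x * (1 - x) * errT 1 j| <= `|errT 1 j|.
  by apply: bnd; apply/andP; split; nra.
have h5 : `|(1 - x) * errT theta q| <= `|errT theta q| by apply: bnd; lra.
have h6 : `|x * errT 1 j| <= `|errT 1 j| by apply: bnd; lra.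
rewrite eW eT.
have := ler_normB ((1 - x) ^+ 2 * errW theta q + x ^+ 2 * errW 1 j
  + x * (1 - x) * errT theta q + x * (1 - x) * errT 1 j) (errW theta N.+1).
have := ler_normD ((1 - x) ^+ 2 * errW theta q + x ^+ 2 * errW 1 j
  + x * (1 - x) * errT theta q) (x * (1 - x) * errT 1 j).
have := ler_normD ((1 - x) ^+ 2 * errW theta q + x ^+ 2 * errW 1 j)
  (x * (1 - x) * errT theta q).
have := ler_normD ((1 - x) ^+ 2 * errW theta q) (x ^+ 2 * errW 1 j).
have := ler_normB ((1 - x) * errT theta q + x * errT 1 j) (errT theta N.+1).
have := ler_normD ((1 - x) * errT theta q) (x * errT 1 j).
by lra.
Qed.

End toll.

(** * The fixed-point operator *)

Section operator.
Variables (R : realType) (theta : R).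
Hypothesis theta_gt0 : 0 < theta.
Local Notation D01 := (`]0, 1[%classic : set R).
Implicit Types (mu nu : probability (R * R)%type R) (f : R * R -> R) (v : R).
Implicit Types (x y c z : R * R) (L M : R).

Lemma add2E x y : x + y = (x.1 + y.1, x.2 + y.2).
Proof. by []. Qed.

(** The l1 norm of a matrix is its largest column sum; here these are [(1 - v)^2] and
    [v (1 - v) + (1 - v) = 1 - v^2]. *)
Lemma Mleft_contr v x y : 0 <= v <= 1 ->
  l1dist (Mleft v x) (Mleft v y) <= (1 - v ^+ 2) * l1dist x y.
Proof.
move=> v01; rewrite /l1dist /Mleft /=.
have -> : (1 - v) ^+ 2 * x.1 + v * (1 - v) * x.2 -
    ((1 - v) ^+ 2 * y.1 + v * (1 - v) * y.2) =
    (1 - v) ^+ 2 * (x.1 - y.1) + v * (1 - v) * (x.2 - y.2) by ring.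
rewrite -mulrBr [`|(1 - v) * _|]normrM [`|1 - v|]ger0_norm; last by lra.
have := ler_normD ((1 - v) ^+ 2 * (x.1 - y.1)) (v * (1 - v) * (x.2 - y.2)).
rewrite [`|(1 - v) ^+ 2 * _|]normrM [`|v * (1 - v) * _|]normrM.
rewrite [`|v * (1 - v)|]ger0_norm; last by nra.
rewrite [`|(1 - v) ^+ 2|]ger0_norm ?sqr_ge0 //.
have := normr_ge0 (x.1 - y.1); have := normr_ge0 (x.2 - y.2).
set p := `|x.1 - y.1|; set q := `|x.2 - y.2| => q0 p0 h.
apply: (le_trans (lerD h (lexx _))).
have : (1 - v) ^+ 2 * p <= (1 - v ^+ 2) * p by rewrite ler_wpM2r //; nra.
by nra.
Qed.

Lemma Mright_contr v x y : 0 <= v <= 1 ->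
  l1dist (Mright v x) (Mright v y) <= l1dist x y.
Proof.
move=> v01; rewrite /l1dist /Mright /=.
have -> : v ^+ 2 * x.1 + v * (1 - v) * x.2 - (v ^+ 2 * y.1 + v * (1 - v) * y.2) =
    v ^+ 2 * (x.1 - y.1) + v * (1 - v) * (x.2 - y.2) by ring.
rewrite -mulrBr [`|v * (x.2 - _)|]normrM [`|v|]ger0_norm; last by lra.
have := ler_normD (v ^+ 2 * (x.1 - y.1)) (v * (1 - v) * (x.2 - y.2)).
rewrite [`|v ^+ 2 * _|]normrM [`|v * (1 - v) * _|]normrM.
rewrite [`|v * (1 - v)|]ger0_norm; last by nra.
rewrite [`|v ^+ 2|]ger0_norm ?sqr_ge0 //.
have := normr_ge0 (x.1 - y.1); have := normr_ge0 (x.2 - y.2).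
set p := `|x.1 - y.1|; set q := `|x.2 - y.2| => q0 p0 h.
apply: (le_trans (lerD h (lexx _))).
have : v ^+ 2 * p <= 1 * p by rewrite ler_wpM2r //; nra.
have : (v * (1 - v) + v) * q <= 1 * q by rewrite ler_wpM2r //; nra.
by nra.
Qed.

Lemma l1distD x y c d : l1dist (x + c) (y + d) <= l1dist x y + l1dist c d.
Proof.
rewrite /l1dist !add2E /=.
have := ler_normD (x.1 - y.1) (c.1 - d.1).
have := ler_normD (x.2 - y.2) (c.2 - d.2).
have -> : x.1 + c.1 - (y.1 + d.1) = (x.1 - y.1) + (c.1 - d.1) by ring.
have -> : x.2 + c.2 - (y.2 + d.2) = (x.2 - y.2) + (c.2 - d.2) by ring.
by lra.
Qed.

Lemma l1dist_refl x : l1dist x x = 0.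
Proof. by rewrite /l1dist !subrr normr0 addr0. Qed.

(** The matrix entries change by [v - v'] times [2 - v - v'], [1 - v - v'], [v + v'] or 1, up to
    sign, so all column sums are at most [2 |v - v'|]. *)
Lemma M_param v v' x y c c' : 0 <= v <= 1 -> 0 <= v' <= 1 ->
  l1dist (Mleft v x + Mright v y + c) (Mleft v' x + Mright v' y + c') <=
  2 * `|v - v'| * (l1dist x 0 + l1dist y 0) + l1dist c c'.
Proof.
move=> v01 v01'.
apply: (le_trans (l1distD _ _ _ _)); rewrite lerD2r.
apply: (le_trans (l1distD _ _ _ _)); rewrite mulrDr.
have e0 := normr_ge0 (v - v').
have a1 : `|2 - v - v'| <= 2 by rewrite ler_norml; lra.
have a2 : `|1 - v - v'| <= 1 by rewrite ler_norml; lra.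
have a3 : `|v + v'| <= 2 by rewrite ler_norml; lra.
have aux (p q : R) a b : `|a| <= 2 -> `|b| <= 1 ->
   `|(v - v') * (a * p) + (v - v') * (b * q)| + `|(v - v') * q| <=
   2 * `|v - v'| * (`|p| + `|q|).
  move=> ha hb; have := ler_normD ((v - v') * (a * p)) ((v - v') * (b * q)).
  rewrite !normrM.
  have h1 : `|v - v'| * (`|a| * `|p|) <= `|v - v'| * (2 * `|p|).
    by rewrite ler_wpM2l // ler_wpM2r.
  have h2 : `|v - v'| * (`|b| * `|q|) <= `|v - v'| * (1 * `|q|).
    by rewrite ler_wpM2l // ler_wpM2r.
  by lra.
rewrite /l1dist /Mleft /Mright /= !subr0; apply: lerD.
  have := @aux x.1 x.2 (- (2 - v - v')) (1 - v - v').
  rewrite normrN => /(_ a1 a2).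
  have -> : (v - v') * (- (2 - v - v') * x.1) + (v - v') * ((1 - v - v') * x.2) =
    (1 - v) ^+ 2 * x.1 + v * (1 - v) * x.2 -
    ((1 - v') ^+ 2 * x.1 + v' * (1 - v') * x.2) by ring.
  by have -> : (1 - v) * x.2 - (1 - v') * x.2 = - ((v - v') * x.2);
    [ring|rewrite normrN].
have := @aux y.1 y.2 (v + v') (1 - v - v') a3 a2.
have -> : (v - v') * ((v + v') * y.1) + (v - v') * ((1 - v - v') * y.2) =
    v ^+ 2 * y.1 + v * (1 - v) * y.2 -
    (v' ^+ 2 * y.1 + v' * (1 - v') * y.2) by ring.
by have -> : v * y.2 - v' * y.2 = (v - v') * y.2 by ring.
Qed.

(** The toll [c] stays a free argument: it is [(tollW, tollT)] for finite trees and becomes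
    [b_hoppe] only in the limit. *)
Definition inner nu f v c x : R := ex nu (fun y => f (Mleft v x + Mright v y + c)).
Definition mix_op mu nu f v c : R := ex mu (inner nu f v c).

Lemma Lip_right L f v c : 0 <= L -> Lip L f -> 0 <= v <= 1 ->
  forall x, Lip L (fun y => f (Mleft v x + Mright v y + c)).
Proof.
move=> L0 fL v01 x y y'; apply: (le_trans (fL _ _)); rewrite ler_wpM2l //.
rewrite -/(l1dist _ _) -/(l1dist _ _).
apply: (le_trans (l1distD _ _ _ _)); rewrite l1dist_refl addr0.
by apply: (le_trans (l1distD _ _ _ _)); rewrite l1dist_refl add0r Mright_contr.
Qed.

Lemma inner_Lip L f v c nu M : 0 <= L -> Lip L f -> (forall x, `|f x| <= M) ->
  0 <= v <= 1 -> Lip (L * (1 - v ^+ 2)) (inner nu f v c).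
Proof.
move=> L0 fL fM v01 x x'.
have i x0 : integ nu (fun y => f (Mleft v x0 + Mright v y + c)).
  apply: (@integ_bounded _ _ _ _ _ M); last by move=> y; exact: fM.
  exact: Lip_measurable (Lip_right c L0 fL v01 x0).
rewrite -(ex_cst nu (L * (1 - v ^+ 2) * (`|x.1 - x'.1| + `|x.2 - x'.2|))).
apply: le_norm_exB => //; first exact: integ_cst.
move=> y; apply: (le_trans (fL _ _)); rewrite -mulrA ler_wpM2l //.
rewrite -/(l1dist _ _) -/(l1dist _ _).
apply: (le_trans (l1distD _ _ _ _)); rewrite l1dist_refl addr0.
by apply: (le_trans (l1distD _ _ _ _)); rewrite l1dist_refl addr0 Mleft_contr.
Qed.

Lemma ex_bound d (T : measurableType d) (P : probability T R) (g : T -> R) (M : R) :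
  measurable_fun setT g -> (forall t, `|g t| <= M) -> `|ex P g| <= M.
Proof.
move=> mg gM; have ig := integ_bounded P mg gM.
rewrite -(ex_cst P M); apply: (le_trans (le_norm_ex ig)).
by apply: le_ex => //; [exact: integ_normr|exact: integ_cst].
Qed.

Lemma inner_bound L f v c nu M : 0 <= L -> Lip L f -> (forall x, `|f x| <= M) ->
  0 <= v <= 1 -> forall x, `|inner nu f v c x| <= M.
Proof.
move=> L0 fL fM v01 x; apply: ex_bound => [|y]; last exact: fM.
exact: Lip_measurable (Lip_right c L0 fL v01 x).
Qed.

Lemma Lip_weak L L' f : L <= L' -> Lip L f -> Lip L' f.
Proof.
by move=> LL fL x y; apply: (le_trans (fL x y)); rewrite ler_wpM2r ?addr_ge0.
Qed.

Definition l1_moment mu : R := ex mu (fun x => l1dist x 0).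

Definition first_moments mu : Prop :=
  integ mu (fun x => x.1) /\ integ mu (fun x => x.2).

Lemma integ_l1dist mu : first_moments mu -> integ mu (fun x => l1dist x 0).
Proof.
move=> [i1 i2]; apply: integD.
  by under eq_fun do rewrite subr0; exact: integ_normr.
by under eq_fun do rewrite subr0; exact: integ_normr.
Qed.

Lemma Gop_param L f M mu nu v v' c c' : 0 <= L -> Lip L f ->
  (forall x, `|f x| <= M) -> first_moments mu -> first_moments nu ->
  0 <= v <= 1 -> 0 <= v' <= 1 ->
  `|mix_op mu nu f v c - mix_op mu nu f v' c'| <=
  L * (2 * `|v - v'| * (l1_moment mu + l1_moment nu) + l1dist c c').
Proof.
move=> L0 fL fM fmu fnu v01 v01'.
have i w d : 0 <= w <= 1 -> integ mu (inner nu f w d).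
  move=> w01; apply: integ_bounded (inner_bound d nu L0 fL fM w01).
  exact: Lip_measurable (inner_Lip d nu L0 fL fM w01).
have imu := integ_l1dist fmu; have inu := integ_l1dist fnu.
have -> : L * (2 * `|v - v'| * (l1_moment mu + l1_moment nu) + l1dist c c') =
   ex mu (fun x => L * (2 * `|v - v'|) * l1dist x 0 +
     L * (2 * `|v - v'| * l1_moment nu + l1dist c c')).
  by rewrite exD; [rewrite exZ // ex_cst /l1_moment; ring|exact: integZ|exact: integ_cst].
apply: le_norm_exB; [exact: i|exact: i| |].
  by apply: integD; [exact: integZ|exact: integ_cst].
move=> x.
have -> : L * (2 * `|v - v'|) * l1dist x 0 + L * (2 * `|v - v'| * l1_moment nu + l1dist c c')
  = ex nu (fun y => L * (2 * `|v - v'|) * l1dist y 0 +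
     L * (2 * `|v - v'| * l1dist x 0 + l1dist c c')).
  by rewrite exD; [rewrite exZ // ex_cst /l1_moment; ring|exact: integZ|exact: integ_cst].
apply: le_norm_exB.
- apply: integ_bounded (fun y => fM _).
  exact: Lip_measurable (Lip_right c L0 fL v01 x).
- apply: integ_bounded (fun y => fM _).
  exact: Lip_measurable (Lip_right c' L0 fL v01' x).
- by apply: integD; [exact: integZ|exact: integ_cst].
move=> y; apply: (le_trans (fL _ _)); rewrite -/(l1dist _ _).
rewrite [leRHS](_ : _ = L * (2 * `|v - v'| * (l1dist x 0 + l1dist y 0) + l1dist c c')).
  by rewrite ler_wpM2l //; exact: M_param.
by ring.
Qed.

Lemma b_hoppe_cvg v : D01 v ->
  (fun t => l1dist (b_hoppe theta t) (b_hoppe theta v)) t @[t --> v] --> (0 : R).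
Proof.
rewrite /= in_itv /= => /andP[v0 v1].
have cl : (fun t : R => ln t) t @[t --> v] --> ln v by exact: continuous_ln.
have c1t : (fun t : R => 1 - t) t @[t --> v] --> 1 - v.
  by apply: cvgB; [exact: cvg_cst|exact: cvg_id].
have cl1 : (fun t : R => ln (1 - t)) t @[t --> v] --> ln (1 - v).
  apply: (cvg_comp _ _ c1t); apply: continuous_ln; lra.
have ct : (fun t : R => t) t @[t --> v] --> v by exact: cvg_id.
have cE : (fun t : R => entropyE t) t @[t --> v] --> entropyE v.
  by apply: cvgD; apply: cvgM.
have c2 : (fun t : R => (b_hoppe theta t).2) t @[t --> v] --> (b_hoppe theta v).2.
  apply: cvgD; first exact: cvgD.
  by apply: cvgM => //; exact: cvg_cst.
have c1 : (fun t : R => (b_hoppe theta t).1) t @[t --> v] --> (b_hoppe theta v).1.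
  apply: cvgD; last by apply: cvgM => //; exact: cvg_cst.
  apply: cvgD => //; apply: cvgM => //; apply: cvgB; first exact: cvg_cst.
  by apply: cvgM => //; exact: cvg_cst.
have z (g : R -> R) : g t @[t --> v] --> g v ->
    `|g t - g v| @[t --> v] --> (0 : R).
  move=> cg; apply/norm_cvg0P; rewrite -[X in _ --> X](subrr (g v)).
  by apply: cvgB => //; exact: cvg_cst.
rewrite -[X in _ --> X](addr0 0); apply: cvgD.
  exact: (z (fun t => (b_hoppe theta t).1)).
exact: (z (fun t => (b_hoppe theta t).2)).
Qed.

Definition beta_op mu nu f v : R := mix_op mu nu f v (b_hoppe theta v).

(** Measurability in [v] comes from continuity on the open interval, where the logarithms of
    [b_hoppe] are continuous and [Gop_param] controls the dependence on [v] and on the toll. *)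
Lemma GG_bbd L f M mu nu : 0 <= L -> Lip L f -> (forall x, `|f x| <= M) ->
  first_moments mu -> first_moments nu -> bbd M (beta_op mu nu f).
Proof.
move=> L0 fL fM fmu fnu; split; last first.
  move=> v; rewrite /= in_itv /= => v01.
  have {}v01 : 0 <= v <= 1 by lra.
  apply: ex_bound (inner_bound _ nu L0 fL fM v01).
  exact: Lip_measurable (inner_Lip _ nu L0 fL fM v01).
apply: open_continuous_measurable_fun; first exact: interval_open.
move=> v; rewrite inE => Dv; have := Dv; rewrite /= in_itv /= => /andP[v0 v1].
apply/cvgrPdist_le => e e0.
set K := l1_moment mu + l1_moment nu.
have lim0 : (fun t => L * (2 * `|v - t| * K +
      l1dist (b_hoppe theta v) (b_hoppe theta t))) t
    @[t --> v] --> (0 : R).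
  rewrite (_ : 0 = L * (2 * 0 * K + 0)); last by ring.
  apply: cvgM; first exact: cvg_cst.
  apply: cvgD; last first.
    under eq_fun do rewrite l1distC; exact: b_hoppe_cvg.
  apply: cvgM; last exact: cvg_cst.
  apply: cvgM; first exact: cvg_cst.
  apply/norm_cvg0P; rewrite -[X in _ --> X](subrr v).
  by apply: cvgB; [exact: cvg_cst|exact: cvg_id].
have := lim0 => /cvgrPdist_le/(_ e e0) near1.
near=> t.
apply: (le_trans (Gop_param _ _ L0 fL fM fmu fnu _ _)).
- lra.
- suff : 0 < t < 1 by lra.
  apply/andP; split; near: t.
    exact: lt_nbhsr.
  exact: lt_nbhsl.
have : `|0 - L * (2 * `|v - t| * K + l1dist (b_hoppe theta v) (b_hoppe theta t))| <= e.
  by near: t; exact: near1.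
rewrite sub0r normrN => h; apply: le_trans h; exact: ler_norm.
Unshelve. all: by end_near. Qed.

Lemma GG_moreau_cvg f M mu nu : continuous f -> (forall x, `|f x| <= M) ->
  forall v, D01 v ->
  [/\ forall x, integ nu (fun y => f (Mleft v x + Mright v y + b_hoppe theta v)),
      integ mu (inner nu f v (b_hoppe theta v)) &
      (fun k => beta_op mu nu (moreau f k) v) @ \oo --> beta_op mu nu f v].
Proof.
move=> cf fM v; rewrite /= in_itv /= => v01.
have {}v01 : 0 <= v <= 1 by lra.
set c := b_hoppe theta v.
have h1 x := @ex_bounded_cvg _ _ _ nu
  (fun k y => moreau f k (Mleft v x + Mright v y + c))
  (fun y => f (Mleft v x + Mright v y + c)) M
  (fun k => Lip_measurable (Lip_right c (ler0n R k) (moreau_Lip fM k) v01 x))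
  (fun k y => moreau_bounded fM k _) 
  (fun y => @moreau_cvg R f M fM cf (Mleft v x + Mright v y + c)).
have [mi ci] := @ex_bounded_cvg _ _ _ mu (fun k => inner nu (moreau f k) v c)
  (inner nu f v c) M
  (fun k => Lip_measurable (inner_Lip c nu (ler0n R k) (moreau_Lip fM k)
     (moreau_bounded fM k) v01))
  (fun k x => inner_bound c nu (ler0n R k) (moreau_Lip fM k)
     (moreau_bounded fM k) v01 x) (fun x => (h1 x).2).
split => //.
  by move=> x; apply: integ_bounded (fun y => fM _); exact: (h1 x).1.
apply: (integ_bounded _ mi) => x.
by apply: ex_bound (fun y => fM _); exact: (h1 x).1.
Qed.

Lemma GG_bc f M mu nu : continuous f -> (forall x, `|f x| <= M) ->
  first_moments mu -> first_moments nu ->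
  bbd M (beta_op mu nu f) /\
  (fun k => beta_ex theta (beta_op mu nu (moreau f k))) @ \oo --> beta_ex theta (beta_op mu nu f).
Proof.
move=> cf fM fmu fnu; apply: exb_cvg => // [k|v Dv].
  exact: GG_bbd (ler0n R k) (moreau_Lip fM k) (moreau_bounded fM k) fmu fnu.
by have [] := GG_moreau_cvg mu nu cf fM Dv.
Qed.

(** Bridge from the iterated extended-real integral of [fixed_point_eq] to the real-valued operator;
    boundedness of [f] makes all three integrals finite. *)
Lemma fixed_pointE f M mu nu : continuous f -> (forall x, `|f x| <= M) ->
  first_moments mu -> first_moments nu ->
  (\int[lebesgue_measure]_(v in `]0%R, 1%R[)
       ((beta1_dens theta v)%:E *
        \int[mu]_x \int[nu]_y
           (f (Mleft v x + Mright v y + b_hoppe theta v)%R)%:E)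
   = (beta_ex theta (beta_op mu nu f))%:E)%E.
Proof.
move=> cf fM fmu fnu; have [bG _] := GG_bc cf fM fmu fnu.
rewrite /beta_ex /Rintegral fineK; last first.
  apply: integrable_fin_num => //; exact: bbd_integrable bG.
apply: eq_integral => v; rewrite inE => Dv.
have [iy ix _] := GG_moreau_cvg mu nu cf fM Dv.
rewrite [in RHS]EFinM; congr (_ * _)%E; rewrite /beta_op /mix_op EFin_ex //.
by apply: eq_integral => x _; rewrite /inner EFin_ex.
Qed.

End operator.

(** * Passing to the limit in the recursion *)

Section recursion_limit.
Variables (R : realType) (theta : R).
Hypothesis theta_gt0 : 0 < theta.
Implicit Types (mu nu : probability (R * R)%type R) (f h : R * R -> R) (L M : R).

Definition rate (t : R) mu (delta : nat -> R) : Prop :=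
  forall L h M N, 0 <= L -> Lip L h -> (forall x, `|h x| <= M) ->
    `|bE t N (fun b => h (nW t N b, nT t N b)) - ex mu h| <= L * delta N.

(** Given [r], the law of [s] is replaced by [nu] with an error uniform in [r]; what remains is the
    function [inner] of [r], again Lipschitz with constant [L], and the law of [r] is replaced by
    [mu]. *)
Lemma split_close mu nu delta delta1 L f M N j :
  rate theta mu delta -> rate 1 nu delta1 ->
  0 <= L -> Lip L f -> (forall x, `|f x| <= M) -> (j <= N)%N ->
  `|bE2 theta j (N - j) (fun r s =>
      f (nW theta N.+1 (Join r s), nT theta N.+1 (Join r s)))
    - mix_op mu nu f (frac R N j) (tollW theta N j, tollT theta N j)| <=
  L * (delta (N - j)%N + delta1 j).
Proof.
move=> rmu rnu L0 fL fM jN; set x := frac R N j; set c := (tollW _ _ _, _).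
have n0 := ltr0Sn R N.+1.
have x01 : 0 <= x <= 1.
  apply/andP; split; first by rewrite divr_ge0.
  by rewrite ler_pdivrMr // mul1r ler_nat; lia.
have -> : bE2 theta j (N - j) (fun r s =>
      f (nW theta N.+1 (Join r s), nT theta N.+1 (Join r s))) =
   bE theta (N - j) (fun r => bE 1 j (fun s => f (Mleft x
     (nW theta (N - j) r, nT theta (N - j) r) + Mright x (nW 1 j s, nT 1 j s) + c))).
  by apply: eq_bE => r rN; apply: eq_bE => s sN; rewrite (norm_join theta jN rN sN).
have iL : Lip L (inner nu f x c).
  apply: Lip_weak (inner_Lip c nu L0 fL fM x01).
  by rewrite ler_piMr //; nra.
have ib := inner_bound c nu L0 fL fM x01.
have h2 := rmu L (inner nu f x c) M (N - j)%N L0 iL ib.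
apply: (le_trans (ler_distD (bE theta (N - j) (fun r =>
  inner nu f x c (nW theta (N - j) r, nT theta (N - j) r))) _ _)).
rewrite mulrDr addrC; apply: lerD => //.
rewrite -bEB; apply: (le_trans (le_norm_bE _ _ theta_gt0)).
rewrite -[leRHS](bE_cst (N - j) _ theta_gt0); apply: le_bE => // r _.
by have := rnu L _ M j L0 (Lip_right c L0 fL x01
    (nW theta (N - j) r, nT theta (N - j) r)) (fun y => fM _).
Qed.

Lemma Bern_frac_sqr N (v : R) : 0 <= v <= 1 ->
  Bern N v (fun j => (frac R N j - v) ^+ 2) <= N.+2%:R^-1.
Proof.
move=> v01; have n0 := ltr0Sn R N.+1.
have -> : (fun j => (frac R N j - v) ^+ 2) =
    (fun j => N.+2%:R ^- 2 * (j%:R - (N.+2%:R * v - 1)) ^+ 2).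
  apply/funext => j; rewrite /frac -[j.+1%:R]natr1.
  by move: n0; set n := N.+2%:R => n0; field; rewrite gt_eqF.
rewrite BernZ Bern_sqr.
have -> : N.+2%:R = N%:R + 2 :> R by rewrite -!natr1; ring.
have := ler0n R N; set n := N%:R => nn0.
have n2_gt0 : 0 < n + 2 by lra.
rewrite mulrC ler_pdivrMr ?exprn_gt0 //.
rewrite (_ : (n + 2)^-1 * (n + 2) ^+ 2 = n + 2); last by field; rewrite gt_eqF.
have : n * (v * (1 - v)) <= n * 1 by rewrite ler_wpM2l //; nra.
by nra.
Qed.

(** Chebyshev's argument: if [frac] is close to [v], both subtrees are large because [v] is inside
    the interval, and all errors are small; other indices are charged to the binomial variance. *)
Lemma Bern_split_cvg mu nu delta delta1 L f M :
  rate theta mu delta -> rate 1 nu delta1 ->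
  delta @ \oo --> (0 : R) -> delta1 @ \oo --> (0 : R) ->
  first_moments mu -> first_moments nu ->
  0 <= L -> Lip L f -> (forall x, `|f x| <= M) ->
  forall v, (`]0, 1[%classic : set R) v ->
  (fun N => Bern N v (fun j => bE2 theta j (N - j) (fun r s =>
     f (nW theta N.+1 (Join r s), nT theta N.+1 (Join r s))))) @ \oo -->
  beta_op theta mu nu f v.
Proof.
move=> rmu rnu d0 d10 fmu fnu L0 fL fM v Dv.
have := Dv; rewrite /= in_itv /= => /andP[v0 v1].
have v01 : 0 <= v <= 1 by lra.
pose g N j := bE2 theta j (N - j) (fun r s =>
     f (nW theta N.+1 (Join r s), nT theta N.+1 (Join r s))).
set G := beta_op theta mu nu f v.
have M0 : 0 <= M by apply: le_trans (fM 0).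
have gM N j : `|g N j| <= M.
  rewrite /g /bE2; apply: (le_trans (le_norm_bE _ _ theta_gt0)).
  rewrite -[leRHS](bE_cst (N - j) _ theta_gt0); apply: le_bE => // r _.
  apply: (le_trans (le_norm_bE _ _ ltr01)).
  by rewrite -[leRHS](bE_cst j _ (ltr01 : 0 < 1 :> R)); apply: le_bE => // s _.
have GM : `|G| <= M by have [_] := GG_bbd theta L0 fL fM fmu fnu; apply.
(* One null sequence that dominates each error contributed by a part of index [n], whichever side it
   is on. *)
pose w n : R := `|delta n| + `|delta1 n| + `|errW theta n| + `|errW 1 n|
  + 2 * `|errT theta n| + 2 * `|errT 1 n|.
have w0 : w @ \oo --> (0 : R).
  have z (u : nat -> R) : u @ \oo --> (0 : R) -> (fun n => `|u n|) @ \oo --> (0 : R).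
    by move=> u0; apply/(norm_cvg0P u).
  have t1 : 0 < 1 :> R by [].
  rewrite (_ : 0 = 0 + 0 + 0 + 0 + 2 * 0 + 2 * 0); last by ring.
  apply: cvgD; last by apply: cvgM; [exact: cvg_cst|apply/z/errT_cvg0].
  apply: cvgD; last by apply: cvgM; [exact: cvg_cst|apply/z/errT_cvg0].
  apply: cvgD; last by apply/z/errW_cvg0.
  apply: cvgD; last by apply/z/errW_cvg0.
  by apply: cvgD; exact: z.
pose K := 2 * (l1_moment mu + l1_moment nu).
have K0 : 0 <= K.
  by rewrite mulr_ge0 // addr_ge0 //; apply: ex_ge0 => x; exact: l1dist_ge0.
have key N j : (j <= N)%N -> `|g N j - G| <=
    L * (w (N - j)%N + w j + w N.+1 + K * `|frac R N j - v|
      + l1dist (b_hoppe theta (frac R N j)) (b_hoppe theta v)).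
  move=> jN; set x := frac R N j.
  have x01 : 0 <= x <= 1.
    apply/andP; split; first by rewrite divr_ge0.
    by rewrite ler_pdivrMr // mul1r ler_nat; lia.
  have h1 := split_close rmu rnu L0 fL fM jN.
  have h2 := Gop_param (tollW theta N j, tollT theta N j) (b_hoppe theta v)
    L0 fL fM fmu fnu x01 v01.
  apply: (le_trans (ler_distD (mix_op mu nu f x (tollW theta N j, tollT theta N j)) _ _)).
  apply: (le_trans (lerD h1 h2)); rewrite -mulrDr ler_wpM2l //.
  have h3 := toll_err theta_gt0 jN; rewrite -/x in h3.
  have h4 := l1dist_triangle (tollW theta N j, tollT theta N j)
     (b_hoppe theta x) (b_hoppe theta v).
  have h5 : l1dist (tollW theta N j, tollT theta N j) (b_hoppe theta x) <=
    `|errW theta (N - j)| + `|errW 1 j| + 2 * `|errT theta (N - j)| + 2 * `|errT 1 j|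
    + `|errW theta N.+1| + `|errT theta N.+1| by exact: h3.
  have h6 := ler_norm (delta (N - j)%N); have h7 := ler_norm (delta1 j).
  rewrite /w /K.
  have := normr_ge0 (delta N.+1); have := normr_ge0 (delta1 N.+1).
  have := normr_ge0 (delta j); have := normr_ge0 (delta1 (N - j)%N).
  have := normr_ge0 (errW theta j); have := normr_ge0 (errW (1 : R) (N - j)%N).
  have := normr_ge0 (errT theta j); have := normr_ge0 (errT (1 : R) (N - j)%N).
  have := normr_ge0 (errT theta N.+1); have := normr_ge0 (errT (1 : R) N.+1).
  have := normr_ge0 (errW (1 : R) N.+1).
  have -> : 2 * `|x - v| * (l1_moment mu + l1_moment nu) = 2 * (l1_moment mu + l1_moment nu) * `|x - v| by ring.
  move: (2 * (l1_moment mu + l1_moment nu) * `|x - v|) h4 h5 h6 h7.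
  move: (l1dist _ _) (l1dist _ _) (l1dist _ _).
  by move=> *; lra.
apply/cvgrPdist_le => eps eps0.
have L1 : 0 < L + 1 by lra.
(* The five terms of [key] get [e1] each and use half of [eps]; [L + 1] keeps the denominator
   positive. *)
pose e1 := eps / (2 * (5 * (L + 1))).
have e10 : 0 < e1 by rewrite divr_gt0 // !mulr_gt0.
have /cvgrPdist_le/(_ e1 e10)[K1 _ hw] := w0.
have hw' n : (K1 <= n)%N -> w n <= e1.
  by move=> /hw /=; rewrite sub0r normrN; apply: le_trans; exact: ler_norm.
have /cvgrPdist_le/(_ e1 e10) := b_hoppe_cvg theta Dv.
move=> /nbhs_ballP[eta1 /= eta10 hb].
(* The four bounds serve the continuity of [b_hoppe] at [v], the term [K * |frac - v|], and a share
   of at least [v / 2] and [(1 - v) / 2] for the two parts. *)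
pose eta := Num.min (Num.min (eta1 / 2) (e1 / (K + 1))) (Num.min (v / 2) ((1 - v) / 2)).
have K10 : 0 < K + 1 by lra.
have eta0 : 0 < eta.
  by rewrite !lt_min !divr_gt0 //; lra.
have eta_b : eta <= eta1 / 2 by rewrite !ge_min lexx.
have eta_K : eta <= e1 / (K + 1) by rewrite !ge_min lexx orbT.
have eta_v : eta <= v / 2 by rewrite !ge_min lexx !orbT.
have eta_1v : eta <= (1 - v) / 2 by rewrite !ge_min lexx !orbT.
have L5 : L * (5 * e1) <= eps / 2.
  have -> : eps / 2 = (L + 1) * (5 * e1) by rewrite /e1; field; rewrite gt_eqF.
  by apply: ler_wpM2r; [rewrite mulr_ge0 // ltW|lra].
have close N j : (K1 <= N)%N -> K1.+1%:R <= N.+2%:R * (v / 2) ->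
    K1.+1%:R <= N.+2%:R * ((1 - v) / 2) -> (j <= N)%N -> `|frac R N j - v| <= eta ->
    `|g N j - G| <= eps / 2.
  move=> KN Kv K1v jN fv; apply: (le_trans (key N j jN)).
  have n0 := ltr0Sn R N.+1.
  have := fv; rewrite ler_distl => /andP[f1 f2].
  have fE : frac R N j * N.+2%:R = j.+1%:R by rewrite /frac divfK // gt_eqF.
  have f1E : (1 - frac R N j) * N.+2%:R = (N - j).+1%:R.
    by rewrite mulrBl fE mul1r (size_split R jN) addrK.
  have jK : (K1 <= j)%N.
    rewrite -ltnS -(ler_nat R) -fE; apply: (le_trans Kv).
    by rewrite mulrC ler_wpM2r ?(ltW n0) //; lra.
  have qK : (K1 <= N - j)%N.
    rewrite -ltnS -(ler_nat R) -f1E; apply: (le_trans K1v).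
    by rewrite mulrC ler_wpM2r ?(ltW n0) //; lra.
  apply: le_trans L5; rewrite ler_wpM2l //.
  have h1 := hw' _ qK; have h2 := hw' _ jK; have h3 := hw' _ (leqW KN).
  have h4 : K * `|frac R N j - v| <= e1.
    apply: (@le_trans _ _ (K * (e1 / (K + 1)))).
      by rewrite ler_wpM2l // (le_trans fv).
    by rewrite mulrA ler_pdivrMr // mulrC ler_wpM2l ?(ltW e10) //; lra.
  have h5 : l1dist (b_hoppe theta (frac R N j)) (b_hoppe theta v) <= e1.
    have : ball v eta1 (frac R N j).
      rewrite /ball /= distrC; apply: (le_lt_trans fv); apply: (le_lt_trans eta_b); lra.
    move=> /hb /=; rewrite sub0r normrN; apply: le_trans; exact: ler_norm.
  by lra.
(* Chebyshev's constant: the trivial bound [2 * M] is at most [C] times the squared deviation as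
   soon as this deviation exceeds [eta]. *)
pose C := 2 * M / eta ^+ 2.
have C0 : 0 <= C by rewrite divr_ge0 ?sqr_ge0 // mulr_ge0.
near=> N.
have nearK : (K1 <= N)%N by near: N; exact: nbhs_infty_ge.
have nearv : K1.+1%:R <= N.+2%:R * (v / 2).
  rewrite -ler_pdivrMr; last by lra.
  apply: (@le_trans _ _ (N%:R)); last by rewrite ler_nat (leqW (leqnSn N)).
  by near: N; exact: nbhs_infty_ger.
have near1v : K1.+1%:R <= N.+2%:R * ((1 - v) / 2).
  rewrite -ler_pdivrMr; last by lra.
  apply: (@le_trans _ _ (N%:R)); last by rewrite ler_nat (leqW (leqnSn N)).
  by near: N; exact: nbhs_infty_ger.
have all_j j : (j <= N)%N -> `|g N j - G| <= eps / 2 + C * (frac R N j - v) ^+ 2.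
  move=> jN; have [fv|fv] := leP `|frac R N j - v| eta.
    apply: (le_trans (close N j nearK nearv near1v jN fv)).
    by rewrite lerDl mulr_ge0 // sqr_ge0.
  have : `|g N j - G| <= 2 * M.
    apply: (le_trans (ler_normB _ _)); have := gM N j; lra.
  move=> /le_trans; apply.
  have : 2 * M <= C * (frac R N j - v) ^+ 2.
    rewrite -[(frac R N j - v) ^+ 2]real_normK ?num_real //
      /C mulrAC ler_pdivlMr ?exprn_gt0 //.
    rewrite ler_wpM2l ?mulr_ge0 // ler_sqr ?nnegrE ?(ltW eta0) //; exact: ltW.
  by lra.
rewrite distrC -[G](Bern_cst N v).
rewrite (_ : Bern _ _ _ - Bern _ _ _ = Bern N v (fun j => g N j + -1 * G)); last first.
  by rewrite BernD BernZ mulN1r.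
apply: (@le_trans _ _ (Bern N v (fun j => eps / 2 + C * (frac R N j - v) ^+ 2))).
  by apply: le_norm_Bern => // j jN; rewrite mulN1r; exact: all_j.
rewrite BernD BernZ Bern_cst.
have h1 : C * Bern N v (fun j => (frac R N j - v) ^+ 2) <= C * N.+2%:R^-1.
  by rewrite ler_wpM2l // Bern_frac_sqr.
have h2 : C * N.+2%:R^-1 <= eps / 2.
  rewrite ler_pdivrMr // mulrC -ler_pdivrMr; last by lra.
  apply: (@le_trans _ _ (N%:R)); last by rewrite ler_nat (leqW (leqnSn N)).
  by near: N; exact: nbhs_infty_ger.
by apply: (le_trans (lerD (lexx _) (le_trans h1 h2))); rewrite -splitr.
Unshelve. all: by end_near. Qed.

Lemma bbd_Bern N (g : nat -> R) M : (forall j, `|g j| <= M) ->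
  bbd M (fun v => Bern N v g).
Proof.
move=> gM; split.
  apply: (measurable_funS measurableT) => //; rewrite /Bern.
  apply: measurable_sum => j; apply: measurable_funM => //.
  apply: measurable_funM => //; apply: measurable_funM; first exact: measurable_funX.
  by apply: measurable_funX; exact: measurable_funB.
move=> v; rewrite /= in_itv /= => v01; rewrite -[leRHS](Bern_cst N v).
by apply: le_norm_Bern => //; lra.
Qed.

Lemma fixed_point_Lip mu nu delta delta1 L f M :
  rate theta mu delta -> rate 1 nu delta1 ->
  delta @ \oo --> (0 : R) -> delta1 @ \oo --> (0 : R) ->
  first_moments mu -> first_moments nu ->
  0 <= L -> Lip L f -> (forall x, `|f x| <= M) ->
  ex mu f = beta_ex theta (beta_op theta mu nu f).
Proof.
move=> rmu rnu d0 d10 fmu fnu L0 fL fM.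
pose F N b := f (nW theta N b, nT theta N b).
have c1 : (fun N => bE theta N.+1 (F N.+1)) @ \oo --> ex mu f.
  rewrite (cvg_shiftS (fun N => bE theta N (F N))).
  apply/cvgrPdist_le => e e0.
  have Ld : (fun N => L * delta N) @ \oo --> (0 : R).
    by rewrite -(mulr0 L); apply: cvgM => //; exact: cvg_cst.
  have /cvgrPdist_le/(_ e e0) := Ld; apply: filterS => N.
  rewrite sub0r normrN distrC => h; apply: (le_trans (rmu L f M N L0 fL fM)).
  by apply: le_trans h; exact: ler_norm.
have gM N j : `|bE2 theta j (N - j) (fun r s => F N.+1 (Join r s))| <= M.
  rewrite /bE2; apply: (le_trans (le_norm_bE _ _ theta_gt0)).
  rewrite -[leRHS](bE_cst (N - j) _ theta_gt0); apply: le_bE => // r _.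
  apply: (le_trans (le_norm_bE _ _ ltr01)).
  by rewrite -[leRHS](bE_cst j _ (ltr01 : 0 < 1 :> R)); apply: le_bE => // s _; exact: fM.
have [_ c2] := exb_cvg theta_gt0 (fun N => bbd_Bern N (gM N))
  (Bern_split_cvg rmu rnu d0 d10 fmu fnu L0 fL fM).
have e N := bE_split theta_gt0 N (F N.+1).
by move: c1; rewrite (funext e) => c1; exact: cvg_unique c1 c2.
Qed.

End recursion_limit.

(** * Uniqueness and the main theorem *)

Section uniqueness.
Variables (R : realType) (theta : R).
Hypothesis theta_gt0 : 0 < theta.
Implicit Types (mu nu : probability (R * R)%type R) (f h : R * R -> R) (L M : R).

(** After integrating out [nu], a test function with constant [L] becomes, for each [v], one with
    constant [L (1 - v^2)]. Each use of the fixed-point equation thus gains the factor [c], the mean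
    of [1 - V^2], and the difference vanishes by iteration. *)
Lemma contraction_unique mu mu' nu :
  first_moments mu -> first_moments mu' -> first_moments nu ->
  (forall L f M, 0 <= L -> Lip L f -> (forall x, `|f x| <= M) ->
     ex mu f = beta_ex theta (beta_op theta mu nu f)) ->
  (forall L f M, 0 <= L -> Lip L f -> (forall x, `|f x| <= M) ->
     ex mu' f = beta_ex theta (beta_op theta mu' nu f)) ->
  forall L f M, 0 <= L -> Lip L f -> (forall x, `|f x| <= M) -> ex mu' f = ex mu f.
Proof.
move=> fmu fmu' fnu fix1 fix2.
pose c := 1 - beta_moment theta 2 0.
have t0 := theta_gt0.
have r1 := bI_rec t0 1 0; have r0 := bI_rec t0 0 0; have r00 := bI0 t0 0.
have cE : c = 1 - 2 / ((theta + 2) * (theta + 1)).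
  rewrite addr0 divff ?gt_eqF // in r00; rewrite r00 /= in r0.
  have e1 : beta_moment theta 1 0 = (theta + 1)^-1.
    apply: (mulfI (_ : theta + 1 != 0)); first by rewrite gt_eqF // addr_gt0.
    by rewrite r0 mulr1 mulfV // gt_eqF // addr_gt0.
  rewrite /c; congr (_ - _); rewrite e1 /= in r1.
  apply: (mulfI (_ : theta + 2 != 0)); first by rewrite gt_eqF // addr_gt0.
  by rewrite r1; field; rewrite !gt_eqF ?addr_gt0.
have c1 : 0 <= c < 1.
  have p : 0 < (theta + 2) * (theta + 1) by rewrite mulr_gt0 ?addr_gt0.
  rewrite cE; apply/andP; split; last by rewrite ltrBlDr ltrDl divr_gt0.
  by rewrite subr_ge0 ler_pdivrMr // mul1r; nra.
have exc : beta_ex theta (fun v : R => 1 - v ^+ 2) = c.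
  have := exbB t0 (bbd_cst (1 : R)) (bbd_bmono R 2 0).
  rewrite exb_cst // -/(beta_moment theta 2 0) -/c => <-; apply: eq_exb => v _.
  by rewrite /bmono expr0 mulr1.
pose K := l1_moment mu + l1_moment mu'.
have K0 : 0 <= K by rewrite addr_ge0 //; apply: ex_ge0 => x; exact: l1dist_ge0.
have bound m : forall L f M, 0 <= L -> Lip L f -> (forall x, `|f x| <= M) ->
    `|ex mu f - ex mu' f| <= c ^+ m * (L * K).
  (* The base case compares both laws with the point mass at the origin, which is where first
     moments are needed. *)
  elim: m => [|m IH] L f M L0 fL fM.
    have h (rho : probability (R * R)%type R) : first_moments rho ->
        `|ex rho f - f 0| <= L * l1_moment rho.
      move=> frho; have irho := integ_l1dist frho.
      rewrite -(ex_cst rho (f 0)) -exZ //; apply: le_norm_exB.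
      - exact: integ_bounded (Lip_measurable fL) fM.
      - exact: integ_cst.
      - exact: integZ.
      - by move=> x; exact: fL.
    have h1 := h _ fmu; have h2 := h _ fmu'.
    rewrite expr0 mul1r /K mulrDr.
    apply: (le_trans (ler_distD (f 0) _ _)); apply: lerD => //.
    by rewrite distrC.
  rewrite (fix1 L f M) // (fix2 L f M) //.
  have b1 := GG_bbd theta L0 fL fM fmu fnu; have b2 := GG_bbd theta L0 fL fM fmu' fnu.
  rewrite -(exbB t0 b1 b2).
  have bc : bbd 1 (fun v : R => 1 - v ^+ 2).
    split; first by apply: (measurable_funS measurableT) => //;
      apply: measurable_funB => //; exact: measurable_funX.
    by move=> v; rewrite /= in_itv /= => v01; rewrite ler_norml; nra.
  have -> : c ^+ m.+1 * (L * K) = beta_ex theta (fun v => c ^+ m * (L * K) * (1 - v ^+ 2)).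
    by rewrite (exbZ t0 _ bc) exc exprS; ring.
  have bB : bbd (M + `|-1| * M)
      (fun v => beta_op theta mu nu f v - beta_op theta mu' nu f v).
    rewrite (_ : (fun v => _) =
      (fun v => beta_op theta mu nu f v + -1 * beta_op theta mu' nu f v)).
      exact: bbdD b1 (bbdZ (-1) b2).
    by apply/funext => v; rewrite mulN1r.
  apply: (le_norm_exb t0 bB (bbdZ _ bc)) => v; rewrite /= in_itv /= => v01.
  have {}v01 : 0 <= v <= 1 by lra.
  have v2 : 0 <= 1 - v ^+ 2 by nra.
  have := IH (L * (1 - v ^+ 2)) (inner nu f v (b_hoppe theta v)) M
    (mulr_ge0 L0 v2) (inner_Lip _ nu L0 fL fM v01) (inner_bound _ nu L0 fL fM v01).
  by rewrite (_ : c ^+ m * (L * (1 - v ^+ 2) * K) = c ^+ m * (L * K) * (1 - v ^+ 2));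
    last by ring.
move=> L f M L0 fL fM; apply/eqP; rewrite eq_sym -subr_eq0 -normr_le0.
have cvg0 : (fun m => c ^+ m * (L * K)) @ \oo --> (0 : R).
  rewrite -(mul0r (L * K)); apply: cvgM; last exact: cvg_cst.
  by apply: cvg_expr; rewrite ger0_norm; lra.
by apply: (cvgr_to_ge cvg0); apply: nearW => m; exact: bound.
Qed.

End uniqueness.

Lemma finite_second_first (R : realType) (mu : probability (R * R)%type R) :
  finite_second_moments mu -> first_moments mu.
Proof.
move=> [i1 i2]; split; apply: sqi_integ; split => //; first exact: measurable_fst.
exact: measurable_snd.
Qed.

Lemma bounded_continuousP (R : realType) (L : R) (f : R * R -> R) M :
  Lip L f -> (forall x, `|f x| <= M) -> bounded_continuous f.
Proof. by move=> fL fM; split; [exact: Lip_continuous fL|exists M]. Qed.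

Theorem mainTheorem8 (R : realType) (theta : R)
  (nu : probability (R * R)%type R) :
  0 < theta ->
  (* nu = law of (W~, T~): the limit for the random recursive tree (theta = 1) *)
  cvg_dist_L2 (hoppe_normE 1) nu ->
  (* and (known input) the RRT fixed-point equation with U ~ U[0,1] *)
  centered_L2 nu ->
  fixed_point_eq (@unif_dens R) (@b_rrt R) nu nu nu ->
  exists mu : probability (R * R)%type R,
    cvg_dist_L2 (hoppe_normE theta) mu /\
    centered_L2 mu /\
    fixed_point_eq (beta1_dens theta) (b_hoppe theta) mu mu nu /\
    (forall mu' : probability (R * R)%type R,
        centered_L2 mu' ->
        fixed_point_eq (beta1_dens theta) (b_hoppe theta) mu' mu' nu ->
        forall A, measurable A -> mu' A = mu A).
Proof.
move=> t0 [nu_cvg _] [nu2 _] _.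
have [mu [cmu mom [delta d0 hd]]] := limit_law t0.
have [nu1 [_ _ [delta1 d10 hd1]]] := limit_law (@ltr01 R).
have fmu := finite_second_first cmu.1; have fnu := finite_second_first nu2.
have rmu : rate theta mu delta by move=> L h M N L0 hL _; exact: hd.
have bE_cvg (t : R) (t_gt0 : 0 < t) (rho : probability (R * R)%type R) dl :
    dl @ \oo --> (0 : R) -> rate t rho dl -> forall L h M, 0 <= L -> Lip L h ->
    (forall x, `|h x| <= M) ->
    (fun N => bE t N (fun b => h (nW t N b, nT t N b))) @ \oo --> ex rho h.
  move=> dl0 rr L h M L0 hL hM; apply/cvgrPdist_le => e e0.
  have Ld : (fun N => L * dl N) @ \oo --> (0 : R).
    by rewrite -(mulr0 L); apply: cvgM => //; exact: cvg_cst.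
  have /cvgrPdist_le/(_ e e0) := Ld; apply: filterS => N.
  rewrite sub0r normrN distrC => H; apply: (le_trans (rr L h M N L0 hL hM)).
  by apply: le_trans H; exact: ler_norm.
(* [nu] and the constructed [nu1] are limits of the same sequence, so they agree on bounded
   Lipschitz functions and share the rate. *)
have rnu : rate 1 nu delta1.
  move=> L h M N L0 hL hM.
  suff -> : ex nu h = ex nu1 h by exact: hd1.
  have c1 := bE_cvg 1 ltr01 nu1 delta1 d10 (fun L h M N L0 hL _ => hd1 L h N L0 hL)
    L h M L0 hL hM.
  have := nu_cvg h (bounded_continuousP hL hM).
  have ih : integ nu h by exact: integ_bounded (Lip_measurable hL) hM.
  rewrite -EFin_ex // -(cvg_shiftS (fun n => (hoppe_normE 1 n h)%:E)).
  under eq_fun do rewrite (hoppe_normE_bE ltr01).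
  by move=> /fine_cvg c2; exact: cvg_unique c2 c1.
have fixL L f M : 0 <= L -> Lip L f -> (forall x, `|f x| <= M) ->
    ex mu f = beta_ex theta (beta_op theta mu nu f).
  by move=> L0 fL fM; exact: (fixed_point_Lip t0 rmu rnu d0 d10 fmu fnu L0 fL fM).
exists mu; split; [|split => //; split].
- split; last first.
    by split; [exact: cmu.1|exact: mom].
  move=> f [cf [M fM]].
  have intf : integ mu f.
    by apply: integ_bounded fM; exact: continuous_measurable_fun2.
  rewrite -EFin_ex // -(cvg_shiftS (fun n => (hoppe_normE theta n f)%:E)).
  under eq_fun do rewrite (hoppe_normE_bE t0).
  apply: cvg_EFin; first exact: nearW.
  apply: (@portmanteau R mu (fun N f =>
    bE theta N (fun b => f (nW theta N b, nT theta N b))) _ _ _ f M cf fM).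
  + by move=> n g h gh; apply: le_bE => // b _; exact: gh.
  + by move=> n g; rewrite -mulN1r -bEZ; apply: eq_bE => b _; rewrite mulN1r.
  + exact: (bE_cvg theta t0 mu delta d0 rmu).
- move=> f [cf [M fM]].
  have intf : integ mu f.
    by apply: integ_bounded fM; exact: continuous_measurable_fun2.
  rewrite (fixed_pointE t0 cf fM fmu fnu) -EFin_ex //; congr EFin.
  (* The equation holds for every envelope of [f]; both sides converge as the Lipschitz constant
     grows. *)
  have [_ c1] := GG_bc t0 cf fM fmu fnu.
  have [_ c2] := ex_bounded_cvg mu (fun k => Lip_measurable (moreau_Lip fM k))
    (moreau_bounded fM) (moreau_cvg fM cf).
  have e k := fixL k%:R (moreau f k) M (ler0n R k) (moreau_Lip fM k)
    (moreau_bounded fM k).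
  by move: c2; rewrite (funext e) => c2; exact: cvg_unique c2 c1.
- move=> mu' cmu' fp' A mA.
  have fmu' := finite_second_first cmu'.1.
  apply: (eq_measure_Lip _ mA) => L f M L0 fL fM.
  apply: (contraction_unique t0 fmu fmu' fnu fixL _ L0 fL fM).
  move=> L' f' M' L0' fL' fM'.
  have intf : integ mu' f' by exact: integ_bounded (Lip_measurable fL') fM'.
  have := fp' f' (bounded_continuousP fL' fM').
  rewrite (fixed_pointE t0 (Lip_continuous fL') fM' fmu' fnu) -EFin_ex //.
  by move=> [].
Qed.
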